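(* Let $G$ be a free profinite abelian group of infinite rank. Then for every ordinal $\alpha$, the group $G_\alpha$ (the profinite completion of $G$ of order $\alpha$) is a free profinite abelian group, of rank $\omega_0(G_\alpha)$.
   Context: For an infinite cardinal $\mathbf{m}$, the free profinite abelian group of rank $\mathbf{m}$ is the free profinite abelian group on a set $X$ converging to $1$ with $|X|=\mathbf{m}$: it is a profinite abelian group $F$ with a continuous pointed map $i:X\cup\{\ast\}\to F$ from the one-point compactification of the discrete space $X$ (with $\ast$ sent to the identity), such that every continuous pointed map $f:X\cup\{\ast\}\to H$ to a profinite abelian group $H$ (with $\ast$ sent to the identity) factors as $f=\bar f\circ i$ for a unique continuous homomorphism $\bar f:F\to H$. Concretely it is $\prod_{\mathbf{m}}\widehat{\mathbb Z}$. For a profinite group $H$, $\omega_0(H)$ (the local weight) is the cardinality of the set of open normal subgroups of $H$. For an abstract group $\Gamma$, $\widehat{\Gamma}$ denotes its profinite completion, i.e. the inverse limit of all its finite quotients, with canonical homomorphism $\Gamma\to\widehat\Gamma$. A profinite group is called strongly complete if it equals its profinite completion (as an abstract group), equivalently if every subgroup of finite index is open. A free profinite abelian group of infinite rank is not strongly complete. Completions of higher order: for a nonstrongly complete profinite group $G$, define groups $G_\alpha$ and compatible homomorphisms $\varphi_{\gamma\beta}:G_\gamma\to G_\beta$ ($\gamma<\beta$) by transfinite recursion: $G_0=G$; if $\alpha=\beta+1$ then $G_\alpha=\widehat{G_\beta}$ (completion of $G_\beta$ as an abstract group), with $\varphi_{\beta\alpha}$ the canonical map and the other maps obtained by composition;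 if $\alpha$ is a limit ordinal then $G_\alpha=\widehat{H_\alpha}$, where $H_\alpha=\varinjlim_{\beta<\alpha}\{G_\beta,\varphi_{\gamma\beta}\}$ is the direct limit of abstract groups, and $\varphi_{\beta\alpha}$ is the composition $G_\beta\to H_\alpha\to\widehat{H_\alpha}$. *)

(* Defs.v *)
From HB Require Import structures.
From mathcomp Require Import all_boot all_order.
From mathcomp Require Import all_classical topology wochoice.
From mathcomp Require internal_Eqdep_dec.

Set Implicit Arguments.
Unset Strict Implicit.
Unset Printing Implicit Defensive.

Import Order.TTheory.
Local Open Scope classical_set_scope.
Local Open Scope quotient_scope.
Local Open Scope group_scope.

HB.structure Definition PreTopologicalGroup := {G of Topological G & Group G}.

HB.mixin Record PreTopologicalGroup_isTopologicalGroup G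
    of PreTopologicalGroup G := {
  mulg_continuous : continuous (fun x : G * G => x.1 * x.2);
  invg_continuous : continuous (fun x : G => x^-1)
}.

#[short(type="topologicalGroupType")]
HB.structure Definition TopologicalGroup :=
  {G of PreTopologicalGroup G & PreTopologicalGroup_isTopologicalGroup G}.

HB.mixin Record TopologicalGroup_isProfinite G of TopologicalGroup G := {
  profinite_compact : compact [set: G];
  profinite_hausdorff : hausdorff_space G;
  profinite_totally_disconnected : totally_disconnected [set: G]
}.

#[short(type="profiniteGroupType")]
HB.structure Definition ProfiniteGroup :=
  {G of TopologicalGroup G & TopologicalGroup_isProfinite G}.

Definition abelian_group (G : groupType) : Prop := forall x y : G, commute x y.

Definition topological_group_iso (G H : topologicalGroupType) (f : G -> H) :=
  {morph f : x y / x * y} /\ continuous f /\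
  exists2 g : H -> G, continuous g & cancel f g /\ cancel g f.

Definition normal_subgroup (G : groupType) (N : set G) : Prop :=
  [/\ N 1, forall x y, N x -> N y -> N (x * y),
      forall x, N x -> N x^-1 & forall x y, N x -> N (x ^ y)].

(* Finite index is finiteness of the set of left cosets. *)
Definition lcosets (G : groupType) (N : set G) : set (set G) :=
  range (fun g => [set g * n | n in N]).

Record fin_index_normal (G : groupType) := FinIndexNormal {
  fin_index_set :> set G;
  fin_indexP : normal_subgroup fin_index_set /\
               finite_set (lcosets fin_index_set)
}.

(* The abstract quotient group G / N, as classes for x^-1 * y \in N; it is given
   the discrete topology below. *)
Section Quotient.
Variables (G : groupType) (N : fin_index_normal G).

Let N1 : (N : set G) 1. Proof. by case: N => ? [] []. Qed.
Let NM x y : (N : set G) x -> (N : set G) y -> (N : set G) (x * y).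
Proof. by case: N => ? [] [] /= ? + *; apply. Qed.
Let NV x : (N : set G) x -> (N : set G) x^-1.
Proof. by case: N => ? [] [] /= ? ? + *; apply. Qed.
Let NJ x y : (N : set G) x -> (N : set G) (x ^ y).
Proof. by case: N => ? [] [] /= ? ? ? + *; apply. Qed.

Definition coset_rel : rel G := fun x y => `[< (N : set G) (x^-1 * y) >].

Let coset_rel_refl : reflexive coset_rel.
Proof. by move=> x; apply/asboolP; rewrite mulVg. Qed.
Let coset_rel_sym : symmetric coset_rel.
Proof.
suff H x y : coset_rel x y -> coset_rel y x by move=> x y; apply/idP/idP; apply: H.
by move=> /asboolP/NV; rewrite invgM invgK => ?; apply/asboolP.
Qed.
Let coset_rel_trans : transitive coset_rel.
Proof.
move=> y x z /asboolP xy /asboolP yz; apply/asboolP.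
by have := NM xy yz; rewrite -mulgA mulVKg.
Qed.

Definition coset_equiv := EquivRel coset_rel
  coset_rel_refl coset_rel_sym coset_rel_trans.

Definition quotient_group : Type := {eq_quot coset_equiv}.
HB.instance Definition _ := Choice.on quotient_group.
HB.instance Definition _ := EqQuotient.on quotient_group.

Local Notation Q := \pi_quotient_group.

Lemma quotient_eqP (x y : G) :
  Q x = Q y <-> (N : set G) (x^-1 * y).
Proof.
split=> [/eqmodP/asboolP//|Nxy]; apply/eqmodP; exact/asboolP.
Qed.

Lemma quotient_surj (x : quotient_group) : exists g, x = Q g.
Proof. by exists (repr x); rewrite reprK. Qed.

Definition quotient_mul (x y : quotient_group) : quotient_group :=
  Q (repr x * repr y).
Definition quotient_inv (x : quotient_group) : quotient_group := Q (repr x)^-1.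
Definition quotient_one : quotient_group := Q 1.

Let piM x y : quotient_mul (Q x) (Q y) = Q (x * y).
Proof.
rewrite /quotient_mul.
have /quotient_eqP + : Q (repr (Q x)) = Q x.
  by rewrite reprK.
have /quotient_eqP + : Q (repr (Q y)) = Q y.
  by rewrite reprK.
set y' := repr (Q y); set x' := repr (Q x) => yy xx; apply/quotient_eqP.
have := NM (NJ y' xx) yy; congr (N : set G).
by rewrite conjgE invgM -!mulgA mulVKg.
Qed.
Let piV x : quotient_inv (Q x) = Q x^-1.
Proof.
rewrite /quotient_inv.
have /quotient_eqP : Q (repr (Q x)) = Q x.
  by rewrite reprK.
set x' := repr _ => xx; apply/quotient_eqP.
by have := NJ x^-1 (NV xx); rewrite conjgE !invgM !invgK -mulgA mulVKg.
Qed.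

Let mulA : associative quotient_mul.
Proof.
move=> x y z; have [g ->] := quotient_surj x; have [h ->] := quotient_surj y.
by have [k ->] := quotient_surj z; rewrite !piM mulgA.
Qed.
Let mul1 : left_id quotient_one quotient_mul.
Proof. by move=> x; have [g ->] := quotient_surj x; rewrite piM mul1g. Qed.
Let mulr1 : right_id quotient_one quotient_mul.
Proof. by move=> x; have [g ->] := quotient_surj x; rewrite piM mulg1. Qed.
Let mulV : left_inverse quotient_one quotient_inv quotient_mul.
Proof. by move=> x; have [g ->] := quotient_surj x; rewrite piV piM mulVg. Qed.
Let mulrV : right_inverse quotient_one quotient_inv quotient_mul.
Proof. by move=> x; have [g ->] := quotient_surj x; rewrite piV piM mulgV. Qed.

HB.instance Definition _ :=
  isGroup.Build quotient_group mulA mul1 mulr1 mulV mulrV.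

Lemma quotient_piM : {morph Q : x y / x * y}.
Proof. by move=> x y; rewrite -piM. Qed.
Lemma quotient_pi1 : Q 1 = 1 :> quotient_group. Proof. by []. Qed.
Lemma quotient_piV x : Q x^-1 = (Q x)^-1.
Proof. by rewrite -piV. Qed.

HB.instance Definition _ :=
  DiscreteTopology.copy quotient_group (discrete_topology quotient_group).

Lemma finite_quotient : finite_set [set: quotient_group].
Proof.
have [_ fN] := fin_indexP N.
pose f (C : set G) : quotient_group := Q (xget 1 C).
suff -> : [set: quotient_group] = f @` lcosets N by exact: finite_image.
apply/seteqP; split=> // x _; exists [set repr x * n | n in N].
  by exists (repr x).
rewrite /f; case: xgetP => [y _ [n Nn <-]|/(_ (repr x)) []]; last first.
  by exists 1; rewrite ?mulg1.
rewrite -[RHS]reprK; apply/quotient_eqP; rewrite invgM -mulgA mulVg mulg1.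
exact: NV.
Qed.

End Quotient.

Section ProductGroup.
Variables (I : Type) (T : I -> groupType).

Definition prod_mul (x y : prod_topology T) : prod_topology T :=
  fun i => x i * y i.
Definition prod_inv (x : prod_topology T) : prod_topology T :=
  fun i => (x i)^-1.
Definition prod_one : prod_topology T := fun=> 1.

Let mulA : associative prod_mul.
Proof.
by move=> x y z; apply: functional_extensionality_dep => i; exact: mulgA.
Qed.
Let mul1 : left_id prod_one prod_mul.
Proof. by move=> x; apply: functional_extensionality_dep => i; exact: mul1g. Qed.
Let mulr1 : right_id prod_one prod_mul.
Proof. by move=> x; apply: functional_extensionality_dep => i; exact: mulg1. Qed.
Let mulV : left_inverse prod_one prod_inv prod_mul.
Proof. by move=> x; apply: functional_extensionality_dep => i; exact: mulVg. Qed.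
Let mulrV : right_inverse prod_one prod_inv prod_mul.
Proof. by move=> x; apply: functional_extensionality_dep => i; exact: mulgV. Qed.

HB.instance Definition _ := Choice.copy (prod_topology T) (forall i, T i).
HB.instance Definition _ :=
  isGroup.Build (prod_topology T) mulA mul1 mulr1 mulV mulrV.

End ProductGroup.

Section Completion.
Variable G : groupType.

Definition quotient_product : Type :=
  prod_topology (fun N : fin_index_normal G => quotient_group N).
HB.instance Definition _ := Topological.on quotient_product.
HB.instance Definition _ := Group.on quotient_product.

(* The inverse limit of the quotients G / N along the projections G / N -> G / M,
   g N |-> g M, for N included in M, with the topology induced by the product. *)
Definition compatible_families : set quotient_product :=
  [set x | forall N M : fin_index_normal G, N `<=` M ->
     forall g, x N = \pi_(quotient_group N) g -> x M = \pi_(quotient_group M) g].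

Definition profinite_completion : Type := compatible_families.
HB.instance Definition _ := Topological.on profinite_completion.
HB.instance Definition _ := SubChoice.on profinite_completion.

End Completion.
Arguments compatible_families : clear implicits.

HB.instance Definition _ (G : groupType) := gen_eqMixin (fin_index_normal G).
HB.instance Definition _ (G : groupType) :=
  gen_choiceMixin (fin_index_normal G).

Lemma to_prod_continuous (I : Type) (X : topologicalType)
    (T : I -> topologicalType) (f : X -> prod_topology T) :
  (forall i, continuous (fun x => f x i)) -> continuous f.
Proof.
move=> cf x; apply/cvg_sup => i U [_ [[W oW <-] /= Wfx] sU].
apply: (filterS sU); apply: (cf i x); exact: open_nbhs_nbhs.
Qed.

Section CompletionGroup.
Variable G : groupType.
Local Notation P := (profinite_completion G).
Local Notation Q N := (\pi_(quotient_group N)).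

Let compatibleP (x : quotient_product G) :
  x \in compatible_families G <-> forall N M : fin_index_normal G, N `<=` M ->
     forall g, x N = Q N g -> x M = Q M g.
Proof. by rewrite in_setE. Qed.

Lemma compatible_group_closed :
  group_closed (mem (compatible_families G)).
Proof.
split.
  apply/compatibleP => N M NM g.
  change (Q N 1 = Q N g -> Q M 1 = Q M g) => /quotient_eqP Ng.
  by apply/quotient_eqP; exact: NM.
move=> x y /compatibleP cx /compatibleP cy; apply/compatibleP => N M NM g.
have [a xa] := quotient_surj (x N); have [b yb] := quotient_surj (y N).
have -> : (x / y) N = x N / y N by [].
have -> : (x / y) M = x M / y M by [].
rewrite (cx _ _ NM _ xa) (cy _ _ NM _ yb) xa yb.
rewrite -!quotient_piV -!quotient_piM => /quotient_eqP Nab.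
by apply/quotient_eqP; exact: NM.
Qed.

HB.instance Definition _ := SubChoice_isSubGroup.Build _ _ P
  compatible_group_closed.

Lemma completion_mulE (x y : P) N :
  set_val (x * y) N = set_val x N * set_val y N.
Proof. by []. Qed.

Lemma completion_invE (x : P) N : set_val x^-1 N = (set_val x N)^-1.
Proof. by []. Qed.

Lemma completion_coord_continuous (N : fin_index_normal G) :
  continuous (fun x : P => set_val x N : quotient_group N).
Proof.
move=> x.
apply: (@continuous_comp P (quotient_product G) _ set_val (proj N)).
  exact: initial_continuous.
exact: proj_continuous.
Qed.

Lemma nbhs_completion_coord (x : P) N :
  nbhs x [set y : P | set_val y N = set_val x N].
Proof.
exact: (completion_coord_continuous (discrete_set1 (set_val x N))).
Qed.

Lemma to_completion_continuous (X : topologicalType) (f : X -> P) :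
  (forall N, continuous (fun x => set_val (f x) N : quotient_group N)) ->
  continuous f.
Proof.
move=> cf; apply: continuous_comp_initial; exact: to_prod_continuous.
Qed.

Let completion_mul_continuous : continuous (fun x : P * P => x.1 * x.2).
Proof.
apply: to_completion_continuous => N [x y] U /nbhs_singleton /= Uxy.
exists ([set z : P | set_val z N = set_val x N],
        [set z : P | set_val z N = set_val y N]).
  by split; exact: nbhs_completion_coord.
move=> [z t] [/= zx ty]; change (U (set_val z N * set_val t N)).
by rewrite zx ty.
Qed.

Let completion_inv_continuous : continuous (fun x : P => x^-1).
Proof.
apply: to_completion_continuous => N x U /nbhs_singleton /= Ux.
apply: filterS (nbhs_completion_coord x N) => y /= yx.
change (U (set_val y N)^-1); by rewrite yx.
Qed.

HB.instance Definition _ :=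
  PreTopologicalGroup_isTopologicalGroup.Build P
    completion_mul_continuous completion_inv_continuous.

Lemma compatible_families_closed : closed (compatible_families G).
Proof.
rewrite -[X in closed X]setCK closedC openE => x /existsNP[N].
move=> /existsNP[M] /not_implyP[NM] /existsNP[g] /not_implyP[xN xM].
have cQ K : nbhs x [set y : quotient_product G | y K = x K].
  exact: (@proj_continuous _ (fun N : fin_index_normal G => quotient_group N)
    K x _ (discrete_set1 (x K))).
rewrite /interior; have := @filterI _ (nbhs x) (nbhs_filter x) _ _ (cQ N) (cQ M).
apply: filterS => y [/= yN yM] cy; apply: xM.
by rewrite -yM; apply: cy NM _ _; rewrite yN.
Qed.

Let completion_compact : compact [set: P].
Proof.
have cA : compact (compatible_families G).
  apply: subclosed_compact compatible_families_closed _ (@subsetT _ _).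
  have := @tychonoff _ (fun N : fin_index_normal G => quotient_group N)
    (fun=> setT) (fun N => finite_compact (finite_quotient N)).
  by congr compact; apply/seteqP; split.
move=> F FF _.
have FA : F (set_val @^-1` compatible_families G).
  suff -> : set_val @^-1` compatible_families G = [set: P] by exact: filterT.
  by apply/seteqP; split=> // -[x Ax] _; exact: (set_mem Ax).
have [y [Ay cy]] := cA (set_val @ F) (fmap_proper_filter _ FF) FA.
exists (exist _ y (mem_set Ay)); split=> // B V FB [_ [[W oW <-] /= Wy] sV].
have [_ [[x Bx <-] Wx]] : (set_val @` B) `&` W !=set0.
  apply: cy; last exact: open_nbhs_nbhs.
  have : B `<=` set_val @^-1` (set_val @` B) by move=> x Bx; exists x.
  by move/filterS; apply.
by exists x; split=> //; exact: sV.
Qed.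

Let completion_zero_dimensional : zero_dimensional P.
Proof.
move=> x y /eqP xy.
have [N xyN] : exists N, set_val x N <> set_val y N.
  apply/existsNP => H; apply: xy; apply/val_inj.
  exact: functional_extensionality_dep.
exists ((fun z : P => set_val z N : quotient_group N) @^-1` [set set_val x N]).
split=> //=; last exact/nesym.
apply: preimage_clopen; last exact: completion_coord_continuous.
by split; [exact: discrete_open | exact: discrete_closed].
Qed.

Let completion_hausdorff : hausdorff_space P.
Proof.
move=> x y cxy; apply: contrapT => /eqP /completion_zero_dimensional.
move=> [U [[oU cU] Ux nUy]].
have [] := cxy U (~` U); [exact: open_nbhs_nbhs | | by move=> z []].
by apply: open_nbhs_nbhs; split=> //; exact: closed_openC.
Qed.

HB.instance Definition _ := TopologicalGroup_isProfinite.Build P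
  completion_compact completion_hausdorff
  (zero_dimension_totally_disconnected completion_zero_dimensional).

Let to_completion_subproof (g : G) :
  ((fun N => Q N g) : quotient_product G) \in compatible_families G.
Proof.
apply/mem_set => N M NM h /quotient_eqP Ngh; apply/quotient_eqP; exact: NM.
Qed.

Definition to_completion (g : G) : P :=
  exist (fun x => x \in compatible_families G) _ (to_completion_subproof g).

Let to_completionM : {morph to_completion : x y / x * y}.
Proof.
move=> x y; apply/val_inj/functional_extensionality_dep => N.
exact: quotient_piM.
Qed.

HB.instance Definition _ := isMultiplicative.Build G P to_completion
  to_completionM.

End CompletionGroup.

Local Open Scope order_scope.

(* Directed systems of abstract groups over a totally ordered index type. *)
Record group_system d (I : orderType d) := GroupSystem {
  system_obj :> I -> groupType;
  system_map : forall i j, i <= j -> system_obj i -> system_obj j;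
  system_mapM : forall i j (ij : i <= j), {morph system_map ij : x y / x * y};
  system_map_id : forall i (ii : i <= i) x, system_map ii x = x;
  system_map_comp : forall i j k (ij : i <= j) (jk : j <= k) (ik : i <= k) x,
    system_map jk (system_map ij x) = system_map ik x
}.

Section DirectLimit.
Context {d : Order.disp_t} {I : orderType d}.
Variables (S : group_system I).

Definition limit_rel : rel {i : I & S i} := fun x y =>
  `[< exists k (xk : tag x <= k) (yk : tag y <= k),
        system_map xk (tagged x) = system_map yk (tagged y) >].

Let limit_rel_refl : reflexive limit_rel.
Proof. by move=> x; apply/asboolP; exists (tag x), (lexx _), (lexx _). Qed.

Let limit_rel_sym : symmetric limit_rel.
Proof.
by move=> x y; apply/idP/idP => /asboolP[k [xk [yk e]]]; apply/asboolP;
  exists k, yk, xk.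
Qed.

Let limit_rel_trans : transitive limit_rel.
Proof.
move=> y x z /asboolP[k [xk [yk e1]]] /asboolP[l [yl [zl e2]]]; apply/asboolP.
have km : k <= Order.max k l by rewrite le_max lexx.
have lm : l <= Order.max k l by rewrite le_max lexx orbT.
exists (Order.max k l), (le_trans xk km), (le_trans zl lm).
rewrite -(system_map_comp xk km) -(system_map_comp zl lm) e1 -e2.
by rewrite !(system_map_comp _ _ (le_trans yk km)).
Qed.

Definition limit_equiv :=
  EquivRel limit_rel limit_rel_refl limit_rel_sym limit_rel_trans.

(* The direct limit is the disjoint union modulo equality at a later stage. The
   inhabitant I0 of the index type only serves to define the unit element. *)
Definition direct_limit (I0 : [set: I] !=set0) : Type :=
  {eq_quot limit_equiv}.

Variable I0 : [set: I] !=set0.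
Local Notation limit := (direct_limit I0).
HB.instance Definition _ := Choice.on limit.
HB.instance Definition _ := EqQuotient.on limit.

Definition to_limit (i : I) (x : S i) : limit :=
  \pi_(limit) (Tagged (fun i => S i) x).

Lemma to_limit_eqP i j (x : S i) (y : S j) :
  to_limit x = to_limit y <->
  exists k (ik : i <= k) (jk : j <= k), system_map ik x = system_map jk y.
Proof. by split=> [/eqmodP/asboolP//|?]; apply/eqmodP; exact/asboolP. Qed.

Lemma to_limit_surj (u : limit) : exists i (x : S i), u = to_limit x.
Proof.
by exists (tag (repr u)), (tagged (repr u)); rewrite /to_limit taggedK reprK.
Qed.

Lemma to_limit_map i j (ij : i <= j) (x : S i) :
  to_limit (system_map ij x) = to_limit x.
Proof.
apply/to_limit_eqP; exists j, (lexx j), ij; exact: system_map_id.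
Qed.

Let le_maxl (i j : I) : i <= Order.max i j. Proof. by rewrite le_max lexx. Qed.
Let le_maxr (i j : I) : j <= Order.max i j.
Proof. by rewrite le_max lexx orbT. Qed.

Definition limit_mul (u v : limit) : limit :=
  let x := repr u in let y := repr v in
  to_limit (system_map (le_maxl (tag x) (tag y)) (tagged x) *
            system_map (le_maxr (tag x) (tag y)) (tagged y)).
Definition limit_inv (u : limit) : limit :=
  to_limit (tagged (repr u))^-1.
Definition limit_one : limit := to_limit (1 : S (sval (cid I0))).

Let map1 i j (ij : i <= j) : system_map ij (1 : S i) = 1.
Proof.
by apply: (@mulgI _ (system_map ij (1 : S i))); rewrite -system_mapM !mulg1.
Qed.

Let mapV i j (ij : i <= j) (x : S i) : system_map ij x^-1 = (system_map ij x)^-1.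
Proof.
by apply: (@mulgI _ (system_map ij x)); rewrite -system_mapM !mulgV map1.
Qed.

Let reprP (u : limit) : u = to_limit (tagged (repr u)).
Proof. by rewrite /to_limit taggedK reprK. Qed.

Let limit_mulE i (x y : S i) :
  limit_mul (to_limit x) (to_limit y) = to_limit (x * y).
Proof.
rewrite /limit_mul.
have := esym (reprP (to_limit x)); have := esym (reprP (to_limit y)).
move: (repr (to_limit x)) (repr (to_limit y)) => [j x'] [k y'] /=.
move=> /to_limit_eqP[n [kn [inn yn]]] /to_limit_eqP[m [jm [im xm]]].
set l := Order.max j k.
have lp : l <= Order.max l (Order.max n m) by exact: le_maxl.
have np : n <= Order.max l (Order.max n m) by rewrite !le_max lexx !orbT.
have mp : m <= Order.max l (Order.max n m) by rewrite !le_max lexx !orbT.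
apply/to_limit_eqP; exists (Order.max l (Order.max n m)), lp, (le_trans im mp).
rewrite !system_mapM; congr (_ * _).
  rewrite (system_map_comp _ _ (le_trans jm mp)).
  by rewrite -(system_map_comp jm mp) xm (system_map_comp im mp (le_trans im mp)).
rewrite (system_map_comp _ _ (le_trans kn np)).
by rewrite -(system_map_comp kn np) yn (system_map_comp inn np (le_trans im mp)).
Qed.

Let limit_invE i (x : S i) : limit_inv (to_limit x) = to_limit x^-1.
Proof.
rewrite /limit_inv; have := esym (reprP (to_limit x)).
move: (repr (to_limit x)) => [j x'] /= /to_limit_eqP[n [jn [inn e]]].
by apply/to_limit_eqP; exists n, jn, inn; rewrite !mapV e.
Qed.

Let limit_oneE i : limit_one = to_limit (1 : S i).
Proof.
apply/to_limit_eqP; exists (Order.max (sval (cid I0)) i).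
by exists (le_maxl _ _), (le_maxr _ _); rewrite !map1.
Qed.

Let common (u v : limit) :
  exists i (x y : S i), u = to_limit x /\ v = to_limit y.
Proof.
have [i [x ->]] := to_limit_surj u; have [j [y ->]] := to_limit_surj v.
exists (Order.max i j), (system_map (le_maxl i j) x),
  (system_map (le_maxr i j) y).
by rewrite !to_limit_map.
Qed.

Let mulA : associative limit_mul.
Proof.
move=> u v w; have [i [x [y [-> ->]]]] := common u v.
have [j [z ->]] := to_limit_surj w.
rewrite -(to_limit_map (le_maxl i j) x) -(to_limit_map (le_maxl i j) y).
by rewrite -(to_limit_map (le_maxr i j) z) !limit_mulE mulgA.
Qed.
Let mul1 : left_id limit_one limit_mul.
Proof.
move=> u; have [i [x ->]] := to_limit_surj u.
by rewrite (limit_oneE i) limit_mulE mul1g.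
Qed.
Let mulr1 : right_id limit_one limit_mul.
Proof.
move=> u; have [i [x ->]] := to_limit_surj u.
by rewrite (limit_oneE i) limit_mulE mulg1.
Qed.
Let mulV : left_inverse limit_one limit_inv limit_mul.
Proof.
move=> u; have [i [x ->]] := to_limit_surj u.
by rewrite (limit_oneE i) limit_invE limit_mulE mulVg.
Qed.
Let mulrV : right_inverse limit_one limit_inv limit_mul.
Proof.
move=> u; have [i [x ->]] := to_limit_surj u.
by rewrite (limit_oneE i) limit_invE limit_mulE mulgV.
Qed.

HB.instance Definition _ :=
  isGroup.Build limit mulA mul1 mulr1 mulV mulrV.

Lemma to_limitM i : {morph @to_limit i : x y / x * y}.
Proof. by move=> x y; rewrite -limit_mulE. Qed.

End DirectLimit.

(* The transition maps are homomorphisms of abstract groups: no continuity is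
   required (the canonical map from a profinite group to the profinite completion
   of its underlying abstract group is usually not continuous). *)
Record profinite_system d (I : orderType d) := ProfiniteSystem {
  profinite_obj :> I -> profiniteGroupType;
  profinite_map : forall i j, i <= j -> profinite_obj i -> profinite_obj j;
  profinite_mapM :
    forall i j (ij : i <= j), {morph profinite_map ij : x y / x * y};
  profinite_map_id : forall i (ii : i <= i) x, profinite_map ii x = x;
  profinite_map_comp :
    forall i j k (ij : i <= j) (jk : j <= k) (ik : i <= k) x,
      profinite_map jk (profinite_map ij x) = profinite_map ik x
}.

Section Below.
Context {d : Order.disp_t} {I : orderType d}.

(* The system of the groups of index < a. *)
Definition initial_segment (a : I) : Type := {b : I | b < a}.
HB.instance Definition _ a := SubChoice.on (initial_segment a).
HB.instance Definition _ a :=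
  [SubChoice_isSubOrder of initial_segment a by <: with d].

Definition below_system (T : profinite_system I) (a : I) :
    group_system (initial_segment a) :=
  @GroupSystem d (initial_segment a) (fun b => T (val b))
    (fun b c (bc : b <= c) => @profinite_map d I T (val b) (val c) bc)
    (fun b c bc => @profinite_mapM d I T (val b) (val c) bc)
    (fun b bb => @profinite_map_id d I T (val b) bb)
    (fun b c e bc ce be => @profinite_map_comp d I T _ _ _ bc ce be).

(* Zero, successor (a = b + 1) and limit elements of a well-ordered I. *)
Definition is_zero (a : I) : Prop := forall b, a <= b.
Definition is_succ (b a : I) : Prop := b < a /\ forall c, b < c -> a <= c.
Definition is_limit (a : I) : Prop := ~ is_zero a /\ forall b, ~ is_succ b a.

Lemma below_limit_neq0 (a : I) : is_limit a -> [set: initial_segment a] !=set0.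
Proof.
move=> [/existsNP[b /negP ab] _]; rewrite -ltNge in ab.
by exists (exist _ b ab).
Qed.

End Below.

(* f is the canonical map of G into its profinite completion P, up to a unique
   isomorphism of topological groups. *)
Definition is_profinite_completion (G : groupType) (P : profiniteGroupType)
    (f : G -> P) : Prop :=
  exists2 theta : profinite_completion G -> P,
    topological_group_iso theta & forall x, theta (to_completion x) = f x.

(* T is the system of the completions of higher order of G, indexed by the
   elements of a well-ordered type I, an element standing for the order type of
   the elements below it. Each group is prescribed up to topological isomorphism
   compatible with the transition maps. Such a system exists for every G and I:
   see completion_tower_exists. *)
Definition completion_tower d (I : orderType d) (G : profiniteGroupType)
    (T : profinite_system I) : Prop :=
  [/\ forall a, is_zero a ->
        exists theta : G -> T a, topological_group_iso theta,
      forall b a (ba : b <= a), is_succ b a ->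
        is_profinite_completion (@profinite_map d I T b a ba)
    & forall a (la : is_limit a),
        exists2 f : direct_limit (below_system T a) (below_limit_neq0 la) -> T a,
          is_profinite_completion f &
          forall (b : initial_segment a) (x : T (val b)),
            f (to_limit (S := below_system T a) _ x) =
            profinite_map (ltW (valP b)) x].

(* The point at infinity of the one-point compactification is None. *)
Definition free_profinite_abelian_on (X : choiceType) (F : profiniteGroupType)
    (i : one_point_compactification (discrete_topology X) -> F) : Prop :=
  [/\ abelian_group F, continuous i, i None = 1 &
      forall (H : profiniteGroupType)
             (f : one_point_compactification (discrete_topology X) -> H),
        abelian_group H -> continuous f -> f None = 1 ->
        exists! g : F -> H,
          [/\ {morph g : x y / x * y}, continuous g & forall x, f x = g (i x)]].

(* The rank, an infinite cardinal, is given as the cardinality of a set m. *)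
Definition free_profinite_abelian_of_rank (M : Type) (m : set M)
    (F : profiniteGroupType) : Prop :=
  infinite_set m /\
  exists2 X : choiceType, ([set: X] #= m)%card &
    exists i : one_point_compactification (discrete_topology X) -> F,
      free_profinite_abelian_on i.

(* The local weight of G is the cardinality of this set. *)
Definition open_normal_subgroups (G : profiniteGroupType) : set (set G) :=
  [set U | open U /\ normal_subgroup U].
Arguments open_normal_subgroups : clear implicits.

Section TowerExistence.
Variables (d : Order.disp_t) (I : orderType d).
Hypothesis wo : well_order (<=%O : rel I).
Variable G : profiniteGroupType.

Let wf : well_founded (fun b a : I => b < a).
Proof.
move=> a; apply: contrapT => nAa.
pose A : {pred I} := fun x => `[< ~ Acc (fun b a : I => b < a) x >].
have [|z [[zA zmin] _]] := wo (A := A); first by exists a; apply/asboolP.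
move/asboolP: zA; apply; constructor => y yz; apply: contrapT => nAy.
by have := zmin y (asboolT nAy); rewrite leNgt yz.
Qed.

Let elt := {K : profiniteGroupType & K}.
Let Elt (K : profiniteGroupType) (x : K) : elt :=
  existT (fun K : profiniteGroupType => K : Type) K x.

Let Elt_inj (K : profiniteGroupType) : injective (@Elt K).
Proof.
by move=> x y; apply: internal_Eqdep_dec.inj_pair2_eq_dec => L M; exact: pselect.
Qed.

(* A stage: the group, together with the maps into it from earlier stages; as
   the earlier groups are not visible to the recursion, these are recorded as
   functions on all pairs (group, element). *)
Let stage := {P : profiniteGroupType & I -> elt -> P}.

Let smap (s t : stage) (b : I) (x : projT1 s) : projT1 t := projT2 t b (Elt x).

Section Next.
Variables (a : I) (r : forall b, b < a -> stage).

Let obj (b : initial_segment a) := r (valP b).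

Definition stage_laws :=
  [/\ forall b c : initial_segment a, b <= c ->
        {morph @smap (obj b) (obj c) (val b) : x y / x * y},
      forall (b : initial_segment a) (x : projT1 (obj b)),
        @smap (obj b) (obj b) (val b) x = x &
      forall (b c e : initial_segment a) (x : projT1 (obj b)),
        b <= c -> c <= e ->
        @smap (obj c) (obj e) (val c) (@smap (obj b) (obj c) (val b) x) =
        @smap (obj b) (obj e) (val b) x].

Let stage_system (l : stage_laws) : group_system (initial_segment a) :=
  @GroupSystem d _ (fun b : initial_segment a => projT1 (obj b))
    (fun b c _ => @smap (obj b) (obj c) (val b))
    (let: And3 h _ _ := l in h)
    (fun b _ => let: And3 _ h _ := l in h b)
    (fun b c e bc ce _ x => let: And3 _ _ h := l in h b c e x bc ce).

Let next (w : stage) :=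
  [/\ forall x, @smap w w a x = x,
      forall b : initial_segment a,
        {morph @smap (obj b) w (val b) : x y / x * y},
      forall (b c : initial_segment a) (x : projT1 (obj b)), b <= c ->
        @smap (obj c) w (val c) (@smap (obj b) (obj c) (val b) x) =
        @smap (obj b) w (val b) x,
      forall (b : initial_segment a), is_succ (val b) a ->
        is_profinite_completion (@smap (obj b) w (val b))
    & (is_zero a ->
         exists theta : G -> projT1 w, topological_group_iso theta) /\
      forall (la : is_limit a) (l : stage_laws),
        exists2 f : direct_limit (stage_system l) (below_limit_neq0 la) ->
                    projT1 w,
          is_profinite_completion f &
          forall (b : initial_segment a) (x : projT1 (obj b)),
            f (to_limit (S := stage_system l) _ x) = @smap (obj b) w (val b) x].

Let mk (P : profiniteGroupType)
    (phi : forall b : initial_segment a, projT1 (obj b) -> P) : stage :=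
  existT _ P (fun c e => xget 1 [set y : P |
    (c = a /\ e = Elt y) \/
    exists (b : initial_segment a) (x : projT1 (obj b)),
      [/\ c = val b, e = Elt x & y = phi b x]]).

Let mk_self P phi x : @smap (@mk P phi) (@mk P phi) a x = x.
Proof.
rewrite /smap /=; case: xgetP => [y _ [[_ /Elt_inj //]|[b [z [ab]]]]|].
  by have : sval b < a := valP b; rewrite -ab ltxx.
by move=> /(_ x) /= []; left.
Qed.

Let mk_map P phi (b : initial_segment a) x :
  @smap (obj b) (@mk P phi) (val b) x = phi b x.
Proof.
rewrite /smap /=; case: xgetP => [y _ [[ba]|[c [z [bc]]]]|].
- by have : sval b < a := valP b; rewrite ba ltxx.
- have /val_inj ebc := bc; subst c.
  by move=> /Elt_inj -> ->.
- by move=> /(_ (phi b x)) /= []; right; exists b, x.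
Qed.

Let idiso (P : profiniteGroupType) : topological_group_iso (@id P).
Proof.
by split=> //; split=> [x|]; [exact: cvg_id | exists id => // x; exact: cvg_id].
Qed.

Let to_completion_completion (H : groupType) (f : H -> profinite_completion H) :
  f =1 @to_completion H -> is_profinite_completion f.
Proof. by move=> fE; exists id; [exact: idiso | move=> x; rewrite fE]. Qed.

Let next_zero : is_zero a -> exists w, next w.
Proof.
move=> a0; have noseg (b : initial_segment a) : False.
  by have : sval b < a := valP b; rewrite ltNge a0.
exists (mk (P := G) (fun b => False_rect _ (noseg b))); split.
- exact: mk_self.
- by move=> b; case: (noseg b).
- by move=> b; case: (noseg b).
- by move=> b; case: (noseg b).
- by split=> [_|[]//]; exists id; exact: idiso.
Qed.

Let next_succ (b0 : initial_segment a) : is_succ (val b0) a -> stage_laws ->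
  exists w, next w.
Proof.
move=> sb [lM lid lcomp].
have le0 (b : initial_segment a) : b <= b0.
  rewrite leNgt; apply/negP => /(proj2 sb); rewrite leNgt.
  by have : sval b < a := valP b; move=> ->.
pose phi (b : initial_segment a) (x : projT1 (obj b)) :=
  to_completion (@smap (obj b) (obj b0) (val b) x).
exists (mk phi); split.
- exact: mk_self.
- by move=> b x y; rewrite !mk_map /phi (lM _ _ (le0 b)) gmulfM.
- by move=> b c x bc; rewrite !mk_map /phi lcomp.
- move=> b sb'; have {sb'} -> : b = b0.
    apply/val_inj/le_anti/andP; split; first exact: le0.
    rewrite leNgt; apply/negP => /(proj2 sb'); rewrite leNgt.
    by have : sval b0 < a := valP b0; move=> ->.
  by apply: to_completion_completion => x; rewrite mk_map /phi lid.
- split=> [a0|[_ /(_ (val b0))]//].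
  by have : sval b0 < a := valP b0; rewrite ltNge a0.
Qed.

Let next_limit : is_limit a -> stage_laws -> exists w, next w.
Proof.
move=> la l.
pose L : groupType := direct_limit (stage_system l) (below_limit_neq0 la).
pose phi (b : initial_segment a) (x : projT1 (obj b)) : profinite_completion L :=
  to_completion (to_limit (S := stage_system l) (below_limit_neq0 la) x : L).
exists (@mk (profinite_completion L) phi); split.
- exact: mk_self.
- move=> b x y; rewrite !mk_map /phi -gmulfM; congr to_completion.
  exact: (to_limitM (S := stage_system l)).
- move=> b c x bc; rewrite !mk_map /phi; congr to_completion.
  exact: (to_limit_map (S := stage_system l) _ bc).
- by move=> b sb; have [_ /(_ (val b))] := la.
- split=> [a0|la' l']; first by have [] := la.
  rewrite (Prop_irrelevance la' la) (Prop_irrelevance l' l).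
  exists (@to_completion _); first exact: to_completion_completion.
  by move=> b x; rewrite mk_map.
Qed.

Let next_exists : stage_laws -> exists w, next w.
Proof.
move=> l; have [a0|na0] := pselect (is_zero a); first exact: next_zero.
have [[b sb]|ns] := pselect (exists b, is_succ b a).
  exact: (@next_succ (exist _ b (proj1 sb))).
by apply: next_limit => //; split=> // b sb; apply: ns; exists b.
Qed.

Definition next_stage : stage :=
  if pselect (exists w, next w) is left e then sval (cid e)
  else existT _ G (fun _ _ => 1).

Definition is_next := next.

Lemma next_stageP : stage_laws -> is_next next_stage.
Proof.
rewrite /next_stage => /next_exists; case: pselect => // e _.
exact: svalP (cid e).
Qed.

End Next.

Let stages : I -> stage := Fix wf (fun=> stage) next_stage.

Let stagesE a : stages a = next_stage (fun b (_ : b < a) => stages b).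
Proof.
apply: Fix_eq => x f g fg; congr next_stage.
by apply: functional_extensionality_dep => y; apply/funext => h; exact: fg.
Qed.

Let good a := is_next (fun b (_ : b < a) => stages b) (stages a).

Let good_mapM b a : b <= a -> good a ->
  {morph @smap (stages b) (stages a) b : x y / x * y}.
Proof.
rewrite le_eqVlt => /predU1P[-> [self _ _ _ _]|ba [_ mapM _ _ _]] x y.
  by rewrite !self.
exact: (mapM (exist _ b ba)).
Qed.

Let good_map_id a : good a -> forall x, @smap (stages a) (stages a) a x = x.
Proof. by case. Qed.

Let good_map_comp b c a : b <= c -> c <= a -> good a -> forall x,
  @smap (stages c) (stages a) c (@smap (stages b) (stages c) b x) =
  @smap (stages b) (stages a) b x.
Proof.
move=> bc; rewrite le_eqVlt => /predU1P[-> [self _ _ _ _]|ca [_ _ comp _ _]] x.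
  by rewrite self.
exact: (comp (exist _ b (le_lt_trans bc ca)) (exist _ c ca)).
Qed.

Let stages_good a : good a.
Proof.
elim/(well_founded_ind wf): a => a IH.
rewrite /good stagesE; apply: next_stageP; split.
- by move=> b c bc; apply: good_mapM => //; exact: IH (valP c).
- by move=> b; apply: good_map_id; exact: IH (valP b).
- by move=> b c e x bc ce; apply: good_map_comp => //; exact: IH (valP e).
Qed.

Lemma completion_tower_exists :
  exists T : profinite_system I, completion_tower G T.
Proof.
pose T := @ProfiniteSystem d I (fun b => projT1 (stages b))
  (fun b a _ => @smap (stages b) (stages a) b)
  (fun b a ba => good_mapM ba (stages_good a))
  (fun a _ => good_map_id (stages_good a))
  (fun b c a bc ca _ => good_map_comp bc ca (stages_good a)).
exists T; split.
- by move=> a; have [_ _ _ _ []] := stages_good a.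
- move=> b a ba sb; have [_ _ _ /(_ (exist _ b (proj1 sb)) sb)] := stages_good a.
  by [].
- move=> a la; have [_ _ _ _ [_ /(_ la)]] := stages_good a.
  set l : stage_laws (fun b (_ : b < a) => stages b) := And3
    (fun (b c : initial_segment a) (bc : b <= c) =>
       good_mapM bc (stages_good (val c)))
    (fun b : initial_segment a => good_map_id (stages_good (val b)))
    (fun (b c e : initial_segment a) x (bc : b <= c) (ce : c <= e) =>
       good_map_comp bc ce (stages_good (val e)) x).
  by move=> /(_ l) H; exact: H.
Qed.

End TowerExistence.

(* Main.v *)
(* A free profinite abelian group F on X has coordinates F -> Zhat dual to its
   generators. They show that F is torsion-free, that its open subgroups are as many
   as the elements of X, and that |F / pF| = |F| = 2^|X| for every prime p.

   Conversely, let A be an infinite torsion-free abelian group with |A / pA| = |A| for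
   all p. Homomorphisms A -> Z / p lift to homomorphisms A -> Z_p, as a basis of A
   modulo p is a basis modulo p^k for every k. Since Hom(A, Z / p) has dimension 2^|A|
   for every p, bases for all p can be indexed by the power set of A and glued to
   homomorphisms A -> Zhat. Every homomorphism from A to a finite abelian group K is
   then uniquely a finite combination of these with coefficients in K. Reading off the
   coefficients of A -> A / N, for all N of finite index, gives generators of the
   completion of A, which is therefore free on the power set of A.

   It remains to see that the condition on A passes through the tower. Completion is
   injective modulo p, because A / pA is residually finite, and it is not surjective
   modulo p, by Cantor's theorem. Hence a limit H of the tower satisfies |H| <= |H / pH|,
   because both its length and its terms embed in H / pH. *)

From HB Require Import structures.
Require Import Defs.
From mathcomp Require Import all_boot all_order all_algebra.
From mathcomp Require Import all_classical topology wochoice zify ring.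

Set Implicit Arguments.
Unset Strict Implicit.
Unset Printing Implicit Defensive.

Import Order.TTheory GRing.Theory.
Local Open Scope classical_set_scope.
Local Open Scope quotient_scope.
Local Open Scope ring_scope.

(** * Cardinality *)

(** For a torsion-free A the completion is a product over the primes p of powers of Z_p, with
    exponent dim Hom(A, Z / p) at p. It is free only if this exponent is the same for all p, which
    torsion-freeness alone does not ensure; the hypothesis |A / pA| = |A| forces the value 2^|A|
    everywhere. The condition has to concern abstract groups, since the direct limits at limit
    stages carry no topology. It is phrased by a self-map with pairwise incongruent values, so that
    of cardinal arithmetic little more than |A x A| = |A| is used.

    Z_p and Zhat are never constructed: a homomorphism to Zhat is a family of integer-valued maps
    indexed by n, each additive modulo n, compatible along divisibility. Likewise a homomorphism to
    B / N is a map to B that is additive modulo N. All identities are thus memberships in a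
    subgroup. *)

Definition embeds (T U : Type) : Prop := exists f : T -> U, injective f.

Lemma embeds_trans (T U V : Type) : embeds T U -> embeds U V -> embeds T V.
Proof. by move=> [f fI] [g gI]; exists (g \o f); exact: inj_comp. Qed.

Lemma embeds_prod (T T' U U' : Type) :
  embeds T T' -> embeds U U' -> embeds (T * U) (T' * U').
Proof.
by move=> [f fI] [g gI]; exists (fun x => (f x.1, g x.2)) => -[a b] [c d] [/fI-> /gI->].
Qed.

Lemma embeds_set (T U : Type) : embeds T U -> embeds (set T) (set U).
Proof.
move=> [f fI]; exists (fun A => f @` A) => A B AB.
apply/seteqP; split=> x Ax.
  by have : (f @` A) (f x); [exists x|rewrite AB => -[y By /fI <-]].
by have : (f @` B) (f x); [exists x|rewrite -AB => -[y By /fI <-]].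
Qed.

Lemma Cantor_embeds (T : Type) : ~ embeds (set T) T.
Proof.
move=> [f fI]; pose D := [set x | exists2 A, f A = x & ~ A x].
have [|nDD] := pselect (D (f D)); last by apply: (nDD); exists D.
by move=> /[dup] DD [A /fI -> ].
Qed.

Lemma card_le_embeds (T U : Type) : ([set: T] #<= [set: U])%card <-> embeds T U.
Proof.
split=> [/card_leP[f]|[f fI]]; last first.
  have fE : (range f #= [set: T])%card by apply: inj_card_eq => x y _ _ /fI.
  by apply: card_le_trans (card_leT (range f)); have := fE; rewrite card_eq_le => /andP[].
exists (fun x => val (f (SigSub (in_setT x)))) => x y /val_inj.
by move=> /(@inj _ _ _ f); rewrite !inE => /(_ I I) [].
Qed.

Lemma infinite_embeds (T : Type) : infinite_set [set: T] <-> embeds nat T.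
Proof. by rewrite infiniteP card_le_embeds. Qed.

(** By Zorn's lemma there is a maximal graph of a partial bijection. If it missed a point on each
    side, that pair could be added. *)
Lemma embeds_total (T U : Type) : embeds T U \/ embeds U T.
Proof.
pose P (R : set (T * U)) := forall s t, R s -> R t -> s.1 = t.1 <-> s.2 = t.2.
have [F FP Ftot|R [RP Rmax]] := @Zorn_bigcup _ P.
  move=> s t [A FA As] [B FB Bt].
  have [AB|BA] := Ftot _ _ FA FB.
    by apply: (FP _ FB) => //; exact: AB.
  by apply: (FP _ FA) => //; exact: BA.
have [Rl|/existsNP[a nRa]] := pselect (forall x, exists y, R (x, y)).
  left; exists (fun x => sval (cid (Rl x))) => x x'.
  case: cid => y /= Ry; case: cid => y' /= Ry' yy.
  exact/(RP _ _ Ry Ry').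
have [Rr|/existsNP[b nRb]] := pselect (forall y, exists x, R (x, y)).
  right; exists (fun y => sval (cid (Rr y))) => y y'.
  case: cid => x /= Rx; case: cid => x' /= Rx' xx.
  exact/(RP _ _ Rx Rx').
have [] := Rmax (R `|` [set (a, b)]).
  split=> [|/(_ (a, b)) Rab]; first exact: subsetUl.
  by apply: nRa; exists b; apply: Rab; right.
have nR z : R z -> (a <> z.1) /\ (b <> z.2).
  case: z => x y Rxy; split=> /= e; first by apply: nRa; exists y; rewrite e.
  by apply: nRb; exists x; rewrite e.
move=> s t [Rs|->] [Rt|->] //; first exact: RP.
- have [na nb] := nR _ Rs.
  by split=> /= /esym.
- by have [na nb] := nR _ Rt; split.
Qed.

Section Square.
Variables (T : Type) (g : nat -> T).
Hypothesis gI : injective g.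

(* Zorn's lemma is applied to the graphs of the injections Y * Y -> Y with Y a subset
   of T, all extending a fixed one on the range of g, so that Y is infinite. *)
Let ent (t : T * T * T) (u : T) := [\/ u = t.1.1, u = t.1.2 | u = t.2].

Let good (R : set (T * T * T)) :=
  (forall s t, R s -> R t -> s.1 = t.1 <-> s.2 = t.2) /\
  (forall s t u v, R s -> R t -> ent s u -> ent t v -> exists w, R (u, v, w)).

Let R0 : set (T * T * T) := range (fun p : nat * nat => (g p.1, g p.2, g (pickle p))).

Let good_R0 : good R0.
Proof.
split=> [_ _ [[a b] _ <-] [[c d] _ <-]/=|_ _ u v [[a b] _ <-] [[c d] _ <-]].
  by split=> [[/gI-> /gI->]//|/gI/(pcan_inj pickleK)[-> ->]].
have gE p (w : T) : ent (g p.1, g p.2, g (pickle p)) w -> exists n, w = g n.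
  by case=> ->; eexists.
by move=> /(gE (a, b))[n ->] /(gE (c, d))[m ->]; exists (g (pickle (n, m))); exists (n, m).
Qed.

Lemma embeds_square_nat : embeds (T * T) T.
Proof.
have [F FP Ftot|R [RP Rmax]] := @Zorn_bigcup _ (fun R => good (R0 `|` R)).
  have two s t : (R0 `|` \bigcup_(X in F) X) s -> (R0 `|` \bigcup_(X in F) X) t ->
      exists X, [/\ good (R0 `|` X), X `<=` \bigcup_(X in F) X,
                    (R0 `|` X) s & (R0 `|` X) t].
    move=> [Rs|[A FA As]] [Rt|[B FB Bt]].
    - exists set0; rewrite setU0; split=> //; exact: good_R0.
    - exists B; split; [exact: FP| exact: bigcup_sup|by left|by right].
    - exists A; split; [exact: FP| exact: bigcup_sup|by right|by left].
    - have [AB|BA] := Ftot _ _ FA FB.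
        exists B; split; [exact: FP| exact: bigcup_sup|right; exact: AB|by right].
      exists A; split; [exact: FP| exact: bigcup_sup|by right|right; exact: BA].
  split=> [s t us ut|s t u v us ut su tv].
    by have [X [[+ _] _ Xs Xt]] := two _ _ us ut; apply.
  have [X [[_ +] Xsub Xs Xt]] := two _ _ us ut.
  move=> /(_ _ _ _ _ Xs Xt su tv) [w [?|/Xsub ?]]; exists w; [by left|by right].
set Q := R0 `|` R in RP; have [Qf Qd] := RP.
pose Y u := exists2 t, Q t & ent t u.
have [f fP] : {f : T -> T -> T | forall u v, Y u -> Y v -> Q (u, v, f u v)}.
  have H (p : T * T) : exists w, Y p.1 -> Y p.2 -> Q (p.1, p.2, w).
    have [[[s Qs us] [t Qt vt]]|nY] := pselect (Y p.1 /\ Y p.2).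
      by have [w Qw] := Qd _ _ _ _ Qs Qt us vt; exists w.
    by exists (g 0) => Y1 Y2; case: nY.
  by exists (fun u v => sval (cid (H (u, v)))) => u v; exact: svalP (cid (H (u, v))).
have fY u v : Y u -> Y v -> Y (f u v).
  by move=> Yu Yv; exists (u, v, f u v); [exact: fP|constructor 3].
have fI u v u' v' : Y u -> Y v -> Y u' -> Y v' -> f u v = f u' v' -> u = u' /\ v = v'.
  move=> Yu Yv Yu' Yv' e.
  by have [_ /(_ e) /= []] := Qf _ _ (fP _ _ Yu Yv) (fP _ _ Yu' Yv').
have gY n : Y (g n).
  by exists (g n, g n, g (pickle (n, n))); [left; exists (n, n)|constructor 1].
(* If [Y] embeds in its complement by [j], the injection extends to the pairs from the union of [Y]
   and [j(Y)]: the three new kinds of pairs, told apart by the tag [c b b'], have room in [j(Y)].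
   This contradicts maximality. *)
have [[j0 jI]|[j0 jI]] := embeds_total {y | Y y} {y | ~ Y y}.
  pose j y := if pselect (Y y) is left h then sval (j0 (exist _ y h)) else y.
  have jE y (h : Y y) : j y = sval (j0 (exist _ y h)).
    by rewrite /j; case: pselect => // h'; rewrite (Prop_irrelevance h' h).
  have njY y : Y y -> ~ Y (j y) by move=> h; rewrite (jE _ h); exact: svalP (j0 _).
  have {}jI y y' : Y y -> Y y' -> j y = j y' -> y = y'.
    by move=> h h'; rewrite (jE _ h) (jE _ h') => /eq_sig_hprop/jI H; have [] := H (fun _ => @Prop_irrelevance _).
  pose pt (b : bool) y := if b then j y else y.
  have ptI b y b' y' : Y y -> Y y' -> pt b y = pt b' y' -> b = b' /\ y = y'.
    move=> h h'; case: b; case: b' => /=.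
    - by move/jI => ->.
    - by move=> e; have := njY _ h; rewrite e.
    - by move=> e; have := njY _ h'; rewrite -e.
    - by [].
  pose c (b b' : bool) : nat := (b + b'.*2)%N.
  pose v (b : bool) y (b' : bool) y' := if b || b' then f (f y y') (g (c b b')) else f y y'.
  have vY b y b' y' : Y y -> Y y' -> Y (v b y b' y').
    by move=> h h'; rewrite /v; case: ifP => _; apply: (fY) => //; exact: fY.
  pose E := [set t | exists b y b' y', [/\ Y y, Y y' &
                       t = (pt b y, pt b' y', pt (b || b') (v b y b' y'))]].
  have QE : Q `<=` E.
    move=> [[x y] z] Qxyz.
    have Yx : Y x by exists (x, y, z) => //; constructor 1.
    have Yy : Y y by exists (x, y, z) => //; constructor 2.
    exists false, x, false, y; split=> //=; congr (_, _, _).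
    by rewrite /v /=; apply/(Qf _ _ Qxyz (fP _ _ Yx Yy)).
  have [] := Rmax E.
    split=> [t Rt|/(_ (pt true (g 0), pt true (g 0), pt true (v true (g 0) true (g 0))))].
      by apply: QE; right.
    move=> ER; have /ER RE : E (pt true (g 0), pt true (g 0), pt true (v true (g 0) true (g 0))).
      by exists true, (g 0), true, (g 0).
    apply: (njY _ (gY 0)).
    by eexists; [right; exact: RE|constructor 1].
  rewrite setUidr; last by move=> t R0t; apply: QE; left.
  split=> [_ _ [b [y [b' [y' [Yy Yy' ->]]]]] [d [z [d' [z' [Yz Yz' ->]]]]]|].
    split=> [[/ptI[]// -> -> /ptI[]// -> ->]//|/=].
    move=> /ptI[]; [exact: vY|exact: vY|]; rewrite /v.
    case: ifPn => [bb|]; case: ifPn => [dd|] //.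
      move=> _ /fI[]; try exact: fY; try exact: gY.
      move=> /fI[]// -> -> /gI; rewrite /c => cc.
      by have [-> ->] : b = d /\ b' = d'
        by move: cc {bb dd}; case: b; case: b'; case: d; case: d'.
    by case: b b' d d' => [] [] [] [] //= _ _ _ /fI[] // -> ->.
  have entE (t : T * T * T) u : E t -> ent t u -> exists b y, Y y /\ u = pt b y.
    move=> [b [y [b' [y' [Yy Yy' ->]]]]] [] -> /=.
    - by exists b, y.
    - by exists b', y'.
    - by exists (b || b'), (v b y b' y'); split=> //; exact: vY.
  move=> s t u w Es Et /(entE _ _ Es)[b [y [Yy ->]]] /(entE _ _ Et)[b' [y' [Yy' ->]]].
  by exists (pt (b || b') (v b y b' y')); exists b, y, b', y'.
(* Now the complement embeds in [Y], so [h] embeds [T] in [Y]; the second arguments [g 0] and [g 1]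
   keep the two halves apart. *)
pose h x := if pselect (Y x) is right n then f (sval (j0 (exist _ x n))) (g 1) else f x (g 0).
have hY x : Y (h x).
  rewrite /h; case: pselect => Yx; apply: (fY) => //.
  exact: svalP (j0 _).
have hI : injective h.
  move=> x y; rewrite /h; case: pselect => Yx; case: pselect => Yy /fI[] //;
    try exact: (svalP (j0 _)).
  - by move=> _ /gI.
  - by move=> _ /gI.
  - by move=> /eq_sig_hprop/jI H; have [] := H (fun _ => @Prop_irrelevance _).
exists (fun p => f (h p.1) (h p.2)) => -[x y] [x' y'] /= e.
by have [/hI -> /hI ->] := fI _ _ _ _ (hY _) (hY _) (hY _) (hY _) e.
Qed.

End Square.

Lemma embeds_square (T : Type) : infinite_set [set: T] -> embeds (T * T) T.
Proof. by move=> /infinite_embeds[g gI]; exact: embeds_square_nat gI. Qed.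

Lemma embeds_prod_infinite (T U V : Type) : infinite_set [set: T] ->
  embeds U T -> embeds V T -> embeds (U * V) T.
Proof.
by move=> /embeds_square Tsq UT VT; apply: embeds_trans Tsq; exact: embeds_prod.
Qed.

(** A list is coded by its length and by iterated pairing. The length tells how often to unpair, so
    [g 0] can safely end every code. *)
Lemma embeds_seq (T U : Type) : infinite_set [set: T] -> embeds U T ->
  embeds (seq U) T.
Proof.
move=> iT [u uI]; have [q qI] := embeds_square iT.
have /infinite_embeds[g gI] := iT.
pose code := foldr (fun x c => q (u x, c)) (g 0).
exists (fun s => q (g (size s), code s)) => s t /qI[/gI]; elim: s t => [|x s IH] [|y t] //=.
by move=> [/IH st] /qI[/uI -> /st ->].
Qed.

Lemma infinite_embedsW (T U : Type) : infinite_set [set: T] -> embeds T U ->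
  infinite_set [set: U].
Proof. by move=> /infinite_embeds nT TU; apply/infinite_embeds; exact: embeds_trans TU. Qed.

Lemma embeds_countable (T : countType) (U : Type) : infinite_set [set: U] -> embeds T U.
Proof.
move=> /infinite_embeds; apply: embeds_trans.
by exists pickle; exact: (pcan_inj pickleK).
Qed.

(** * Subgroups of abelian groups and independence modulo a prime *)

Definition add_subgroup (V : zmodType) (W : set V) : Prop :=
  W 0 /\ forall x y, W x -> W y -> W (x - y).

Section AddSubgroup.
Variables (V : zmodType) (W : set V).
Hypothesis sW : add_subgroup W.

Lemma add_subgroup0 : W 0. Proof. by case: sW. Qed.

Lemma add_subgroupB x y : W x -> W y -> W (x - y).
Proof. by case: sW => _; apply. Qed.

Lemma add_subgroupN x : W x -> W (- x).
Proof. by rewrite -[- x]add0r; apply: add_subgroupB; exact: add_subgroup0. Qed.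

Lemma add_subgroupD x y : W x -> W y -> W (x + y).
Proof. by move=> Wx /add_subgroupN Wy; rewrite -[y]opprK; exact: add_subgroupB. Qed.

Lemma add_subgroupMn x n : W x -> W (x *+ n).
Proof.
move=> Wx; elim: n => [|n IH]; first exact: add_subgroup0.
by rewrite mulrS; exact: add_subgroupD.
Qed.

Lemma add_subgroupMz x (m : int) : W x -> W (x *~ m).
Proof.
case: m => n Wx; first exact: add_subgroupMn.
by rewrite NegzE mulrNz; apply: add_subgroupN; exact: add_subgroupMn.
Qed.

Lemma add_subgroup_sum (I : eqType) (r : seq I) (F : I -> V) :
  (forall i, i \in r -> W (F i)) -> W (\sum_(i <- r) F i).
Proof.
move=> WF; rewrite big_seq; elim/big_ind: _ => //; first exact: add_subgroup0.
exact: add_subgroupD.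
Qed.

Lemma add_subgroup_congr x y : W (x - y) -> W x <-> W y.
Proof.
move=> Wxy; split=> [Wx|Wy].
  by rewrite -[y](subKr x); exact: add_subgroupB.
by rewrite -[x](subrK y); exact: add_subgroupD.
Qed.

Lemma add_subgroup_sym x y : W (x - y) -> W (y - x).
Proof. by move/add_subgroupN; rewrite opprB. Qed.

Lemma add_subgroup_trans y x z : W (x - y) -> W (y - z) -> W (x - z).
Proof. by move=> Wxy Wyz; rewrite -(subrKA y); exact: add_subgroupD. Qed.

End AddSubgroup.

Lemma prime_bezout (p : nat) (c : int) : prime p -> ~~ (p %| c)%Z ->
  exists u v : int, u * c + v * p = 1.
Proof.
move=> pp pc; have [u [v]] := Bezoutz c p.
have -> : gcdz c p = 1; last by exists u, v.
apply/eqP; rewrite -[_ == _]/(coprimez c p) coprimez_sym coprimezE.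
by rewrite prime_coprime.
Qed.

Section ModpBasis.
Variables (p : nat) (V : zmodType) (V0 W : set V).
Hypotheses (pp : prime p) (sW : add_subgroup W).
Hypothesis pV0 : forall v, V0 v -> W (v *+ p).

(** Linear independence over Z / p of the classes of [B] modulo [W]; integer coefficients stand for
    residues. *)
Definition modp_free (B : set V) := forall (r : seq V) (c : V -> int), uniq r ->
  {in r, forall b, B b} -> W (\sum_(b <- r) b *~ c b) ->
  {in r, forall b, (p %| c b)%Z}.

(** Zorn's lemma gives a basis of [V0] modulo [W] over Z / p. It is applied to A modulo pA and to
    Hom(A, Z / p); in the second case [V] consists of all maps A -> int and [V0] of those additive
    modulo p. *)
Lemma modp_basis : exists B, [/\ B `<=` V0, modp_free B &
  forall v, V0 v -> exists (r : seq V) (c : V -> int),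
    [/\ uniq r, {in r, forall b, B b} & W (v - \sum_(b <- r) b *~ c b)]].
Proof.
have [F FP Ftot|B [[BV0 Bfree] Bmax]] :=
    @Zorn_bigcup V (fun B => B `<=` V0 /\ modp_free B).
  split=> [v [B /FP[BV0 _]]|r c ur rF]; first exact: BV0.
  (* A finite part of the union of a chain lies in one of its members; only the empty list may have
     no member to lie in. *)
  have : r = [::] \/ exists2 B, F B & {in r, forall b, B b}.
    elim: r rF {c ur} => [|b r IH] rF; first by left.
    right; have [B FB Bb] := rF b (mem_head _ _).
    have [x xr|->|[C FC rC]] := IH; first by apply: rF; rewrite inE xr orbT.
      by exists B => // x; rewrite inE => /eqP ->.
    have [BC|CB] := Ftot _ _ FB FC.
      by exists C => // x; rewrite inE => /predU1P[->|/rC//]; exact: BC.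
    by exists B => // x; rewrite inE => /predU1P[->//|/rC]; exact: CB.
  by move=> [->//|[B /FP[_ +] rB]]; apply.
exists B; split=> // v V0v; apply: contrapT => nspan.
have nBv : ~ B v.
  move=> Bv; apply: nspan; exists [:: v], (fun=> 1); split=> //.
    by move=> b; rewrite inE => /eqP ->.
  by rewrite big_seq1 mulr1z subrr; exact: add_subgroup0.
have [] := Bmax (B `|` [set v]).
  split=> [|/(_ v) vB]; first exact: subsetUl.
  by apply: nBv; apply: vB; right.
split=> [w [/BV0//|->//]|r c ur rB].
have [vr|nvr] := boolP (v \in r); last first.
  apply: Bfree => // b br; have [//|bv] := rB b br.
  by rewrite -bv br in nvr.
rewrite (big_rem v) //= => Wsum.
have r'B : {in rem v r, forall b, B b}.
  move=> b; rewrite mem_rem_uniq // inE => /andP[/eqP bv /rB[//|]].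
  by move=> /bv.
(* Otherwise Bezout inverts [c v] modulo p and solves the relation for [v], which would then be
   spanned by [B]. *)
have pv : (p %| c v)%Z.
  apply: contrapT => /negP /(prime_bezout pp)[u [w uw]].
  apply: nspan; exists (rem v r), (fun b => - (c b * u)).
  split=> //; first exact: rem_uniq.
  rewrite -[v in W (v - _)]mulr1z -uw mulrzDr.
  have -> : \sum_(b <- rem v r) b *~ - (c b * u) =
     - ((\sum_(b <- rem v r) b *~ c b) *~ u).
    rewrite mulrz_suml -sumrN; apply: eq_bigr => b _.
    by rewrite mulrNz mulrzA.
  rewrite opprK addrAC; apply: add_subgroupD => //.
    rewrite [u * _]mulrC mulrzA -mulrzDl; exact: add_subgroupMz.
  by rewrite mulrzA mulrzAC; apply: add_subgroupMz => //; exact: pV0.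
have Wv : W (v *~ c v).
  have /dvdzP[k ->] := pv.
  by rewrite mulrzA mulrzAC; apply: add_subgroupMz => //; exact: pV0.
move=> b br; have [->//|bv] := eqVneq b v.
apply: (Bfree (rem v r) c) => //; first exact: rem_uniq.
  have -> : \sum_(b <- rem v r) b *~ c b =
      v *~ c v + \sum_(b <- rem v r) b *~ c b - v *~ c v by rewrite addrC addKr.
  exact: add_subgroupB.
by rewrite mem_rem_uniq // inE bv.
Qed.

End ModpBasis.

Lemma sum_widen (I : eqType) (M : zmodType) (r s : seq I) (F : I -> M) :
  uniq r -> uniq s -> {subset r <= s} -> (forall i, i \notin r -> F i = 0) ->
  \sum_(i <- r) F i = \sum_(i <- s) F i.
Proof.
move=> ur us rs F0; rewrite [RHS](bigID [in r]) /= [X in _ + X]big1 ?addr0; last first.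
  by move=> i /F0.
rewrite -[RHS]big_filter; apply: perm_big; apply: uniq_perm; rewrite ?filter_uniq //.
by move=> i; rewrite mem_filter; case: (boolP (i \in r)) => // /rs ->.
Qed.

Lemma sum_delta (I : eqType) (M : zmodType) (r : seq I) (F : I -> M) x :
  uniq r -> x \in r -> \sum_(y <- r) F y *~ (y == x)%:Z = F x.
Proof.
move=> ur xr; rewrite (bigD1_seq x) //= eqxx mulr1z big1 ?addr0 // => y /negbTE ->.
by rewrite mulr0z.
Qed.

Lemma sum_widen_mod (I : eqType) (M : zmodType) (N : set M) (r s : seq I) (F : I -> M) :
  add_subgroup N -> uniq r -> uniq s -> {subset r <= s} ->
  (forall i, i \notin r -> N (F i)) -> N (\sum_(i <- s) F i - \sum_(i <- r) F i).
Proof.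
move=> sN ur us rs F0; pose G i := if i \in r then F i else 0.
rewrite [X in _ - X](eq_big_seq G); last by move=> i ir; rewrite /G ir.
rewrite (sum_widen ur us rs) => [|i /negbTE ir]; last by rewrite /G ir.
rewrite -sumrB; apply: add_subgroup_sum => // i _; rewrite /G.
case: ifPn => [_|/F0 NF]; last by rewrite subr0.
by rewrite subrr; exact: add_subgroup0.
Qed.

Definition torsion_free (A : zmodType) : Prop :=
  forall p, prime p -> forall x : A, x *+ p = 0 -> x = 0.

Definition multiples (A : zmodType) (n : nat) : set A := range (fun x => x *+ n).

Lemma add_subgroup_multiples (A : zmodType) n : add_subgroup (multiples (A := A) n).
Proof.
split=> [|_ _ [x _ <-] [y _ <-]]; first by exists 0; rewrite ?mul0rn.
by exists (x - y); rewrite ?mulrnBl.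
Qed.

(** * Homomorphisms to the p-adic integers with prescribed values on a basis modulo p *)

Section HomExtension.
Variables (p : nat) (A : zmodType) (D : set A).
Hypotheses (pp : prime p) (tfA : torsion_free A).
Hypothesis Dfree : modp_free p (multiples p) D.
Hypothesis Dspan : forall a : A, exists (r : seq A) (c : A -> int),
  [/\ uniq r, {in r, forall b, D b} & multiples p (a - \sum_(b <- r) b *~ c b)].

(** Independence modulo p makes the coefficients divisible by p. As A is torsion-free, the relation
    can be divided by p, and the induction hypothesis applies to the quotients. *)
Lemma modpk_free k (r : seq A) (c : A -> int) : uniq r -> {in r, forall b, D b} ->
  multiples (p ^ k) (\sum_(b <- r) b *~ c b) ->
  {in r, forall b, ((p ^ k)%N %| c b)%Z}.
Proof.
move=> ur rD; elim: k c => [|k IH] c [a _ ac] b br; first by rewrite dvd1z.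
have pc : {in r, forall b, (p %| c b)%Z}.
  apply: (Dfree ur rD); exists (a *+ p ^ k) => //.
  by rewrite -ac expnSr mulrnA.
have cE : {in r, forall b, c b = (c b %/ p)%Z * p}.
  by move=> b' /pc /divzK.
rewrite (cE _ br) expnSr PoszM dvdz_mul2r; last by rewrite eqz_nat -lt0n prime_gt0.
apply: (IH (fun b => (c b %/ p)%Z) _ b br); exists a => //.
apply/subr0_eq/(tfA pp); rewrite mulrnBl -mulrnA -expnSr ac -sumrMnl.
apply/eqP; rewrite subr_eq0; apply/eqP/eq_big_seq => b' /cE {1}->.
by rewrite mulrzA pmulrn.
Qed.

Variable e : A -> int.

(* a is congruent modulo p^k to a combination of D on which the linear extension of
   e takes the value z. *)
Let rep k a z := exists (r : seq A) (c : A -> int),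
  [/\ uniq r, {in r, forall b, D b}, forall b, b \notin r -> c b = 0,
    multiples (p ^ k) (a - \sum_(b <- r) b *~ c b) & z = \sum_(b <- r) c b * e b].

Let repB k a z a' z' : rep k a z -> rep k a' z' -> rep k (a - a') (z - z').
Proof.
move=> [r [c [ur rD c0 ac ->]]] [r' [c' [ur' rD' c0' ac' ->]]].
pose s := undup (r ++ r').
have us : uniq s by exact: undup_uniq.
have rs : {subset r <= s} by move=> b br; rewrite mem_undup mem_cat br.
have rs' : {subset r' <= s} by move=> b br; rewrite mem_undup mem_cat br orbT.
exists s, (fun b => c b - c' b); split=> //.
- by move=> b; rewrite mem_undup mem_cat => /orP[/rD|/rD'].
- by move=> b; rewrite mem_undup mem_cat negb_or => /andP[/c0-> /c0'->].
- rewrite (eq_bigr (fun b => b *~ c b - b *~ c' b)); last first.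
    by move=> b _; rewrite mulrzBr.
  rewrite sumrB -(sum_widen ur us) //; last by move=> b /c0 ->.
  rewrite -(sum_widen ur' us) //; last by move=> b /c0' ->.
  have subACA (x y u v : A) : x - y - (u - v) = (x - u) - (y - v).
    by rewrite !opprD !opprK addrACA.
  by rewrite subACA; apply: add_subgroupB => //; exact: add_subgroup_multiples.
- rewrite (sum_widen ur us) //; last by move=> b /c0 ->; rewrite mul0r.
  rewrite (sum_widen ur' us) //; last by move=> b /c0' ->; rewrite mul0r.
  by rewrite -sumrB; apply: eq_bigr => b _; rewrite mulrBl.
Qed.

(** Independence modulo p^k makes every coefficient divisible. By [repB], the value attached to an
    element is therefore unique modulo p^k. *)
Let rep0 k z : rep k 0 z -> ((p ^ k)%N %| z)%Z.
Proof.
move=> [r [c [ur rD _ ac ->]]]; rewrite big_seq; apply: rpred_sum => b br.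
apply/dvdz_mulr/(modpk_free ur rD _ br).
rewrite -[X in multiples _ X]opprK; apply: add_subgroupN.
  exact: add_subgroup_multiples.
by rewrite -[X in multiples _ X]sub0r.
Qed.

Let rep_le k l a z : (k <= l)%N -> rep l a z -> rep k a z.
Proof.
move=> kl [r [c [ur rD c0 [b _ ac] ->]]]; exists r, c; split=> //.
by exists (b *+ p ^ (l - k)); rewrite // -mulrnA -expnD subnK.
Qed.

Let rep_gen k d : D d -> rep k d (e d).
Proof.
move=> Dd; exists [:: d], (fun b => (b == d)%:Z); split=> //.
- by move=> b; rewrite inE => /eqP ->.
- by move=> b; rewrite inE => /negbTE ->.
- by rewrite big_seq1 eqxx subrr; exists 0; rewrite // mul0rn.
- by rewrite big_seq1 eqxx mul1r.
Qed.

Let rep_shift k (a : A) z : rep k a z -> rep k.+1 (a *+ p) (z * p).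
Proof.
move=> [r [c [ur rD c0 [b _ ac] ->]]]; exists r, (fun b => c b * p); split=> //.
- by move=> b' /c0 ->; rewrite mul0r.
- exists b => //; rewrite expnSr mulrnA ac mulrnBl -sumrMnl; congr (_ - _).
  by apply: eq_bigr => b' _; rewrite mulrzA pmulrn.
- by rewrite mulr_suml; apply: eq_bigr => b' _; rewrite mulrAC.
Qed.

(** Modulo p, [a] is a combination of [D]; the remainder is p times an element, which the induction
    hypothesis represents modulo p^k. *)
Let rep_exists k a : exists z, rep k a z.
Proof.
elim: k a => [|k IH] a.
  by exists 0, [::], (fun=> 0); split; rewrite ?big_nil //; exists (a - 0).
have [r [c [ur rD [a' _ aE]]]] := Dspan a.
(* The sign is reversed because [repB] provides differences only. *)
have [z' a'z'] := IH (- a').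
have : rep k.+1 (\sum_(b <- r) b *~ c b) (\sum_(b <- r) c b * e b).
  pose c' b := if b \in r then c b else 0.
  exists r, c'; split=> //.
  - by move=> b /negbTE br; rewrite /c' br.
  - rewrite [X in _ - X](_ : _ = \sum_(b <- r) b *~ c b) ?subrr; first by exists 0; rewrite ?mul0rn.
    by apply: eq_big_seq => b br; rewrite /c' br.
  - by apply: eq_big_seq => b br; rewrite /c' br.
move=> /repB/(_ (rep_shift a'z')); rewrite mulNrn opprK aE addrC subrK => ?.
by eexists; eassumption.
Qed.

(** The maps [phi k] are the residues modulo p^k of a homomorphism A -> Z_p extending [e]. They
    choose values of [rep k], and [rep0] turns each identity between elements of A into a congruence
    between values. *)
Lemma hom_extension : exists phi : nat -> A -> int,
  [/\ forall k a b, ((p ^ k)%N %| phi k (a + b) - phi k a - phi k b)%Z,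
      forall k l a, (k <= l)%N -> ((p ^ k)%N %| phi l a - phi k a)%Z &
      forall k d, D d -> ((p ^ k)%N %| phi k d - e d)%Z].
Proof.
exists (fun k a => sval (cid (rep_exists k a))); split.
- move=> k a b; case: cid => x /= Hx; case: cid => y /= Hy; case: cid => z /= Hz.
  suff : rep k (a + b - a - b) (x - y - z) by rewrite [a + b]addrC addrK subrr => /rep0.
  by apply: repB => //; exact: repB.
- move=> k l a kl; case: cid => x /= Hx; case: cid => y /= Hy.
  by apply: rep0; rewrite -(subrr a); apply: repB => //; exact: rep_le Hx.
- move=> k d Dd; case: cid => x /= Hx.
  by apply: rep0; rewrite -(subrr d); apply: repB => //; exact: rep_gen.
Qed.

End HomExtension.

(** A homomorphism from [A] to [B / N], given by representatives of its values. *)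
Definition additive_mod (A B : zmodType) (N : set B) (f : A -> B) : Prop :=
  forall a b, N (f (a + b) - f a - f b).

Section AdditiveMod.
Variables (A B : zmodType) (N : set B) (f : A -> B).
Hypotheses (sN : add_subgroup N) (fN : additive_mod N f).

Lemma additive_mod0 : N (f 0).
Proof.
have := fN 0 0; rewrite addr0 subrr sub0r => /(add_subgroupN sN).
by rewrite opprK.
Qed.

Lemma additive_modB a b : N (f (a - b) - (f a - f b)).
Proof.
have := fN (a - b) b; rewrite subrK => /(add_subgroupN sN).
by rewrite !opprB addrCA.
Qed.

Lemma additive_modN a : N (f (- a) + f a).
Proof.
have := add_subgroupB sN additive_mod0 (fN (- a) a).
by rewrite addNr -addrA -opprD subKr.
Qed.

Lemma additive_modMn a n : N (f (a *+ n) - f a *+ n).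
Proof.
elim: n => [|n IH]; first by rewrite !mulr0n subr0; exact: additive_mod0.
have := add_subgroupD sN (fN a (a *+ n)) IH.
by rewrite -!mulrS addrA addrNK -addrA -opprD -mulrS.
Qed.

Lemma additive_modMz a (m : int) : N (f (a *~ m) - f a *~ m).
Proof.
case: m => n; first exact: additive_modMn.
rewrite NegzE !mulrNz opprK.
have := add_subgroupB sN (additive_modN (a *+ n.+1)) (additive_modMn a n.+1).
by rewrite opprB addrA addrAC addrK.
Qed.

Lemma additive_mod_sum (I : Type) (r : seq I) (F : I -> A) :
  N (f (\sum_(i <- r) F i) - \sum_(i <- r) f (F i)).
Proof.
elim: r => [|i r IH]; first by rewrite !big_nil subr0; exact: additive_mod0.
rewrite !big_cons; have := add_subgroupD sN (fN (F i) (\sum_(i <- r) F i)) IH.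
by rewrite addrA addrNK -addrA -opprD.
Qed.

Lemma additive_mod_congr (M : set A) a b : M (a - b) -> (forall c, M c -> N (f c)) ->
  N (f a - f b).
Proof.
move=> Mab MN; have := add_subgroupB sN (MN _ Mab) (additive_modB a b).
by rewrite opprB addrC subrK.
Qed.

End AdditiveMod.

Lemma morph_additive_mod (A B : zmodType) (N : set B) (f : A -> B) : add_subgroup N ->
  {morph f : a b / a + b} -> additive_mod N f.
Proof.
by move=> sN fD a b; rewrite fD addrAC addrK subrr; exact: add_subgroup0.
Qed.

Definition dvdset (n : nat) : set int := [set z | (n %| z)%Z].

Lemma add_subgroup_dvdset n : add_subgroup (dvdset n).
Proof. by split=> [|x y nx ny]; rewrite /dvdset /= ?dvdz0 // rpredB. Qed.

Section Span.
Variables (p : nat) (V : zmodType) (V0 W B : set V).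
Hypotheses (pp : prime p) (sW : add_subgroup W) (BV0 : B `<=` V0).
Hypothesis pV0 : forall v, V0 v -> W (v *+ p).
Hypothesis Bspan : forall v, V0 v -> exists (r : seq V) (c : V -> int),
  [/\ uniq r, {in r, forall b, B b} & W (v - \sum_(b <- r) b *~ c b)].
Variables (T : Type) (s : T -> V).
Hypotheses (sV0 : forall t, V0 (s t)) (sI : forall t u, W (s t - s u) -> t = u).
Hypothesis iT : infinite_set [set: T].

(** If [B] were finite, [s t] would be determined modulo [W] by its coefficients modulo p, hence by
    one of finitely many tuples. *)
Lemma span_infinite : infinite_set [set: {b | B b}].
Proof.
have [coef coefP] : {c : T -> V -> int & forall t, exists r, [/\ uniq r, {in r, forall b, B b},
    forall b, b \notin r -> c t b = 0 & W (s t - \sum_(b <- r) b *~ c t b)]}.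
  have H t : exists (c : V -> int) r, [/\ uniq r, {in r, forall b, B b},
    forall b, b \notin r -> c b = 0 & W (s t - \sum_(b <- r) b *~ c b)].
    have [r [c [ur rB Wc]]] := Bspan (sV0 t).
    exists (fun b => if b \in r then c b else 0), r; split=> //.
      by move=> b /negbTE ->.
    rewrite (eq_big_seq (fun b => b *~ c b)) // => b ->.
    by [].
  by exists (fun t => sval (cid (H t))) => t; exact: svalP (cid (H t)).
move=> Bfin.
have [sB sBP] : exists sB : seq V, forall b, B b -> b \in sB.
  have /finite_seqP[sB sBE] : finite_set (B : set V).
    suff <- : [set sval b | b in [set: {b | B b}]] = B by exact: finite_image.
    apply/seteqP; split=> [_ [b _ <-]|b Bb]; first exact: svalP b.
    by exists (exist _ b Bb).
  by exists sB => b; rewrite sBE.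
pose S := undup sB.
have Sfree t : W (s t - \sum_(b <- [seq b <- S | `[< B b >]]) b *~ coef t b).
  have [r [ur rB c0]] := coefP t; rewrite (sum_widen (s := [seq b <- S | `[< B b >]])) //.
  - by rewrite filter_uniq // undup_uniq.
  - move=> b /rB Bb; rewrite mem_filter mem_undup sBP // andbT; exact/asboolP.
  - by move=> b /c0 ->.
set S' := [seq b <- S | _] in Sfree.
have S'B : {in S', forall b, B b} by move=> b; rewrite mem_filter => /andP[/asboolP].
have pE (z : int) : (`|(z %% p)%Z|%N < p)%N.
  by rewrite -ltz_nat gez0_abs ?ltz_pmod ?modz_ge0 // ?ltz_nat ?eqz_nat -?lt0n prime_gt0.
suff TF : embeds T ((size S').-tuple 'I_p).
  by apply: (infinite_embedsW iT TF); exact: finite_finset.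
exists (fun t => [tuple Ordinal (pE (coef t (nth 0 S' i))) | i < size S']) => t u tu.
apply: sI; apply: (add_subgroup_trans sW (Sfree t)).
apply: (add_subgroup_trans sW _ (add_subgroup_sym sW (Sfree u))).
rewrite -sumrB; apply: add_subgroup_sum => // b bS'.
rewrite -mulrzBr.
suff /dvdzP[q ->] : (p %| coef t b - coef u b)%Z.
  by rewrite mulrzA mulrzAC; apply: add_subgroupMz => //; apply/pV0/BV0/S'B.
rewrite -eqz_mod_dvd.
have /(congr1 (fun x => tnth x (Ordinal (etrans (index_mem b S') bS')))) := tu.
rewrite !tnth_mktuple /= nth_index // => /(congr1 val) /=.
have m0 z : (0 <= z %% p)%Z by rewrite modz_ge0 // eqz_nat -lt0n prime_gt0.
by move=> /(congr1 Posz); rewrite !gez0_abs // => ->.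
Qed.

(** A lower bound for a dimension: each [s t] is determined modulo [W] by a list over [B] and int,
    and such lists are no more numerous than the infinite set [B]. *)
Lemma span_embeds : embeds T {b | B b}.
Proof.
have iB := span_infinite.
suff TB : embeds T (seq ({b | B b} * int)).
  apply: (embeds_trans TB); apply: embeds_seq => //.
  apply: embeds_prod_infinite => //; first by exists id.
  exact: embeds_countable.
have H t : exists l : seq ({b | B b} * int), W (s t - \sum_(x <- l) sval x.1 *~ x.2).
  have [r [c [_ rB]]] := Bspan (sV0 t).
  suff [l <-] : exists l : seq ({b | B b} * int),
      \sum_(x <- l) sval x.1 *~ x.2 = \sum_(b <- r) b *~ c b by exists l.
  elim: r rB => [|b r IH] rB; first by exists [::]; rewrite !big_nil.
  have [|l lE] := IH; first by move=> x xr; apply: rB; rewrite inE xr orbT.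
  exists ((exist _ b (rB b (mem_head _ _)), c b) :: l).
  by rewrite !big_cons lE.
exists (fun t => sval (cid (H t))) => t u.
case: cid => l /= Wl; case: cid => l' /= Wl' ll'; rewrite -ll' in Wl'.
by apply: sI; apply: (add_subgroup_trans sW Wl); exact: add_subgroup_sym.
Qed.

End Span.

(** * Dual bases of torsion-free groups *)

Lemma embeds_bijective (T U : Type) : embeds T U -> embeds U T ->
  exists f : T -> U, bijective f.
Proof.
elim/Ppointed: U => U TU UT; last first.
  move: TU UT => /card_le_embeds TU /card_le_embeds UT.
  have /card_set_bijP[f fb] := Cantor_Bernstein TU UT.
  by exists f; rewrite -setTT_bijective.
by have [f _] := TU; exists f; exists (fun u => False_rect T (no u)) => [t|u];
  [case: (no (f t))|case: (no u)].
Qed.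

Lemma crt_primes (n : nat) (c : nat -> int) : (0 < n)%N ->
  exists z : int, forall p, prime p -> ((p ^ logn p n)%N %| z - c p)%Z.
Proof.
move=> n0.
(* [u] is the idempotent of Z / n that is 1 modulo the p-part of n and 0 modulo the p'-part. *)
have idem (p : nat) : exists u : int, ((n`_p)%N %| u - 1)%Z /\ ((n`_p^')%N %| u)%Z.
  have co : coprimez (n`_p)%N (n`_p^')%N by rewrite coprimezE /= coprime_partC.
  exists (zchinese (n`_p)%N (n`_p^')%N 1 0); split.
    by rewrite -eqz_mod_dvd zchinese_modl.
  by rewrite -[X in (_ %| X)%Z]subr0 -eqz_mod_dvd zchinese_modr.
pose u p := sval (cid (idem p)).
have u1 p : ((n`_p)%N %| u p - 1)%Z by rewrite /u; case: cid => ? [].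
have u0 p : ((n`_p^')%N %| u p)%Z by rewrite /u; case: cid => ? [].
exists (\sum_(p <- primes n) c p * u p) => p pp; rewrite -p_part.
have [pn|pn] := boolP (p \in primes n); last first.
  by rewrite p_part (_ : logn p n = 0%N) ?expn0 ?dvd1z //; apply/eqP; rewrite -leqn0 leqNgt logn_gt0.
rewrite (big_rem p) //= -addrAC; apply: rpredD.
  by rewrite -[X in _ - X]mulr1 -mulrBr dvdz_mull.
rewrite big_seq; apply: rpred_sum => q.
rewrite mem_rem_uniq ?primes_uniq // inE => /andP[qp qn].
apply/dvdz_mull/(dvdz_trans _ (u0 q)).
rewrite dvdzE /= -[(n`_p)%N](part_pnat_id (pi := (q^')%N)); first by rewrite partn_dvd // dvdn_part.
by apply: sub_in_pnat (part_pnat p n) => r _; rewrite !inE => /eqP ->; rewrite eq_sym.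
Qed.

(* beta x is a homomorphism from A to the profinite integers, given by its
   residues: beta x n a only matters modulo n. The last two conditions say that
   the reductions modulo p form a basis of Hom(A, Z / p), for every prime p. *)
Definition dual_basis (A : zmodType) (X : eqType) (beta : X -> nat -> A -> int) : Prop :=
  [/\ forall x n, (0 < n)%N -> additive_mod (dvdset n) (beta x n),
      forall x n m a, (0 < m)%N -> (n %| m)%N -> (n %| beta x m a - beta x n a)%Z,
      forall p e, prime p -> additive_mod (dvdset p) e ->
        exists (r : seq X) (v : X -> int),
          uniq r /\ forall a : A, (p %| e a - \sum_(x <- r) v x * beta x p a)%Z &
      forall p (r : seq X) (v : X -> int), prime p -> uniq r ->
        (forall a, p %| \sum_(x <- r) v x * beta x p a)%Z ->
        {in r, forall x, (p %| v x)%Z}].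

(* The last condition says that |A / pA| = |A|. *)
Definition rich (A : zmodType) : Prop :=
  [/\ torsion_free A, infinite_set [set: A] &
      forall p, prime p -> exists f : A -> A, forall a b, multiples p (f a - f b) -> a = b].

Lemma fct_sum_mulrz (T : Type) (I : Type) (r : seq I) (F : I -> T -> int) (c : I -> int) a :
  (\sum_(i <- r) (F i : T -> int) *~ c i) a = \sum_(i <- r) c i * F i a.
Proof.
rewrite fct_sumE; apply: eq_bigr => i _.
have Mn (f : T -> int) m : (f *+ m) a = f a *+ m by elim: m => // m IH; rewrite !mulrS -IH.
case: (c i) => m; first by rewrite -pmulrn Mn mulrC -mulr_natr natz.
rewrite NegzE mulrNz -pmulrn -[LHS]/(- ((F i *+ m.+1) a)) Mn.
by rewrite -mulr_natr natz mulNr mulrC.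
Qed.

Section DualBasisModp.
Variables (A : zmodType) (p : nat).
Hypotheses (richA : rich A) (pp : prime p).

(** Take a basis [D] of A modulo p and a basis [Y] of Hom(A, Z / p). Both bounds of |Y| = 2^|A| are
    proved by embeddings, so [Y] can be indexed by [set A]. Each member of [Y] is then lifted to Z_p
    by extending its values on [D]. *)
Lemma modp_dual_basis : exists phi : set A -> nat -> A -> int,
  [/\ forall x k, additive_mod (dvdset (p ^ k)) (phi x k),
      forall x k l a, (k <= l)%N -> ((p ^ k)%N %| phi x l a - phi x k a)%Z,
      forall e, additive_mod (dvdset p) e ->
        exists (r : seq (set A)) (v : set A -> int),
          uniq r /\ forall a : A, (p %| e a - \sum_(x <- r) v x * phi x 1 a)%Z &
      forall (r : seq (set A)) (v : set A -> int), uniq r ->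
        (forall a, p %| \sum_(x <- r) v x * phi x 1 a)%Z ->
        {in r, forall x, (p %| v x)%Z}].
Proof.
have [tfA iA /(_ p pp)[f fI]] := richA.
have smul := add_subgroup_multiples A p.
have pT (v : A) : [set: A] v -> multiples p (v *+ p) by exists v.
have [D [_ Dfree /(_ _ I) Dspan]] :=
  modp_basis pp smul pT.
have DspanT a : [set: A] a -> _ := fun _ => Dspan a.
have AD : embeds A {d | D d}.
  exact: (@span_embeds p A setT _ D pp smul (@subsetT _ _) pT DspanT A f (fun=> I) fI iA).
have ext := hom_extension pp tfA Dfree Dspan.
pose V := A -> int.
pose V0 : set V := additive_mod (dvdset p).
pose W : set V := [set g | forall a, (p %| g a)%Z].
have sW : add_subgroup W.
  by split=> [a|g h Wg Wh a]; [exact: dvdz0|exact: rpredB].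
have pV0 (g : V) : V0 g -> W (g *+ p).
  move=> _ a; rewrite (_ : (g *+ p) a = g a *+ p); last by elim: (p) => // n IH; rewrite !mulrS -IH.
  by rewrite -mulr_natr natz dvdz_mull.
have [Y [YV0 Yfree Yspan]] := modp_basis pp sW pV0.
have iX : infinite_set [set: set A].
  by apply: infinite_embedsW iA _; exists set1 => a b; move=> /seteqP[/(_ a erefl)].
have [j jI] := AD.
(* [j] copies A into [D]. A subset [S] of A yields the homomorphism extending the indicator of the
   copy of [S], and distinct subsets yield homomorphisms distinct modulo p. *)
have XY : embeds (set A) {y | Y y}.
  have [sec secP] : {sec : A -> A -> Prop | forall a, sec (sval (j a)) = eq a}.
    exists (fun d a => d = sval (j a)) => a; apply/funext => b; apply/propext.
    split=> [/eq_sig_hprop e|->//]; apply: jI; apply: e => ?; exact: Prop_irrelevance.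
  pose ind (S : set A) (d : A) : int := `[< exists2 a, S a & sec d a >] : nat.
  pose s (S : set A) : V := sval (cid (ext (ind S))) 1%N.
  have sE S : V0 (s S) /\ forall a, (p %| s S (sval (j a)) - (`[< S a >] : nat)%:Z)%Z.
    rewrite /s; case: cid => g /= [gM _ gE]; split=> [a b|a]; first by have := gM 1%N a b; rewrite expn1.
    have := gE 1%N _ (svalP (j a)); rewrite expn1 /ind secP.
    rewrite (_ : `[< exists2 b, S b & a = b >] = `[< S a >]) //.
    by apply: asbool_equiv_eq; split=> [[b Sb ->]|Sa] //; exists a.
  apply: (@span_embeds p V V0 W Y pp sW YV0 pV0 Yspan (set A) s) => [S|S S' SS'|//].
    by case: (sE S).
  have nat_dvd (b b' : bool) : (p %| b%:Z - b'%:Z)%Z -> b = b'.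
    by case: b; case: b' => //; rewrite ?subr0 ?sub0r ?dvdzN dvdzE /= dvdn1;
      move/eqP=> p1; move: pp; rewrite p1.
  apply/funext => a; apply/propext; suff e : `[< S a >] = `[< S' a >].
    by split=> /asboolP; [rewrite e|rewrite -e] => /asboolP.
  have SSa : (p %| s S (sval (j a)) - s S' (sval (j a)))%Z := SS' (sval (j a)).
  apply: nat_dvd; have := rpredD (rpredB SSa ((sE S).2 a)) ((sE S').2 a).
  by congr (_ %| _)%Z; ring.
(* A homomorphism to Z / p is determined by the graph of its residues, a subset of [A * nat]. Two
   members of [Y] with the same graph would be dependent. *)
have YX : embeds {y | Y y} (set A).
  have AN : embeds (A * nat) A.
    by apply: embeds_prod_infinite => //; [exists id|apply/infinite_embeds].
  apply: embeds_trans (embeds_set AN).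
  exists (fun y => [set am | am.2 = `|(sval y am.1 %% p)%Z|%N]) => -[y Yy] [y' Yy'] /= yy'.
  apply: eq_exist => /=; apply: contrapT => /eqP ney.
  have Wyy : W (y - y') => [a|].
    rewrite -[(y - y') a]/(y a - y' a) -eqz_mod_dvd; apply/eqP.
    have : [set am : A * nat | am.2 = `|(y am.1 %% p)%Z|%N] (a, `|(y a %% p)%Z|%N) by [].
    have m0 z : (0 <= z %% p)%Z by rewrite modz_ge0 // eqz_nat -lt0n prime_gt0.
    by rewrite yy' /= => /(congr1 Posz); rewrite !gez0_abs.
  pose c (b : V) : int := if b == y then 1 else -1.
  have uy : uniq [:: y; y'] by rewrite /= inE ney.
  have yY : {in [:: y; y'], forall b, Y b}.
    by move=> b; rewrite !inE => /orP[] /eqP ->.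
  have cE : \sum_(b <- [:: y; y']) b *~ c b = y - y'.
    by rewrite !big_cons big_nil addr0 /c eqxx eq_sym (negbTE ney) mulr1z mulrNz mulr1z.
  have Wsum : W (\sum_(b <- [:: y; y']) b *~ c b) by rewrite cE.
  have := Yfree _ c uy yY Wsum y (mem_head _ _).
  by rewrite /c eqxx dvdzE /= dvdn1 => /eqP p1; move: pp; rewrite p1.
have [g [h hK gK]] := embeds_bijective XY YX.
(* The lift and the original [g x] are homomorphisms modulo p that agree on [D], and [D] spans A
   modulo p. *)
have phi1 x a : (p %| sval (cid (ext (sval (g x)))) 1%N a - sval (g x) a)%Z.
  case: cid => phi /= [phiM _ phiD].
  have sp := add_subgroup_dvdset p.
  have dM : additive_mod (dvdset p) (fun a => phi 1%N a - sval (g x) a).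
    move=> b c; have := rpredB (phiM 1%N b c) (YV0 _ (svalP (g x)) b c).
    rewrite expn1 /dvdset /=; congr (_ %| _)%Z.
    by move: (sval (g x)) => y; ring.
  have [r [c [ur rD Wac]]] := Dspan a.
  have dp b : multiples p b -> dvdset p (phi 1%N b - sval (g x) b).
    move=> [b' _ <-]; have := additive_modMn sp dM b' p; set u := (phi 1%N b' - sval (g x) b') *+ p => H.
    by rewrite -[X in dvdset p X](subrK u); apply: rpredD => //; rewrite /u -mulr_natr natz dvdz_mull.
  have := additive_mod_congr sp dM Wac dp.
  set S := \sum_(b <- r) _ => HS.
  rewrite -[X in (_ %| X)%Z](subrK (phi 1%N S - sval (g x) S)); apply: rpredD => //.
  rewrite -[X in (_ %| X)%Z](subrK (\sum_(b <- r) (phi 1%N (b *~ c b) - sval (g x) (b *~ c b)))).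
  apply: rpredD; first exact: (additive_mod_sum sp dM).
  rewrite big_seq; apply: rpred_sum => b br.
  have := additive_modMz sp dM b (c b); set u := (phi 1%N b - sval (g x) b) *~ c b => H.
  rewrite -[X in (_ %| X)%Z](subrK u); apply: rpredD => //.
  rewrite /u -mulrzr; apply: dvdz_mulr.
  by have := phiD 1%N _ (rD _ br); rewrite expn1.
exists (fun x => sval (cid (ext (sval (g x))))); split.
- by move=> x k a b; case: cid => phi /= [phiM _ _]; exact: phiM.
- by move=> x k l a; case: cid => phi /= [_ phiC _]; exact: phiC.
- move=> e eM; have [r [c [ur rY Wr]]] := Yspan e eM.
  pose k y := if pselect (Y y) is left Yy then h (exist _ y Yy) else set0.
  have kK y : y \in r -> sval (g (k y)) = y.
    by move=> /rY Yy; rewrite /k; case: pselect => // Yy'; rewrite gK.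
  exists (map k r), (fun x => c (sval (g x))); split.
    by rewrite map_inj_in_uniq // => y y' yr y'r kk; rewrite -(kK _ yr) kk kK.
  move=> a; rewrite big_map.
  have := Wr a; rewrite -[(e - _) a]/(e a - (\sum_(b <- r) b *~ c b) a) fct_sum_mulrz => H.
  rewrite -[X in (_ %| X)%Z](subrKA (\sum_(y <- r) c y * y a)); apply: rpredD => //.
  rewrite -sumrB big_seq; apply: rpred_sum => y yr.
  rewrite kK // -mulrBr; apply: dvdz_mull.
  by rewrite -[X in (_ %| X)%Z]opprB rpredN; have := phi1 (k y) a; rewrite kK.
- move=> r v ur rdvd x xr.
  have gI : injective (fun x => sval (g x)).
    move=> y z /= /eq_sig_hprop e; apply: (can_inj hK); apply: e => ?.
    exact: Prop_irrelevance.
  pose k (y : V) := if pselect (Y y) is left Yy then h (exist _ y Yy) else set0.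
  have kK z : k (sval (g z)) = z.
    rewrite /k; case: pselect => [Yy|[]]; last exact: svalP (g z).
    by rewrite -[RHS]hK; congr h; case: (g z) Yy => w Yw Yy; exact: eq_exist.
  rewrite -[x]kK; apply: (Yfree (map (fun x => sval (g x)) r) (fun y => v (k y))).
  - by rewrite map_inj_uniq.
  - by move=> _ /mapP[z _ ->]; exact: svalP (g z).
  - move=> a; rewrite big_map fct_sum_mulrz.
    rewrite -[X in (_ %| X)%Z](subrK (\sum_(x <- r) v x * sval (cid (ext (sval (g x)))) 1%N a)).
    apply: rpredD => //; rewrite -sumrB; apply: rpred_sum => z _.
    by rewrite kK -mulrBr -opprB mulrN rpredN; exact/dvdz_mull/phi1.
  - exact: map_f.
Qed.

End DualBasisModp.

(** The bases for all primes share the index type [set A]. So for each index the Chinese remainder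
    theorem glues the residues modulo the prime powers in n to a residue modulo n. *)
Lemma rich_dual_basis (A : zmodType) : rich A ->
  exists beta : set A -> nat -> A -> int, dual_basis beta.
Proof.
move=> richA.
have [phi phiP] : {phi : forall p, prime p -> set A -> nat -> A -> int |
  forall p pp, [/\ forall x k, additive_mod (dvdset (p ^ k)) (phi p pp x k),
      forall x k l a, (k <= l)%N -> ((p ^ k)%N %| phi p pp x l a - phi p pp x k a)%Z,
      forall e, additive_mod (dvdset p) e ->
        exists (r : seq (set A)) (v : set A -> int),
          uniq r /\ forall a : A, (p %| e a - \sum_(x <- r) v x * phi p pp x 1 a)%Z &
      forall (r : seq (set A)) (v : set A -> int), uniq r ->
        (forall a, p %| \sum_(x <- r) v x * phi p pp x 1 a)%Z ->
        {in r, forall x, (p %| v x)%Z}]}.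
  exists (fun p pp => sval (cid (modp_dual_basis richA pp))) => p pp.
  exact: svalP (cid (modp_dual_basis richA pp)).
pose phi0 p := if pselect (prime p) is left pp then phi p pp else fun _ _ _ => 0.
have phi0P p (pp : prime p) : phi0 p = phi p pp.
  by rewrite /phi0; case: pselect => // pp'; rewrite (bool_irrelevance pp' pp).
pose beta x n a := if pselect (0 < n)%N is left n0 then
  sval (cid (crt_primes (fun p => phi0 p x (logn p n) a) n0)) else 0.
have betaP x n a p : (0 < n)%N -> prime p ->
    ((p ^ logn p n)%N %| beta x n a - phi0 p x (logn p n) a)%Z.
  move=> n0 pp; rewrite /beta; case: pselect => // n0'.
  by case: cid => z /= zP; exact: zP.
have beta1 x p a : prime p -> (p %| beta x p a - phi0 p x 1%N a)%Z.
  move=> pp; have := betaP x p a p (prime_gt0 pp) pp.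
  by rewrite logn_prime // eqxx.
have dvdP n (z : int) : (0 < n)%N ->
    (forall p, prime p -> ((p ^ logn p n)%N %| z)%Z) -> (n %| z)%Z.
  move=> n0 H; rewrite dvdzE /=; apply/(dvdn_partP _ n0) => p.
  by rewrite mem_primes p_part => /and3P[/H].
exists beta; split.
- move=> x n n0 a b; apply: dvdP => // p pp.
  have [/(_ x (logn p n) a b) phiM _ _ _] := phiP p pp; rewrite -phi0P in phiM.
  have := rpredB (rpredB (betaP x n (a + b) p n0 pp) (betaP x n a p n0 pp))
    (betaP x n b p n0 pp).
  move=> /(rpredD phiM); congr (_ %| _)%Z; ring.
- move=> x n m a m0 nm; have n0 := dvdn_gt0 m0 nm; apply: dvdP => // p pp.
  have kl := dvdn_leq_log p m0 nm.
  have [_ /(_ x _ _ a kl) phiC _ _] := phiP p pp; rewrite -phi0P in phiC.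
  have kl' : ((p ^ logn p n)%N %| (p ^ logn p m)%N%:Z)%Z by rewrite dvdzE /= dvdn_exp2l.
  have := dvdz_trans kl' (betaP x m a p m0 pp).
  move=> /(rpredD phiC) /rpredB /(_ (betaP x n a p n0 pp)).
  congr (_ %| _)%Z; ring.
- move=> p e pp eM; have [_ _ /(_ e eM)[r [v [ur H]]] _] := phiP p pp.
  exists r, v; split=> // a; rewrite -[X in (_ %| X)%Z](subrKA (\sum_(x <- r) v x * phi0 p x 1%N a)).
  apply: rpredD; first by rewrite (phi0P _ pp).
  rewrite -sumrB; apply: rpred_sum => x _; rewrite -mulrBr; apply: dvdz_mull.
  by rewrite -[X in (_ %| X)%Z]opprB rpredN; exact: beta1.
- move=> p r v pp ur H; have [_ _ _] := phiP p pp; apply=> // a.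
  rewrite -[X in (_ %| X)%Z](subrK (\sum_(x <- r) v x * beta x p a)).
  apply: rpredD => //; rewrite -(phi0P _ pp) -sumrB; apply: rpred_sum => x _.
  rewrite -mulrBr; apply: dvdz_mull.
  by rewrite -[X in (_ %| X)%Z]opprB rpredN; exact: beta1.
Qed.

(** * Subgroups of finite index *)

Definition finite_index (B : zmodType) (N : set B) : Prop :=
  exists (T : finType) (f : B -> T), forall a b, f a = f b -> N (a - b).

Lemma finite_index_list (B : zmodType) (N : set B) : finite_index N ->
  exists l : seq B, forall b, exists2 b', b' \in l & N (b - b').
Proof.
move=> [T [f fN]].
have H (t : T) : exists b, forall b', f b' = t -> f b = t.
  have [[b fb]|nb] := pselect (exists b, f b = t); first by exists b.
  by exists 0 => b' fb'; case: nb; exists b'.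
exists [seq sval (cid (H t)) | t <- enum T] => b.
exists (sval (cid (H (f b)))); first by apply/mapP; exists (f b); rewrite ?mem_enum.
by apply: fN; case: cid => b' /= /(_ b erefl) ->.
Qed.

Lemma list_finite_index (B : zmodType) (N : set B) (l : seq B) : add_subgroup N ->
  (forall b, exists2 b', b' \in l & N (b - b')) -> finite_index N.
Proof.
move=> sN lN; pose g b := sval (cid2 (lN b)).
have gl b : g b \in l by rewrite /g; case: cid2.
have fl b : (index (g b) l < size l)%N by rewrite index_mem.
exists 'I_(size l), (fun b => Ordinal (fl b)) => a b /(congr1 val) /= e.
have {}e : g a = g b by rewrite -(nth_index 0 (gl a)) e nth_index.
have gN c : N (c - g c) by rewrite /g; case: cid2.
by apply: (add_subgroup_trans sN (gN a)); rewrite e; exact: add_subgroup_sym.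
Qed.

(** By the pigeonhole principle some [x *+ k] with 0 < k <= #|T| lies in [N], and the factorial is a
    multiple of every such k. *)
Lemma finite_index_exponent (B : zmodType) (N : set B) : add_subgroup N ->
  finite_index N -> exists2 n, (0 < n)%N & forall b, N (b *+ n).
Proof.
move=> sN [T [f fN]]; exists (#|T|)`!; first exact: fact_gt0.
move=> x.
have [k [k0 kl Nk]] : exists k, [/\ (0 < k)%N, (k <= #|T|)%N & N (x *+ k)].
  have /injectivePn[i [j ij fij]] : ~~ injectiveb (fun i : 'I_#|T|.+1 => f (x *+ i)).
    by apply/injectiveP => finj; have := leq_card _ finj; rewrite card_ord ltnn.
  wlog ltij : i j ij fij / (i < j)%N.
    move=> W; case: (ltngtP i j) => [lt|lt|/val_inj e]; first exact: (W i j).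
      by apply: (W j i) => //; rewrite eq_sym.
    by rewrite e eqxx in ij.
  exists (j - i)%N; split; [by rewrite subn_gt0|by rewrite (leq_trans (leq_subr _ _)) // -ltnS|].
  rewrite mulrnBr; last exact: ltnW.
  exact: fN.
have /dvdnP[q ->] : (k %| (#|T|)`!)%N by rewrite dvdn_fact // k0.
by rewrite mulnC mulrnA; exact: add_subgroupMn.
Qed.

Lemma finite_indexI (B : zmodType) (N M : set B) : finite_index N -> finite_index M ->
  finite_index (N `&` M).
Proof.
move=> [T [f fN]] [U [g gM]]; exists (T * U)%type, (fun b => (f b, g b)) => a b [fab gab].
by split; [exact: fN|exact: gM].
Qed.

Lemma additive_mod_finite_index (A : zmodType) (n : nat) (e : A -> int) : (0 < n)%N ->
  additive_mod (dvdset n) e -> finite_index [set a | (n %| e a)%Z].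
Proof.
move=> n0 eM.
have pE (z : int) : (`|(z %% n)%Z|%N < n)%N.
  by rewrite -ltz_nat gez0_abs ?ltz_pmod ?modz_ge0 // ?ltz_nat ?eqz_nat -?lt0n.
have m0 z : (0 <= z %% n)%Z by rewrite modz_ge0 // eqz_nat -lt0n.
exists 'I_n, (fun a => Ordinal (pE (e a))) => a b /(congr1 val) /(congr1 Posz) /=.
rewrite !gez0_abs // => /eqP; rewrite eqz_mod_dvd => nab /=.
have := rpredD (additive_modB (add_subgroup_dvdset n) eM a b) nab.
by rewrite /dvdset /= subrK.
Qed.

Lemma additive_mod_kernel (A B : zmodType) (N : set B) (f : A -> B) : add_subgroup N ->
  additive_mod N f -> add_subgroup [set a | N (f a)].
Proof.
move=> sN fM; split=> [|a b Na Nb]; first exact: (additive_mod0 sN fM).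
exact/(add_subgroup_congr sN (additive_modB sN fM a b))/(add_subgroupB sN).
Qed.

(** A / pA is residually finite: [a] has a coefficient [c d] prime to p over a basis modulo p, and
    the homomorphism dual to [d] takes at [a] the value [c d] modulo p. *)
Lemma separate_modp (A : zmodType) (p : nat) (a : A) : torsion_free A -> prime p ->
  ~ multiples p a -> exists2 e : A -> int, additive_mod (dvdset p) e & ~ (p %| e a)%Z.
Proof.
move=> tfA pp npa; have smul := add_subgroup_multiples A p.
have pT (v : A) : [set: A] v -> multiples p (v *+ p) by exists v.
have [D [_ Dfree /(_ _ I) Dspan]] := modp_basis pp smul pT.
have [r [c [ur rD Hr]]] := Dspan a.
have [d dr pcd] : exists2 d, d \in r & ~ (p %| c d)%Z.
  apply: contrapT => nd; apply: npa; apply/(add_subgroup_congr smul Hr).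
  apply: add_subgroup_sum => // d dr.
  have /dvdzP[q ->] : (p %| c d)%Z by apply: contrapT => pcd; apply: nd; exists d.
  by exists (d *~ q) => //; rewrite mulrzA pmulrn.
have [phi [phiM _ phiD]] := hom_extension pp tfA Dfree Dspan (fun b => (b == d)%:Z).
have sp := add_subgroup_dvdset p.
have eM : additive_mod (dvdset p) (phi 1%N).
  by move=> x y; have := phiM 1%N x y; rewrite expn1.
exists (phi 1%N) => // pa; apply: pcd.
have k0 b : multiples p b -> dvdset p (phi 1%N b).
  move=> [b' _ <-]; apply/(add_subgroup_congr sp (additive_modMn sp eM b' p)).
  by rewrite /dvdset /= -mulr_natr natz dvdz_mull.
have H1 := additive_mod_congr sp eM Hr k0.
have H2 := (add_subgroup_congr sp H1).1 pa.
have H3 := (add_subgroup_congr sp (additive_mod_sum sp eM r (fun b => b *~ c b))).1 H2.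
rewrite -[c d](sum_delta (r := r) c ur dr).
apply: (add_subgroup_congr sp _).1 H3; rewrite -sumrB.
apply: add_subgroup_sum => // b br.
apply: (add_subgroup_trans sp (additive_modMz sp eM b (c b))).
rewrite !mulrzz [c b * _]mulrC -mulrBl.
by have := phiD 1%N b (rD b br); rewrite expn1; exact: dvdz_mulr.
Qed.

(** * Coefficients of homomorphisms to finite abelian groups *)

Section Decomposition.
Variables (A B : zmodType) (X : eqType) (beta : X -> nat -> A -> int).
Hypothesis betaP : dual_basis beta.
Variables (N : set B) (n : nat).
Hypotheses (sN : add_subgroup N) (n0 : (0 < n)%N) (nB : forall b, N (b *+ n)).

(* Every homomorphism A -> S / N is a unique finite combination of the beta x with
   coefficients in S / N. This passes from S to S + <s> when p s is in S, so it
   climbs from N to B through extensions of prime index. *)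
Let decomposing (S : set B) :=
  [/\ add_subgroup S, N `<=` S,
    forall chi : A -> B, additive_mod N chi -> (forall a, S (chi a)) ->
      exists (r : seq X) (h : X -> B), [/\ uniq r, forall x, x \notin r -> h x = 0,
        forall x, S (h x) & forall a, N (chi a - \sum_(x <- r) h x *~ beta x n a)] &
    forall (r : seq X) (h : X -> B), uniq r -> {in r, forall x, S (h x)} ->
      (forall a, N (\sum_(x <- r) h x *~ beta x n a)) -> {in r, forall x, N (h x)}].

Let NMz b (m : int) : (n %| m)%Z -> N (b *~ m).
Proof. by move=> /dvdzP[q ->]; rewrite mulrzA mulrzAC; apply: (add_subgroupMz sN); exact: nB. Qed.

Let additive_term b x : additive_mod N (fun a => b *~ beta x n a).
Proof.
have [betaM _ _ _] := betaP.
by move=> a c; rewrite -!mulrzBr; apply: NMz; exact: betaM.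
Qed.

Let subr_sub3 (x y z x' y' z' : B) :
  x - x' - (y - y') - (z - z') = x - y - z - (x' - y' - z').
Proof. by rewrite !opprD !opprK !addrA [LHS](ACl (1*3*5*2*4*6)). Qed.

Section Adjoin.
Variables (S : set B) (p : nat) (s : B).
Hypotheses (dS : decomposing S) (pp : prime p) (nSs : ~ S s) (Ssp : S (s *+ p)).

Let S1 : set B := [set y | exists m : int, S (y - s *~ m)].

Let sS : add_subgroup S. Proof. by case: dS. Qed.
Let NS : N `<=` S. Proof. by case: dS. Qed.

Let SMz (m : int) : S (s *~ m) <-> (p %| m)%Z.
Proof.
split=> [Sm|/dvdzP[q ->]]; last first.
  by rewrite mulrzA mulrzAC; exact: (add_subgroupMz sS).
apply: contrapT => /negP /(prime_bezout pp)[u [v uv]]; apply: nSs.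
rewrite -[s]mulr1z -uv mulrzDr; apply: (add_subgroupD sS).
  by rewrite mulrC mulrzA; exact: (add_subgroupMz sS).
by rewrite mulrzA mulrzAC; exact: (add_subgroupMz sS).
Qed.

(** [n] kills B / N and [N] lies in [S], so the order p of [s] modulo [S] divides [n]. Hence
    [beta x n] can be reduced modulo p. *)
Let pn : (p %| n)%N.
Proof. by have /SMz : S (s *~ n) := NS (nB s). Qed.

Let beta_p x a : (p %| beta x n a - beta x p a)%Z.
Proof. by have [_ betaC _ _] := betaP; exact: betaC. Qed.

Let sum_beta_p (r : seq X) (v : X -> int) a :
  (p %| \sum_(x <- r) v x * beta x n a - \sum_(x <- r) v x * beta x p a)%Z.
Proof.
rewrite -sumrB; apply: rpred_sum => x _; rewrite -mulrBr; apply: dvdz_mull.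
exact: beta_p.
Qed.

Let adjoin_in : S1 s.
Proof. by exists 1; rewrite mulr1z subrr; exact: (add_subgroup0 sS). Qed.

(** Modulo [S], [chi] takes values in the group of order p generated by [s], so it is [s] times a
    homomorphism [e] to Z / p. Expanding [e] in the [beta x] modulo p and lifting the expansion
    leaves a remainder with values in [S], which decomposes it. *)
Lemma decomposing_adjoin : exists S', [/\ decomposing S', S `<=` S' & S' s].
Proof.
have [_ _ ex un] := dS; have [_ _ span indep] := betaP.
have SS1 y : S y -> S1 y by exists 0; rewrite mulr0z subr0.
have sS1 : add_subgroup S1.
  split=> [|x y [m Sx] [m' Sy]]; first exact/SS1/(add_subgroup0 sS).
  exists (m - m'); have := add_subgroupB sS Sx Sy.
  by rewrite mulrzBr !opprD !opprK addrACA.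
exists S1; split=> //; split=> //.
- by move=> y /NS/SS1.
- move=> chi chiM chiS.
  have [e eP] : {e : A -> int | forall a, S (chi a - s *~ e a)}.
    exists (fun a => sval (cid (chiS a))) => a; exact: svalP (cid (chiS a)).
  have eM : additive_mod (dvdset p) e.
    move=> a b; apply/SMz.
    have := add_subgroupB sS (NS (chiM a b)) (add_subgroupB sS (add_subgroupB sS (eP (a + b)) (eP a)) (eP b)).
    by rewrite subr_sub3 subKr !mulrzBr.
  have [r1 [v [ur1 eE]]] := span p e pp eM.
  pose h1 x := s *~ (if x \in r1 then v x else 0).
  have h10 x : x \notin r1 -> h1 x = 0 by rewrite /h1 => /negbTE ->; rewrite mulr0z.
  pose s1 a := \sum_(x <- r1) h1 x *~ beta x n a.
  have s1E a : s1 a = s *~ (\sum_(x <- r1) v x * beta x n a).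
    rewrite mulrz_sumr; apply: eq_big_seq => x xr.
    by rewrite /h1 xr mulrzA.
  have [||r2 [h2 [ur2 h20 Sh2 E2]]] := ex (fun a => chi a - s1 a).
  + move=> a b; rewrite subr_sub3; apply: (add_subgroupB sN); first exact: chiM.
    by rewrite /s1 -!sumrB; apply: add_subgroup_sum => // x _; exact: additive_term.
  + move=> a; rewrite s1E -(subrK (s *~ e a) (chi a)) -addrA -mulrzBr.
    apply: (add_subgroupD sS) => //; apply/SMz.
    have := rpredB (eE a) (sum_beta_p r1 v a).
    by rewrite opprB addrA addrNK.
  exists (undup (r1 ++ r2)), (fun x => h1 x + h2 x); split.
  + exact: undup_uniq.
  + by move=> x; rewrite mem_undup mem_cat negb_or => /andP[/h10 -> /h20 ->]; rewrite addr0.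
  + move=> x; apply: add_subgroupD => //; last exact: SS1.
    by exists (if x \in r1 then v x else 0); rewrite subrr; exact: (add_subgroup0 sS).
  + move=> a; rewrite (eq_bigr (fun x => h1 x *~ beta x n a + h2 x *~ beta x n a)); last first.
      by move=> x _; rewrite mulrzDl.
    rewrite big_split /= opprD addrA.
    rewrite -(@sum_widen _ _ r1 (undup (r1 ++ r2))) ?undup_uniq //; last first.
      by move=> x /h10 ->; rewrite mul0rz.
      by move=> x xr; rewrite mem_undup mem_cat xr.
    rewrite -(@sum_widen _ _ r2 (undup (r1 ++ r2))) ?undup_uniq //; last first.
      by move=> x /h20 ->; rewrite mul0rz.
      by move=> x xr; rewrite mem_undup mem_cat xr orbT.
- move=> r h ur hS1 hN.
  have [v vP] : {v : X -> int | {in r, forall x, S (h x - s *~ v x)}}.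
    have H x : exists m, x \in r -> S (h x - s *~ m).
      by have [/hS1[m Sm]|] := boolP (x \in r); [exists m|exists 0].
    by exists (fun x => sval (cid (H x))) => x; exact: svalP (cid (H x)).
  have pv : {in r, forall x, (p %| v x)%Z}.
    apply: indep => // a; apply/SMz.
    rewrite -[X in s *~ X](subKr (\sum_(x <- r) v x * beta x n a)) mulrzBr.
    apply: (add_subgroupB sS); last exact/SMz/sum_beta_p.
    have S2 : S (\sum_(x <- r) (h x - s *~ v x) *~ beta x n a).
      by apply: add_subgroup_sum => // x xr; apply: add_subgroupMz => //; exact: vP.
    have := add_subgroupB sS (NS (hN a)) S2; rewrite -sumrB mulrz_sumr.
    congr S; apply: eq_bigr => x _.
    by rewrite mulrzBl subKr mulrzA.
  (* Since p divides every [v x], the coefficients [h x] already lie in [S], where uniqueness is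
     known. *)
  apply: un => // x xr; rewrite -(subrK (s *~ v x) (h x)).
  by apply: (add_subgroupD sS); [exact: vP|apply/SMz/pv].
Qed.

End Adjoin.

(** Induction on a multiple [b *+ m] in [S]. For a prime p dividing m and k = m / p, either [b *+ k]
    is in [S], or it has order p modulo [S] and can be adjoined; in both cases k replaces m. *)
Let decomposing_extend (S : set B) b : decomposing S ->
  exists S', [/\ decomposing S', S `<=` S' & S' b].
Proof.
have [m m0 Sm] : exists2 m, (0 < m)%N & N (b *+ m) by exists n.
move=> dS; have {Sm} : S (b *+ m) by case: dS => _ NS _ _; exact: NS.
elim/ltn_ind: m S m0 dS => m IH S m0 dS Sm.
have [m1|] := leqP m 1.
  by exists S; split=> //; have := Sm; rewrite (_ : m = 1%N) ?mulr1n //; lia.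
move=> m1; have pp := pdiv_prime m1; have pm := pdiv_dvd m.
set p := pdiv m in pp pm; set k := (m %/ p)%N.
have mE : m = (k * p)%N by rewrite divnK.
have km : (k < m)%N by rewrite ltn_Pdiv // prime_gt1.
have k0 : (0 < k)%N by rewrite divn_gt0 ?prime_gt0 // dvdn_leq.
have [Sk|nSk] := pselect (S (b *+ k)); first exact: IH Sk.
have [|S' [dS' SS' S'k]] := decomposing_adjoin dS pp nSk.
  by rewrite -mulrnA -mE.
have [S'' [dS'' S'S'' S''b]] := IH k km S' k0 dS' S'k.
by exists S''; split=> //; exact: subset_trans S'S''.
Qed.

Hypothesis fN : finite_index N.

Let decomposing_all : decomposing setT.
Proof.
have [l lP] := finite_index_list fN.
have dN : decomposing N.
  split=> // chi _ chiN; exists [::], (fun=> 0); split=> // [_|a].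
    exact: (add_subgroup0 sN).
  by rewrite big_nil subr0.
have [S dS lS] : exists2 S, decomposing S & {in l, forall b, S b}.
  elim: l {lP} => [|b l [S dS lS]]; first by exists N.
  have [S' [dS' SS' S'b]] := decomposing_extend b dS.
  by exists S' => // x; rewrite inE => /predU1P[->//|/lS/SS'].
suff SE : S = setT by rewrite SE in dS.
have [sS NS _ _] := dS; apply/seteqP; split=> // b _.
have [b' /lS Sb' /NS Sbb'] := lP b.
exact/(add_subgroup_congr sS Sbb').
Qed.

Lemma dual_basis_decomposition (chi : A -> B) : additive_mod N chi ->
  exists (r : seq X) (h : X -> B), [/\ uniq r, forall x, x \notin r -> h x = 0 &
    forall a, N (chi a - \sum_(x <- r) h x *~ beta x n a)].
Proof.
move=> chiM; have [_ _ + _] := decomposing_all.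
by move=> /(_ _ chiM (fun=> I))[r [h [? ? _ ?]]]; exists r, h.
Qed.

Lemma dual_basis_unique (r : seq X) (h : X -> B) : uniq r ->
  (forall a, N (\sum_(x <- r) h x *~ beta x n a)) -> {in r, forall x, N (h x)}.
Proof. by move=> ur; have [_ _ _] := decomposing_all; exact. Qed.

End Decomposition.

(** * Open subgroups of profinite abelian groups *)

(** The intersection [Q] of the clopen sets around [x] is connected, so total disconnectedness
    reduces it to [x]. If no clopen set separated [y] from [x], then [y] would be in [Q]. *)
Lemma compact_totally_disconnected_zero_dimensional (T : topologicalType) :
  hausdorff_space T -> compact [set: T] -> totally_disconnected [set: T] ->
  zero_dimensional T.
Proof.
move=> hT cT tdT x y xy; apply: contrapT => nU.
pose E := [set D : set T | D x /\ clopen D].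
pose Q := \bigcap_(D in E) D.
have clQ : closed Q by apply: closed_bigI => D [_ []].
have Qx : Q x by move=> D [].
have Qy : Q y.
  by move=> D [Dx clD]; apply: contrapT => nDy; apply: nU; exists D.
suff Qconn : connected Q.
  suff : [set x] y by move=> /= yx; move: xy; rewrite yx eqxx.
  by rewrite -(tdT x I); exists Q => //; split.
(* A partition of Q into two closed sets is separated by a clopen set: this is the
   equality of components and quasi-components. *)
have part (B C D : set T) : B x -> open C -> B = Q `&` C -> closed D -> B = Q `&` D ->
    B = Q.
  move=> Bx oC BC cD BD.
  have cB : closed B by rewrite BD; exact: closedI.
  have cQB : closed (Q `&` ~` C) by apply: closedI => //; exact: open_closedC.
  have nB : set_nbhs B (~` (Q `&` ~` C)).
    apply/set_nbhsP; exists (~` (Q `&` ~` C)); split=> //; first exact: closed_openC.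
    by move=> z; rewrite BC => -[_ Cz] [].
  have [V VB clV] := compact_normal hT cT cB nB.
  have /set_nbhsP[O [oO BO OV]] := VB.
  pose S := closure V `\` O.
  have cS : compact S.
    apply: (subclosed_compact _ cT) => //; apply: closedI; first exact: closed_closure.
    exact: open_closedC.
  (* [S] is disjoint from [Q], so by compactness one clopen [W] around [x] misses [S]. The
     intersections of [W] with [O] and with [closure V] then coincide, which makes a clopen set
     around [x]; it contains [Q]. *)
  have [W [Wx [oW cW]] WS] : exists2 W, E W & W `&` S = set0.
    apply: contrapT => nW; pose F := filter_from E (fun W => W `&` S).
    have FF : ProperFilter F.
      apply: filter_from_proper; last first.
        move=> W EW; apply/set0P; apply/eqP => WS0; apply: nW; by exists W.
      apply: filter_from_filter; first by exists setT; split=> //; exact: clopenT.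
      move=> W W' [Wx clW] [W'x clW']; exists (W `&` W'); last by move=> z [[]].
      by split=> //; exact: clopenI.
    have [|z [[clVz nOz] cz]] := cS F FF; first by exists setT => [|z []//]; split=> //; exact: clopenT.
    have Qz : Q z.
      move=> D' [Dx [oD cD']]; rewrite (closure_id D').1 // => U nU'.
      have FD : F (D' `&` S) by exists D'.
      by have [w [[Dw _] Uw]] := cz _ _ FD nU'; exists w.
    apply: (clV _ clVz); split=> // Cz; apply: nOz; apply: BO.
    by rewrite BC.
  rewrite BC; apply/seteqP; split=> [z []//|z Qz]; split=> //.
  apply: contrapT => nCz.
  have clWO : clopen (W `&` O).
    split; first exact: openI.
    suff -> : W `&` O = W `&` closure V by apply: closedI => //; exact: closed_closure.
    apply/seteqP; split=> w [Ww ?]; split=> //; first exact/subset_closure/OV.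
    by apply: contrapT => nOw; have : set0 w by rewrite -WS.
  have [_ Oz] : (W `&` O) z by apply: Qz; split=> //; split=> //; exact: BO.
  by apply: (clV z) => //; exact/subset_closure/OV.
move=> B [b Bb] [C oC BC] [D cD BD].
have [Bx|nBx] := pselect (B x); first exact: part BC cD BD.
have QBC : Q `&` ~` B = Q `&` ~` C by rewrite BC setCI setIUr setICr set0U.
have QBD : Q `&` ~` B = Q `&` ~` D by rewrite BD setCI setIUr setICr set0U.
have : b \in Q by rewrite inE; move: Bb; rewrite BC => -[].
rewrite -(part (Q `&` ~` B) (~` D) (~` C)) ?inE //; first by case.
- exact: closed_openC.
- exact: open_closedC.
Qed.

Section ZmodOf.
Variables (G : groupType) (cG : abelian_group G).

(** An alias of [G] indexed by the proof of commutativity, on which the additive structure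
    depends. *)
Definition zmod_of (_ : abelian_group G) : Type := G.
Local Notation Z := (zmod_of cG).
HB.instance Definition _ := Choice.copy Z G.

Let add (x y : Z) : Z := (x * y)%g.
Let addA : associative add. Proof. exact: mulgA. Qed.
Let addC : commutative add. Proof. exact: cG. Qed.
Let add0 : left_id (1%g : Z) add. Proof. exact: mul1g. Qed.
Let addN : left_inverse (1%g : Z) (fun x : Z => x^-1%g : Z) add. Proof. exact: mulVg. Qed.
HB.instance Definition _ := GRing.isZmodule.Build Z addA addC add0 addN.

Lemma zmod_of_0 : 0 = 1%g :> Z. Proof. by []. Qed.

Lemma normal_subgroup_zmod (U : set G) :
  normal_subgroup U <-> add_subgroup (U : set Z).
Proof.
split=> [[U1 UM UV _]|sU]; first by split=> // x y Ux /UV; exact: UM.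
split.
- exact: (add_subgroup0 sU).
- by move=> x y Ux Uy; exact: (add_subgroupD sU).
- by move=> x Ux; exact: (add_subgroupN sU).
- by move=> x y Ux; rewrite conjgE (cG x) mulgA mulVg mul1g.
Qed.

End ZmodOf.

Section OpenSubgroups.
Variables (H : profiniteGroupType) (cH : abelian_group H).
Local Notation Z := (zmod_of cH).

Definition open_subgroup (U : set H) : Prop := open U /\ add_subgroup (U : set Z).

Let cptH : compact [set: H]. Proof. exact: profinite_compact. Qed.
Let hausH : hausdorff_space H. Proof. exact: profinite_hausdorff. Qed.

Lemma translate_continuous (a : H) : continuous (fun x : H => a * x)%g.
Proof.
move=> x; apply: (@continuous_comp _ _ _ (fun x => (a, x)) (fun p : H * H => p.1 * p.2)%g).
  by apply: cvg_pair => /=; [exact: cvg_cst|exact: cvg_id].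
exact: mulg_continuous.
Qed.

Lemma open_translate (a : Z) (U : set H) : open U -> open [set x : H | U ((x : Z) - a)].
Proof.
move=> oU; have -> : [set x : H | U ((x : Z) - a)] = (fun x : H => a^-1 * x)%g @^-1` U.
  by apply/seteqP; split=> x /=; rewrite -[(a^-1 * x)%g]/(- a + (x : Z)) addrC.
by apply: open_comp => // x _; exact: translate_continuous.
Qed.

Lemma add_subgroup_open (W O : set H) : add_subgroup (W : set Z) ->
  nbhs (1%g : H) O -> O `<=` W -> open W.
Proof.
move=> sW nO OW; rewrite openE => x Wx.
have : nbhs x [set y : H | O ((y : Z) - (x : Z))].
  have : nbhs (x^-1 * x)%g O by rewrite mulVg.
  move=> /(@translate_continuous x^-1%g x) nO1.
  have {}nO1 : nbhs x ((fun y : H => x^-1 * y)%g @^-1` O) by exact: nO1.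
  apply: filterS nO1 => y /=.
  by rewrite -[(x^-1 * y)%g]/(- (x : Z) + (y : Z)) addrC.
by apply: filterS => y /OW Wyx; exact/(add_subgroup_congr sW Wyx).
Qed.

(** The translations that, with their inverses, map a clopen neighbourhood [C] of 1 into itself form
    a subgroup. It lies in [C], as 1 does, and compactness of [C] makes it open. *)
Lemma open_subgroup_basis (O : set H) : nbhs (1%g : H) O ->
  exists2 U, open_subgroup U & U `<=` O.
Proof.
move=> nO.
have zdH := compact_totally_disconnected_zero_dimensional hausH cptH
  (@profinite_totally_disconnected H).
have [C [C1 [oC cC]] CO] := zero_dimensional_cvg hausH zdH cptH nO.
have cptC : compact C by exact: subclosed_compact cC cptH _.
pose V : set H := [set h | forall x, C x -> C (h * x)%g].
have nV : nbhs (1%g : H) V.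
  have /compact_near_coveringP := cptC.
  move=> /(_ H (nbhs (1%g : H)) (fun h x => C (h * x)%g) _) H1.
  apply: H1 => x Cx.
  have : nbhs (1 * x)%g C by rewrite mul1g; exact: open_nbhs_nbhs.
  move=> /(@mulg_continuous H (1%g, x)) [[P Q] /= [nP nQ] PQ].
  by exists (Q, P) => // -[y h] /= [Qy Ph]; apply: (PQ (h, y)).
pose U : set H := [set h | V h /\ V h^-1%g].
exists U; last by move=> h [Vh _]; apply: CO; rewrite -[h]mulg1; exact: Vh.
have sU : add_subgroup (U : set Z).
  split.
    by split=> x /=; rewrite -?[(0 : Z)]/(1%g : H) ?invg1 mul1g.
  move=> x y [Vx Vx'] [Vy Vy']; split=> z Cz.
    by rewrite -[(x : Z) - y]/(x * y^-1)%g -mulgA; apply/Vx/Vy'.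
  by rewrite -[(x : Z) - y]/(x * y^-1)%g invgM invgK -mulgA; apply/Vy/Vx'.
split=> //; apply: (@add_subgroup_open _ U) => //.
apply: filterI => //.
have : nbhs (1^-1)%g V by rewrite invg1.
exact: (@invg_continuous H 1%g).
Qed.

Lemma open_subgroupI (U V : set H) : open_subgroup U -> open_subgroup V ->
  open_subgroup (U `&` V).
Proof.
move=> [oU sU] [oV sV]; split; first exact: openI.
split=> [|x y [Ux Vx] [Uy Vy]]; first by split; exact: add_subgroup0.
by split; exact: add_subgroupB.
Qed.

Lemma open_subgroupT : open_subgroup setT.
Proof. by split=> //; exact: openT. Qed.

Lemma open_subgroup_nbhs (x : Z) (U : set H) : open_subgroup U ->
  nbhs (x : H) [set y : H | U ((y : Z) - x)].
Proof.
move=> [oU sU]; apply: open_nbhs_nbhs; split; first exact: open_translate.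
by rewrite /= subrr; exact: add_subgroup0.
Qed.

Lemma nbhs_open_subgroup (x : H) (O : set H) : nbhs x O ->
  exists2 U, open_subgroup U & forall y : Z, U (y - (x : Z)) -> O y.
Proof.
move=> nO; have : nbhs (x * 1)%g O by rewrite mulg1.
move=> /(@translate_continuous x 1%g) /open_subgroup_basis[U oU UO].
exists U => // y /UO /=; congr O.
by rewrite -[(x * _)%g]/((x : Z) + (y - (x : Z))) addrC subrK.
Qed.

Lemma open_subgroup_separated (x y : Z) :
  (forall U, open_subgroup U -> U (x - y)) -> x = y.
Proof.
move=> Uxy; apply/eqP/negPn/negP => xy.
have := hausH; rewrite open_hausdorff => /(_ x y xy)[[P Q] /= [Px Qy] [oP oQ /eqP PQ]].
have [U oU UP] := nbhs_open_subgroup (open_nbhs_nbhs (conj oQ (set_mem Qy))).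
have : set0 x; last by [].
rewrite -PQ; split; first exact: set_mem.
by apply: UP; exact: Uxy.
Qed.

Lemma open_subgroup_finite_index (U : set H) : open_subgroup U ->
  finite_index (U : set Z).
Proof.
move=> oU; suff [l] : exists l : seq Z, forall x : Z, exists2 y : Z, y \in l & U (x - y).
  by apply: list_finite_index; case: oU.
(* Finite subcovers are expressed by lists of points, filtered by inclusion, so that
   [compact_near_coveringP] applies. *)
pose F := filter_from setT (fun l : seq H => [set l' : seq H | {subset l <= l'}]).
have FF : Filter F.
  apply: filter_from_filter; first by exists [::].
  move=> l l' _ _; exists (l ++ l') => // l'' ll.
  by split=> x xl; apply: ll; rewrite mem_cat xl ?orbT.
have /compact_near_coveringP := cptH.
move=> /(_ _ F (fun l x => exists2 y : Z, (y : H) \in l & U ((x : Z) - y)) FF).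
case=> [x _|l _ lP]; last first.
  by exists l => x; have [y yl Uxy] := lP l (fun _ => id) x I; exists y.
exists ([set y : H | U ((y : Z) - (x : Z))], [set l' : seq H | {subset [:: x] <= l'}]).
  by split; [exact: open_subgroup_nbhs|exists [:: x]].
by move=> [y l] [/= Uyx xl]; exists x => //; apply: xl; rewrite mem_head.
Qed.

Lemma open_subgroup_exponent (U : set H) : open_subgroup U ->
  exists2 n, (0 < n)%N & forall x : Z, U (x *+ n).
Proof.
move=> oU; apply: (finite_index_exponent oU.2).
exact: open_subgroup_finite_index.
Qed.

(** Compatible cosets of the open subgroups have the finite intersection property, so by compactness
    they have a common point. This is how elements of [H] are built from approximations. *)
Lemma open_subgroup_assemble (c : set H -> Z) :
  (forall U V, open_subgroup U -> open_subgroup V -> U `<=` V -> V (c U - c V)) ->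
  exists h : Z, forall U, open_subgroup U -> U (h - c U).
Proof.
move=> cP; pose K U : set H := [set h : H | U ((h : Z) - c U)].
pose F := filter_from open_subgroup K.
have FF : ProperFilter F.
  apply: filter_from_proper; last first.
    by move=> U [oU sU]; exists (c U); rewrite /K /= subrr; exact: add_subgroup0.
  apply: filter_from_filter; first by exists setT; exact: open_subgroupT.
  move=> U V oU oV; exists (U `&` V); first exact: open_subgroupI.
  have oUV := open_subgroupI oU oV.
  move=> h [Uh Vh]; split; rewrite /K /=.
    by apply: (add_subgroup_trans oU.2 Uh); apply: cP => // x [].
  by apply: (add_subgroup_trans oV.2 Vh); apply: cP => // x [].
have [h [_ ch]] := cptH FF filterT.
exists h => U oU; have FK : F (K U) by exists U.
have [y [Ky Uyh]] := ch _ _ FK (open_subgroup_nbhs h oU).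
exact: (add_subgroup_trans oU.2 (add_subgroup_sym oU.2 Uyh)).
Qed.

End OpenSubgroups.

(** * Free profinite abelian groups in coordinates *)

Local Notation opc X := (one_point_compactification (discrete_topology X)).

Lemma compact_discrete_finite (X : choiceType) (K : set (discrete_topology X)) :
  compact K -> finite_set (K : set X).
Proof.
move=> cK; pose F := filter_from setT (fun l : seq X => [set l' : seq X | {subset l <= l'}]).
have FF : Filter F.
  apply: filter_from_filter; first by exists [::].
  move=> l l' _ _; exists (l ++ l') => // l'' ll.
  by split=> x xl; apply: ll; rewrite mem_cat xl ?orbT.
have /compact_near_coveringP := cK.
move=> /(_ _ F (fun l (x : X) => x \in l) FF); case=> [x _|l _ lP].
  exists ([set x], [set l' : seq X | {subset [:: x] <= l'}]).
    by split; [exact: discrete_set1|exists [:: x]].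
  by move=> [y l] [/= -> xl]; apply: xl; rewrite mem_head.
apply: (@sub_finite_set _ _ [set` l]); last exact: finite_seq.
by move=> x /(lP l (fun _ => id)).
Qed.

Section ConvergingToOne.
Variables (X : choiceType) (H : profiniteGroupType) (cH : abelian_group H).
Variable f : opc X -> H.
Hypothesis f1 : f None = 1%g.

(** Only continuity at [None] matters: its neighbourhoods have finite complements, and the open
    subgroups form a basis at 1. This is convergence to 1. *)
Lemma opc_continuousP : continuous f <->
  forall U, open_subgroup cH U -> finite_set [set x : X | ~ U (f (Some x))].
Proof.
split=> [cf U oU|fU].
  have : nbhs (None : opc X) (f @^-1` U).
    apply: (cf None); rewrite f1; apply: open_nbhs_nbhs; split; first by case: oU.
    by case: oU => _; exact: add_subgroup0.
  move=> [K [cK _]] KU; apply: sub_finite_set (compact_discrete_finite cK).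
  by move=> x /= nU; apply: contrapT => nK; apply: nU; apply: KU; left; exists x.
move=> [x|] O nO.
  have : nbhs (Some x : opc X) (Some @` [set x : discrete_topology X]).
    exact/one_point_compactification_some_nbhs/discrete_set1.
  move=> nx; change (nbhs (Some x : opc X) (f @^-1` O)).
  apply: (@filterS _ _ (nbhs_filter (Some x : opc X)) _ _ _ nx) => _ [_ -> <-].
  exact: nbhs_singleton nO.
rewrite f1 in nO; have [U oU UO] := open_subgroup_basis cH nO.
exists [set x : discrete_topology X | ~ U (f (Some x))].
  by split; [apply: finite_compact; exact: fU|exact: discrete_closed].
move=> [x|] /=.
  by move=> [[y /contrapT Uy [<-]]|//]; exact: UO.
by move=> _; rewrite /preimage /= f1; exact: nbhs_singleton.
Qed.

End ConvergingToOne.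

Lemma preimage_add_subgroup (F H : groupType) (cF : abelian_group F)
    (cH : abelian_group H) (g : F -> H) (U : set H) : {morph g : x y / (x * y)%g} ->
  add_subgroup (U : set (zmod_of cH)) -> add_subgroup (g @^-1` U : set (zmod_of cF)).
Proof.
move=> gM sU.
have g1 : g 1%g = 1%g by apply: (@mulgI _ (g 1%g)); rewrite -gM !mulg1.
split; first by rewrite /preimage /= -[0]/(1%g : F) g1; exact: (add_subgroup0 sU).
move=> a b Ua Ub; rewrite /preimage /=.
have -> : g (a - b) = (g a : zmod_of cH) - (g b : zmod_of cH).
  apply/eqP; rewrite eq_sym (@subr_eq (zmod_of cH)); apply/eqP.
  change (g a = (g (a - b) * g b)%g); rewrite -gM; congr g.
  exact: (esym (subrK b a)).
exact: (add_subgroupB sU Ua Ub).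
Qed.

Lemma preimage_open_subgroup (F H : profiniteGroupType) (cF : abelian_group F)
    (cH : abelian_group H) (g : F -> H) (U : set H) : {morph g : x y / (x * y)%g} ->
  continuous g -> open_subgroup cH U -> open_subgroup cF (g @^-1` U).
Proof.
move=> gM gc [oU sU]; split; first by apply: open_comp => // x _; exact: gc.
refine (@preimage_add_subgroup F H cF cH g U gM sU).
Qed.

Lemma hom_continuous (F H : profiniteGroupType) (cF : abelian_group F) (cH : abelian_group H)
    (g : F -> H) : {morph g : x y / (x * y)%g} ->
  (forall U, open_subgroup cH U -> nbhs (1%g : F) (g @^-1` U)) -> continuous g.
Proof.
move=> gM gU x O /(nbhs_open_subgroup cH)[U oU UO].
have sW := preimage_add_subgroup cF gM oU.2.
have oW : open_subgroup cF (g @^-1` U).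
  by split=> //; apply: (add_subgroup_open sW (gU U oU)).
change (nbhs x (g @^-1` O)).
apply: filterS (open_subgroup_nbhs x oW) => y /=; rewrite /preimage /= => Uyx.
apply: UO; move: Uyx; congr U.
apply/esym/eqP; rewrite (@subr_eq (zmod_of cH)); apply/eqP.
set d : zmod_of cF := (y : zmod_of cF) - _.
change (g y = (g d * g x)%g); rewrite -gM; congr g.
exact: (esym (subrK (x : zmod_of cF) y)).
Qed.

Section Coordinates.
Variables (X : choiceType) (F : profiniteGroupType) (cF : abelian_group F).
Variable i : opc X -> F.
Local Notation Z := (zmod_of cF).

(* chi x is the continuous homomorphism F -> Zhat dual to the generator i x, given
   by its residues; the expansion reads g = \sum_x chi x g * i x in F / U. *)
Record coordinates (chi : X -> nat -> Z -> int) : Prop := Coordinates {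
  coord_add : forall x n, (0 < n)%N -> additive_mod (dvdset n) (chi x n);
  coord_open : forall x n, (0 < n)%N -> open [set g : F | (n %| chi x n g)%Z];
  coord_compat : forall x n m g, (0 < m)%N -> (n %| m)%N ->
    (n %| chi x m g - chi x n g)%Z;
  coord_delta : forall x y n, (0 < n)%N ->
    (n %| chi x n (i (Some y)) - (x == y)%:Z)%Z;
  coord_expansion : forall (U : set F) n (r : seq X), open_subgroup cF U -> (0 < n)%N ->
    (forall g : Z, U (g *+ n)) -> uniq r -> (forall x, ~ U (i (Some x)) -> x \in r) ->
    forall g : Z, U (g - \sum_(x <- r) (i (Some x) : Z) *~ chi x n g)
}.

Hypotheses (ic : continuous i) (i1 : i None = 1%g).
Variable chi : X -> nat -> Z -> int.
Hypothesis chiP : coordinates chi.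

Section Extension.
Variables (H : profiniteGroupType) (cH : abelian_group H) (f : opc X -> H).
Hypotheses (fc : continuous f) (f1 : f None = 1%g).
Local Notation ZH := (zmod_of cH).

Let supp (U : set H) : exists r : seq X, open_subgroup cH U ->
  uniq r /\ forall x, ~ U (f (Some x)) -> x \in r.
Proof.
have [oU|] := pselect (open_subgroup cH U); last by exists [::].
have /finite_seqP[r rE] := (opc_continuousP cH f1).1 fc U oU.
exists (undup r) => _; split; first exact: undup_uniq.
by move=> x nU; rewrite mem_undup; have : [set` r] x by rewrite -rE.
Qed.

Let expo (U : set H) : exists n, open_subgroup cH U ->
  (0 < n)%N /\ forall h : ZH, U (h *+ n).
Proof.
have [oU|] := pselect (open_subgroup cH U); last by exists 0%N.
by have [n n0 nU] := open_subgroup_exponent oU; exists n.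
Qed.

(** The extension of [f] is the infinite sum of the [f x] with coefficients [chi x g]. Modulo an
    open [U] it reduces to such a finite sum, with [n] an exponent of H / U and [r] containing all x
    with [f x] outside [U]. *)
Let partial (n : nat) (r : seq X) (g : Z) : ZH :=
  \sum_(x <- r) (f (Some x) : ZH) *~ chi x n g.

Let MzU (U : set H) n (h : ZH) (m : int) : open_subgroup cH U ->
  (forall h : ZH, U (h *+ n)) -> (n %| m)%Z -> U (h *~ m).
Proof.
move=> [_ sU] nU /dvdzP[q ->]; rewrite mulrzA mulrzAC.
by apply: (add_subgroupMz sU); exact: nU.
Qed.

(** Both sums are compared with the one for the exponent [n * m] and the union of the two lists. *)
Let partial_indep (U : set H) n m r s g : open_subgroup cH U ->
  (0 < n)%N -> (0 < m)%N ->
  (forall h : ZH, U (h *+ n)) -> (forall h : ZH, U (h *+ m)) ->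
  uniq r -> uniq s ->
  (forall x, ~ U (f (Some x)) -> x \in r) -> (forall x, ~ U (f (Some x)) -> x \in s) ->
  U (partial n r g - partial m s g).
Proof.
move=> oU n0 m0 nU mU ur us rU sU; have [_ gU] := oU.
pose t := undup (r ++ s).
have ut : uniq t by exact: undup_uniq.
have base k q : (k %| n * m)%N -> (forall h : ZH, U (h *+ k)) -> uniq q ->
    (forall x, ~ U (f (Some x)) -> x \in q) -> {subset q <= t} ->
    U (partial (n * m) t g - partial k q g).
  move=> kd kU uq qU qt.
  apply: (add_subgroup_trans gU (y := partial k t g)).
    rewrite /partial -sumrB; apply: add_subgroup_sum => // x _.
    rewrite -mulrzBr; apply: (MzU _ oU kU).
    by apply: (coord_compat chiP) => //; rewrite muln_gt0 n0.
  apply: sum_widen_mod => // x xq; apply: add_subgroupMz => //.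
  by apply: contrapT => /qU; rewrite (negbTE xq).
apply: (add_subgroup_trans gU (y := partial (n * m) t g)).
  apply: add_subgroup_sym => //; apply: base => //; first exact: dvdn_mulr.
  by move=> x xr; rewrite mem_undup mem_cat xr.
apply: base => //; first exact: dvdn_mull.
by move=> x xr; rewrite mem_undup mem_cat xr orbT.
Qed.

Let limit (g : Z) : exists h : ZH, forall U n r, open_subgroup cH U -> (0 < n)%N ->
  (forall h : ZH, U (h *+ n)) -> uniq r -> (forall x, ~ U (f (Some x)) -> x \in r) ->
  U (h - partial n r g).
Proof.
pose c U := partial (sval (cid (expo U))) (sval (cid (supp U))) g.
have [U V oU oV UV|h hc] := @open_subgroup_assemble H cH c.
  rewrite /c; case: cid => n /= /(_ oU)[n0 nU]; case: cid => r /= /(_ oU)[ur rU].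
  case: cid => m /= /(_ oV)[m0 mV]; case: cid => s /= /(_ oV)[us sV].
  apply: partial_indep => //; first by move=> h; apply: UV; exact: nU.
  by move=> x nV; apply: rU => /UV.
exists h => U n r oU n0 nU ur rU.
apply: (add_subgroup_trans oU.2 (hc U oU)).
rewrite /c; case: cid => m /= /(_ oU)[m0 mU]; case: cid => s /= /(_ oU)[us sU].
exact: partial_indep.
Qed.

Let ext (g : F) : H := sval (cid (limit g)).

Let extP (g : Z) U : open_subgroup cH U -> exists n r, [/\ (0 < n)%N,
  (forall h : ZH, U (h *+ n)), uniq r, (forall x, ~ U (f (Some x)) -> x \in r) &
  forall g : Z, U ((ext g : ZH) - partial n r g)].
Proof.
move=> oU; have [n /(_ oU)[n0 nU]] := expo U; have [r /(_ oU)[ur rU]] := supp U.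
exists n, r; split=> // {}g; rewrite /ext; case: cid => h /= hP; exact: hP.
Qed.

Let extM : {morph ext : x y / (x * y)%g}.
Proof.
move=> a b; apply: (@open_subgroup_separated H cH) => U oU; have sU := oU.2.
have [n [r [n0 nU ur rU extU]]] := extP a oU.
apply: (add_subgroup_trans sU (extU (a * b)%g)).
apply: (add_subgroup_trans sU (y := partial n r a + partial n r b)).
  rewrite opprD addrA /partial -!sumrB; apply: add_subgroup_sum => // x _.
  rewrite -!mulrzBr; apply: (MzU _ oU nU).
  exact: (coord_add chiP x n0).
rewrite -[(ext a * ext b)%g]/((ext a : ZH) + (ext b : ZH)) opprD addrACA.
by apply: add_subgroupD => //; apply: add_subgroup_sym.
Qed.

Let ext_gen x : ext (i (Some x)) = f (Some x).
Proof.
apply: (@open_subgroup_separated H cH) => U oU; have sU := oU.2.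
have [n [r0 [n0 nU _ _ _]]] := extP (i None) oU.
have [r /(_ oU)[_ rU]] := supp U.
rewrite /ext; case: cid => h /= hP.
pose s := undup (x :: r); have us : uniq s by exact: undup_uniq.
have xs : x \in s by rewrite mem_undup mem_head.
have sU' y : ~ U (f (Some y)) -> y \in s.
  by move=> /rU yr; rewrite mem_undup inE yr orbT.
apply: (add_subgroup_trans sU (hP U n s oU n0 nU us sU')).
have -> : (f (Some x) : ZH) = \sum_(y <- s) (f (Some y) : ZH) *~ (y == x)%:Z.
  by rewrite (@sum_delta _ ZH).
rewrite /partial -sumrB; apply: add_subgroup_sum => // y _.
by rewrite -mulrzBr; apply: (MzU _ oU nU); exact: (coord_delta chiP).
Qed.

Let ext_continuous : continuous ext.
Proof.
apply: (@hom_continuous F H cF cH) => // U oU; have sU := oU.2.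
have [n [r [n0 nU ur rU extU]]] := extP (i None) oU.
have : nbhs (1%g : F) [set g : F | {in r, forall x, (n %| chi x n g)%Z}].
  elim: (r) => [|x s IH]; first by apply: filterS filterT.
  have nx : nbhs (1%g : F) [set g : F | (n %| chi x n g)%Z].
    apply: open_nbhs_nbhs; split; first exact: (coord_open chiP x n0).
    exact: (additive_mod0 (add_subgroup_dvdset n) (coord_add chiP x n0)).
  apply: filterS (filterI nx IH) => g [/= gx gs] y.
  by rewrite inE => /predU1P[->|/gs].
apply: filterS => g /= gr; rewrite /preimage /=.
apply/(add_subgroup_congr sU (extU g)); rewrite /partial.
apply: add_subgroup_sum => // x xr; exact: (MzU _ oU nU (gr x xr)).
Qed.

(** The preimage of [U] under [g] is an open subgroup of [F] with the same exponent and support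
    list, so [g] can be applied to the expansion of [a] modulo this preimage. *)
Let ext_unique (g : F -> H) : {morph g : x y / (x * y)%g} -> continuous g ->
  (forall x, f x = g (i x)) -> ext = g.
Proof.
move=> gM gc gf; apply/funext => a.
apply: (@open_subgroup_separated H cH) => U oU; have sU := oU.2.
have [n [r [n0 nU ur rU extU]]] := extP (i None) oU.
apply: (add_subgroup_trans sU (extU a)); apply: add_subgroup_sym => //.
have gadd : additive_mod (U : set ZH) (g : Z -> ZH).
  move=> x y; rewrite -[g (x + y)]/(g (x * y)%g) gM -[(_ * _)%g]/((g x : ZH) + (g y : ZH)).
  by rewrite -addrA -opprD subrr; exact: add_subgroup0.
have oW := preimage_open_subgroup cF gM gc oU.
have nW (h : Z) : (g @^-1` U) (h *+ n).
  rewrite /preimage /=.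
  exact/(add_subgroup_congr sU (additive_modMn sU gadd h n))/nU.
have rW x : ~ (g @^-1` U) (i (Some x)) -> x \in r.
  by rewrite /preimage /= -gf; exact: rU.
have H1 := coord_expansion chiP oW n0 nW ur rW a.
have H2 := additive_modB sU gadd a (\sum_(x <- r) (i (Some x) : Z) *~ chi x n a).
apply: (add_subgroup_trans sU (y := (g (\sum_(x <- r) (i (Some x) : Z) *~ chi x n a) : ZH))).
  exact: (add_subgroup_congr sU H2).1 H1.
apply: (add_subgroup_trans sU (additive_mod_sum sU gadd _ _)).
rewrite /partial -sumrB; apply: add_subgroup_sum => // x _.
by rewrite gf; exact: (additive_modMz sU gadd).
Qed.

Lemma coordinates_extension : exists! g : F -> H,
  [/\ {morph g : x y / (x * y)%g}, continuous g & forall x, f x = g (i x)].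
Proof.
exists ext; split; last by move=> g [gM gc gf]; exact: ext_unique.
split=> // -[x|]; first by rewrite ext_gen.
rewrite i1 f1; apply: (@mulgI _ (ext 1%g)).
by rewrite -extM !mulg1.
Qed.

End Extension.

Lemma coordinates_free : free_profinite_abelian_on i.
Proof. by split=> // H f cH fc f1; exact: coordinates_extension. Qed.

End Coordinates.

(** * The profinite completion of an abstract abelian group *)

Section Completion.
Variables (A : groupType) (cA : abelian_group A).
Local Notation ZA := (zmod_of cA).
Local Notation P := (profinite_completion A).
Local Notation Q N := (\pi_(quotient_group N)).

Lemma fin_index_add_subgroup (N : fin_index_normal A) : add_subgroup (N : set ZA).
Proof. by case: N => N [sN fN] /=; exact/normal_subgroup_zmod. Qed.

Lemma fin_index_finite_index (N : fin_index_normal A) : finite_index (N : set ZA).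
Proof.
have sN := fin_index_add_subgroup N.
have /finite_seqP[s sE] := finite_quotient N.
have qs (a : ZA) : Q N (a : A) \in s by have : [set` s] (Q N (a : A)) by rewrite -sE.
have fs a : (index (Q N (a : A)) s < size s)%N by rewrite index_mem.
exists 'I_(size s), (fun a => Ordinal (fs a)) => a b /(congr1 val) /= e.
have : Q N (b : A) = Q N (a : A) by rewrite -(nth_index (Q N 1%g) (qs a)) e nth_index.
move=> /quotient_eqP; congr (N : set A).
by rewrite -[(b^-1 * a)%g]/(- b + a) addrC.
Qed.

Lemma quotient_eq_sub (N : fin_index_normal A) (a b : ZA) :
  Q N (a : A) = Q N (b : A) <-> (N : set ZA) (a - b).
Proof.
rewrite quotient_eqP; have -> : ((a : A)^-1 * b)%g = b - a by rewrite addrC.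
by split; apply: add_subgroup_sym; exact: fin_index_add_subgroup.
Qed.

Lemma fin_index_of (N : set ZA) : add_subgroup N -> finite_index N ->
  exists M : fin_index_normal A, (M : set A) = N.
Proof.
move=> sN /finite_index_list[l lP].
have nN : normal_subgroup (N : set A) by exact/(normal_subgroup_zmod cA).
have fN : finite_set (lcosets (N : set A)).
  have cosetE (c : ZA) : [set (c * n)%g | n in (N : set A)] = [set x | N ((x : ZA) - c)].
    apply/seteqP; split=> [_ [n Nn <-]|x Nxc].
      have -> : (c * n)%g = (n : ZA) + c by rewrite addrC.
      by rewrite /= addrK.
    exists ((x : ZA) - c) => //; rewrite -[(c * _)%g]/(c + ((x : ZA) - c)).
    by rewrite addrC subrK.
  apply: (@sub_finite_set _ _ ((fun c : ZA => [set x | N ((x : ZA) - c)]) @` [set` l]));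
    last by apply: finite_image; exact: finite_seq.
  move=> _ [g _ <-]; have [b bl Ngb] := lP g; exists b => //=.
  rewrite (cosetE g); apply/seteqP; split=> x Nx /=.
    exact: (add_subgroup_trans sN Nx (add_subgroup_sym sN Ngb)).
  exact: (add_subgroup_trans sN Nx Ngb).
by exists (FinIndexNormal (conj nN fN)).
Qed.

Lemma completion_abelian : abelian_group P.
Proof.
move=> x y; apply/val_inj/functional_extensionality_dep => N.
change (set_val x N * set_val y N = set_val y N * set_val x N)%g.
have [a ->] := quotient_surj (set_val x N); have [b ->] := quotient_surj (set_val y N).
by rewrite -!quotient_piM cA.
Qed.

Local Notation ZP := (zmod_of completion_abelian).

Definition completion_rep (N : fin_index_normal A) (x : P) : ZA := repr (set_val x N).

Lemma completion_repE N x : set_val x N = Q N (completion_rep N x : A).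
Proof. by rewrite /completion_rep reprK. Qed.

Lemma set_val_sub N (x y : ZP) : set_val ((x - y : ZP) : P) N = Q N ((completion_rep N x - completion_rep N y : ZA) : A).
Proof.
rewrite -[RHS]/(Q N ((completion_rep N x : A) * (completion_rep N y : A)^-1)%g).
rewrite quotient_piM quotient_piV -!completion_repE.
by rewrite -[LHS]/(set_val ((x : P) * (y : P)^-1)%g N).
Qed.

Lemma completion_compat (N M : fin_index_normal A) (x : P) (a : ZA) : N `<=` M ->
  set_val x N = Q N (a : A) -> set_val x M = Q M (a : A).
Proof.
have cx : compatible_families A (set_val x) := set_mem (valP x).
by move=> NM; exact: cx.
Qed.

Lemma set_val_rep (N M : fin_index_normal A) (x : P) : N `<=` M -> set_val x M = Q M (completion_rep N x : A).
Proof. by move=> NM; apply: (completion_compat NM); exact: completion_repE. Qed.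

Definition coset_kernel (N : fin_index_normal A) : set P := [set x | set_val x N = Q N 1%g].

Lemma open_subgroup_coset_kernel N : open_subgroup completion_abelian (coset_kernel N).
Proof.
split; last first.
  split=> // x y Nx Ny; rewrite /coset_kernel /= set_val_sub.
  apply/quotient_eq_sub; rewrite -zmod_of_0 subr0.
  have sN := fin_index_add_subgroup N.
  have kN z : coset_kernel N z -> (N : set ZA) (completion_rep N z).
    by rewrite /coset_kernel /= completion_repE => /quotient_eq_sub; rewrite -zmod_of_0 subr0.
  by apply: add_subgroupB => //; exact: kN.
rewrite openE => x Nx; apply: filterS (nbhs_completion_coord x N) => y /= yx.
by rewrite /coset_kernel /= yx.
Qed.

Lemma fin_index_setI (N M : fin_index_normal A) : exists K : fin_index_normal A,
  (K : set A) = N `&` M.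
Proof.
apply: fin_index_of; last by apply: finite_indexI; exact: fin_index_finite_index.
have sN := fin_index_add_subgroup N; have sM := fin_index_add_subgroup M.
split; first by split; exact: add_subgroup0.
by move=> x y [Nx Mx] [Ny My]; split; exact: add_subgroupB.
Qed.

Lemma fin_index_setT : exists K : fin_index_normal A, (K : set A) = setT.
Proof.
apply: fin_index_of; first by [].
by exists unit, (fun=> tt).
Qed.

(** A neighbourhood in the product topology constrains finitely many coordinates. Intersecting the
    corresponding subgroups of finite index leaves a single one. *)
Lemma nbhs_coset_kernel (x : ZP) (O : set P) : nbhs (x : P) O ->
  exists N, forall y : ZP, coset_kernel N (y - x) -> O y.
Proof.
pose G := filter_from [set: fin_index_normal A] (fun N => [set y : P | coset_kernel N ((y : ZP) - x)]).
have valE N (y : ZP) : coset_kernel N (y - x) <-> set_val (y : P) N = set_val (x : P) N.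
  rewrite /coset_kernel /= set_val_sub !(completion_repE N).
  by rewrite !quotient_eq_sub -zmod_of_0 subr0.
have GF : Filter G.
  apply: filter_from_filter.
    by have [K _] := fin_index_setT; exists K.
  move=> N M _ _; have [K KNM] := fin_index_setI N M; exists K => // y /= /valE yx.
  have [KN KM] : K `<=` N /\ K `<=` M by rewrite KNM; split=> z [].
  have yK : set_val (y : P) K = Q K (completion_rep K x : A) by rewrite yx completion_repE.
  split; apply/valE.
    by rewrite (completion_compat KN yK) (set_val_rep _ KN).
  by rewrite (completion_compat KM yK) (set_val_rep _ KM).
suff Gx : G --> (x : P) by move=> /Gx [N _ NO]; exists N.
move=> O' [_ [[W oW <-] /= Wx] sO].
have : nbhs (set_val (x : P)) W by exact: open_nbhs_nbhs.
have cv : (fun y : P => set_val y : quotient_product A) @ G --> (set_val (x : P) : quotient_product A).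
  apply/cvg_sup => N U [_ [[V oV <-] /= Vx] sU]; apply: (filterS sU).
  exists N => // y /= /valE yx; rewrite /preimage /=.
  by move: Vx; congr V.
by move=> nW; apply: (filterS sO); exact: cv nW.
Qed.

Lemma preimage_to_completion (U : set P) : open_subgroup completion_abelian U ->
  add_subgroup (@to_completion A @^-1` U : set ZA) /\
  finite_index (@to_completion A @^-1` U : set ZA).
Proof.
move=> oU; have eM : {morph @to_completion A : x y / (x * y)%g} by exact: gmulfM.
split; first exact: (preimage_add_subgroup cA eM oU.2).
have [T [f fU]] := open_subgroup_finite_index oU.
exists T, (fun a => f (to_completion (a : A))) => a b /fU.
congr U; apply/esym/eqP; rewrite eq_sym (@subr_eq ZP); apply/eqP.
rewrite -[RHS]/(to_completion _ * to_completion _)%g -eM; congr to_completion.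
exact: (esym (subrK b a)).
Qed.

(* U is closed, so it contains the closure of the image of N, which is the kernel
   of the projection of P to A / N. *)
Lemma to_completion_congr (U : set P) (N : fin_index_normal A) (x : ZP) (a : ZA) :
  open_subgroup completion_abelian U -> (N : set A) `<=` @to_completion A @^-1` U ->
  set_val (x : P) N = Q N (a : A) -> U (x - (to_completion (a : A) : ZP)).
Proof.
move=> oU NU xa; have [M MU] := nbhs_coset_kernel (open_subgroup_nbhs x oU).
have [K KNM] := fin_index_setI N M.
have [KN KM] : K `<=` N /\ K `<=` M by rewrite KNM; split=> z [].
pose b := completion_rep K x.
have Uxb : U (x - (to_completion (b : A) : ZP)).
  apply: (add_subgroup_sym oU.2); apply: MU.
  rewrite /coset_kernel /= set_val_sub; apply/quotient_eq_sub.
  rewrite -zmod_of_0 subr0; apply/quotient_eq_sub.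
  by rewrite -!completion_repE (@set_val_rep _ _ x KM).
apply: (add_subgroup_trans oU.2 Uxb).
have Nba : (N : set ZA) (b - a).
  by apply/quotient_eq_sub; rewrite -xa (set_val_rep _ KN).
have := NU _ Nba; congr U.
apply/eqP; rewrite eq_sym (@subr_eq ZP); apply/eqP.
rewrite -[RHS]/(to_completion _ * to_completion _)%g -gmulfM; congr to_completion.
exact: (esym (subrK a b)).
Qed.

End Completion.

(** * Generators and coordinates of the completion *)

Section CompletionFree.
Variables (A : groupType) (cA : abelian_group A).
Local Notation ZA := (zmod_of cA).
Local Notation P := (profinite_completion A).
Local Notation Q N := (\pi_(quotient_group N)).
Local Notation ZP := (zmod_of (completion_abelian cA)).
Local Notation rep := (completion_rep cA).

Lemma to_completion_additive (U : set P) : open_subgroup (completion_abelian cA) U ->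
  additive_mod (U : set ZP) (fun a : ZA => to_completion (a : A) : ZP).
Proof.
by move=> [_ sU]; apply: morph_additive_mod => // a b; exact: gmulfM.
Qed.

(** If [a] is not in pA, some homomorphism to Z / p does not vanish at [a]. Its kernel [N] contains
    pA, so a p-th multiple in the completion is trivial in A / N, whereas [a] is not. *)
Lemma completion_pure p (a : ZA) : torsion_free ZA -> prime p ->
  multiples p (to_completion (a : A) : ZP) -> multiples p a.
Proof.
move=> tfA pp [y _ ya]; apply: contrapT => npa.
have [e eM pea] := separate_modp tfA pp npa.
have [N NE] := fin_index_of (additive_mod_kernel (add_subgroup_dvdset p) eM)
  (additive_mod_finite_index (prime_gt0 pp) eM).
have sp := add_subgroup_dvdset p.
have pN (b : ZA) : (N : set ZA) (b *+ p).
  rewrite NE; apply/(add_subgroup_congr sp (additive_modMn sp eM b p)).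
  by rewrite /dvdset /= -mulr_natr natz dvdz_mull.
have sK := (open_subgroup_coset_kernel cA N).2.
have yN n : set_val ((y *+ n : ZP) : P) N = Q N ((rep N y *+ n : ZA) : A).
  elim: n => [//|n IH]; rewrite !mulrS.
  rewrite -[LHS]/(set_val (y : P) N * set_val ((y *+ n : ZP) : P) N)%g IH.
  by rewrite (completion_repE cA N y) -quotient_piM.
apply: pea; suff : (N : set ZA) a by rewrite NE.
have : Q N (a : A) = Q N ((rep N y *+ p : ZA) : A) by rewrite -yN ya.
move=> /(@quotient_eq_sub _ cA _ _ _) H.
exact: (add_subgroup_congr (fin_index_add_subgroup cA N) H).2 (pN _).
Qed.

Hypothesis richA : rich ZA.

Let X : choiceType := set ZA.

(** The generator at [x] has as component in A / N the coefficient [h N x] of [beta x] in the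
    projection A -> A / N. The coordinate at [x] extends [beta x] from A to the completion. *)
Lemma completion_coordinates : exists (i : opc X -> P) (chi : X -> nat -> ZP -> int),
  [/\ continuous i, i None = 1%g & @coordinates X P (completion_abelian cA) i chi].
Proof.
have [beta betaP] := rich_dual_basis richA.
have [betaM betaC _ _] := betaP.
have sN (N : fin_index_normal A) := fin_index_add_subgroup cA N.
have fN (N : fin_index_normal A) := fin_index_finite_index cA N.
have NMz (N : fin_index_normal A) n (h : ZA) (m : int) :
    (forall a : ZA, (N : set ZA) (a *+ n)) -> (n %| m)%Z -> (N : set ZA) (h *~ m).
  by move=> nN /dvdzP[q ->]; rewrite mulrzA mulrzAC; apply: (add_subgroupMz (sN N)); exact: nN.
(* The coefficients are found for one exponent [m] and shown to serve for every exponent [n], by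
   passing through [n * m]. *)
have hex (N : fin_index_normal A) : exists h : X -> ZA, exists2 r : seq X,
    uniq r /\ (forall x, x \notin r -> h x = 0) & forall n, (0 < n)%N -> (forall a : ZA, (N : set ZA) (a *+ n)) ->
      forall a : ZA, (N : set ZA) (a - \sum_(x <- r) h x *~ beta x n a).
  have [m m0 mN] := finite_index_exponent (sN N) (fN N).
  have idM : additive_mod (N : set ZA) (id : ZA -> ZA).
    exact: morph_additive_mod.
  have [r [h [ur h0 hN]]] := dual_basis_decomposition betaP (sN N) m0 mN (fN N) idM.
  exists h, r => // n n0 nN a.
  apply: (add_subgroup_trans (sN N) (hN a)).
  have nm0 : (0 < n * m)%N by rewrite muln_gt0 n0.
  apply: (add_subgroup_trans (sN N) (y := \sum_(x <- r) h x *~ beta x (n * m)%N a)).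
    apply: (add_subgroup_sym (sN N)); rewrite -sumrB; apply: (add_subgroup_sum (sN N)) => x _.
    by rewrite -mulrzBr; apply: (NMz _ m) => //; apply: betaC => //; exact: dvdn_mull.
  rewrite -sumrB; apply: (add_subgroup_sum (sN N)) => x _.
  by rewrite -mulrzBr; apply: (NMz _ n) => //; apply: betaC => //; exact: dvdn_mulr.
pose h N := sval (cid (hex N)).
have hP N := svalP (cid (hex N)).
(* Both [h N] and [h M] decompose the projection A -> A / M, so uniqueness makes them agree modulo
   [M]. *)
have h_compat (N M : fin_index_normal A) x : N `<=` M -> (M : set ZA) (h N x - h M x).
  move=> NM; have [r [ur h0] hN] := hP N; have [s [us h0'] hM] := hP M.
  rewrite -/(h N) -/(h M) in h0 hN h0' hM.
  pose t := undup (r ++ s); have ut : uniq t by exact: undup_uniq.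
  have [xt|] := boolP (x \in t); last first.
    rewrite mem_undup mem_cat negb_or => /andP[/h0 -> /h0' ->].
    by rewrite subrr; exact: (add_subgroup0 (sN M)).
  have [n n0 nN] := finite_index_exponent (sN N) (fN N).
  have nM (a : ZA) : (M : set ZA) (a *+ n) by apply: NM; exact: nN.
  apply: (dual_basis_unique betaP (sN M) n0 nM (fN M) ut (h := fun x => h N x - h M x) _ xt) => a.
  rewrite (eq_bigr (fun x => h N x *~ beta x n a - h M x *~ beta x n a)); last first.
    by move=> y _; rewrite mulrzBl.
  rewrite sumrB -(sum_widen ur ut); last 2 first.
    by move=> y yr; rewrite mem_undup mem_cat yr.
    by move=> y /h0 ->; rewrite mul0rz.
  rewrite -(sum_widen us ut); last 2 first.
    by move=> y ys; rewrite mem_undup mem_cat ys orbT.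
    by move=> y /h0' ->; rewrite mul0rz.
  apply: (add_subgroup_trans (sN M) (y := a)); last exact: hM.
  by apply: (add_subgroup_sym (sN M)); apply: NM; exact: hN.
have icomp x : ((fun N => Q N (h N x : A)) : quotient_product A) \in compatible_families A.
  apply/mem_set => N M NM g /= /(@quotient_eq_sub _ cA _ _ _) Nhg; apply/(@quotient_eq_sub _ cA _ _ _).
  by apply: (add_subgroup_trans (sN M) (add_subgroup_sym (sN M) (h_compat N M x NM))); exact: NM.
pose ix x : P := exist (fun y => y \in compatible_families A) _ (icomp x).
have ixE x N : set_val (ix x) N = Q N (h N x : A) by [].
pose i (o : opc X) : P := if o is Some x then ix x else 1%g.
have h_exp (U : set P) x (N : fin_index_normal A) : open_subgroup (completion_abelian cA) U ->
    (N : set A) `<=` @to_completion A @^-1` U -> U ((ix x : ZP) - (to_completion (h N x : A) : ZP)).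
  by move=> oU NU; exact: (to_completion_congr oU NU).
have ic : continuous i.
  apply/(opc_continuousP (completion_abelian cA)) => // U oU.
  have [sW fW] := preimage_to_completion oU.
  have [N NE] := fin_index_of sW fW.
  have [r [_ h0] _] := hP N.
  apply: (@sub_finite_set _ _ [set` r]); last exact: finite_seq.
  move=> x /= nU; apply: contrapT => /negP xr; apply: nU.
  have NU : (N : set A) `<=` @to_completion A @^-1` U by rewrite NE.
  apply: (add_subgroup_congr oU.2 (h_exp U x N oU NU)).2.
  by apply: NU; rewrite [h N x]h0 //; exact: (add_subgroup0 (sN N)).
(* [K x n] is the kernel of [beta x n] modulo n, so the residue of [beta x n] depends only on the
   component in A / K. For n = 0 any subgroup is chosen. *)
have Kex x n : exists K : fin_index_normal A, (0 < n)%N -> (K : set A) = [set a | (n %| beta x n a)%Z].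
  have [n0|] := boolP (0 < n)%N; last by have [K _] := fin_index_setT cA; exists K.
  have [K KE] := fin_index_of (additive_mod_kernel (add_subgroup_dvdset n) (betaM x n n0)) (additive_mod_finite_index n0 (betaM x n n0)).
  by exists K.
pose K x n := sval (cid (Kex x n)).
have KE x n : (0 < n)%N -> (K x n : set A) = [set a | (n %| beta x n a)%Z].
  exact: svalP (cid (Kex x n)).
pose chi x n (y : ZP) : int := beta x n (rep (K x n) y).
have chiE x n (y : P) (N : fin_index_normal A) (a : ZA) : (0 < n)%N -> N `<=` K x n ->
    set_val y N = Q N (a : A) -> (n %| chi x n y - beta x n a)%Z.
  move=> n0 NK yN; have := completion_compat NK yN.
  rewrite (completion_repE cA) => /(@quotient_eq_sub _ cA _ _ _) /=.
  rewrite KE // => H.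
  have sn := add_subgroup_dvdset n.
  exact: (add_subgroup_congr sn (additive_modB sn (betaM x n n0) _ _)).1 H.
have chi_to x n (a : ZA) : (0 < n)%N -> (n %| chi x n (to_completion (a : A)) - beta x n a)%Z.
  by move=> n0; apply: (chiE x n _ (K x n)).
exists i, chi; split=> //; split.
- move=> x n n0 a b.
  have sn := add_subgroup_dvdset n.
  have abK : set_val ((a + b : ZP) : P) (K x n) = Q (K x n) ((rep (K x n) a + rep (K x n) b : ZA) : A).
    rewrite -[LHS]/(set_val (a : P) (K x n) * set_val (b : P) (K x n))%g.
    by rewrite !(completion_repE cA) -quotient_piM.
  have := rpredD (chiE x n _ (K x n) _ n0 (@subset_refl _ _) abK) (betaM x n n0 (rep (K x n) a) (rep (K x n) b)).
  rewrite /dvdset /=; congr (_ %| _)%Z; rewrite -/(chi x n a) -/(chi x n b); ring.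
- move=> x n n0; rewrite openE => y /= ny.
  apply: filterS (nbhs_completion_coord (y : P) (K x n)) => z /= zy.
  by rewrite /chi /completion_rep zy.
- move=> x n m y m0 nm; have n0 := dvdn_gt0 m0 nm.
  have KK : K x m `<=` K x n.
    rewrite !KE // => a /= ma.
    have nm' : (n %| m%:Z)%Z by [].
    by have := rpredB (dvdz_trans nm' ma) (betaC x n m a m0 nm); rewrite subKr.
  have yK := completion_repE cA (K x m) y.
  have := rpredB (betaC x n m (rep (K x m) y) m0 nm) (chiE x n y (K x m) _ n0 KK yK).
  rewrite -/(chi x m y).
  congr (_ %| _)%Z; ring.
(* Applying [beta x n] to the decomposition of [a] modulo its kernel expresses [beta x n] through
   all the [beta z n], with coefficients [beta x n (h Kx z)]. By uniqueness for homomorphisms to Z /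
   n, these are 1 at z = x and 0 elsewhere. *)
- move=> x y n n0; pose Kx := K x n; have sn := add_subgroup_dvdset n.
  have := chiE x n (ix y) Kx (h Kx y) n0 (@subset_refl _ _) (ixE y Kx).
  set c := chi x n _; rewrite -[X in _ -> X]/(dvdset n (c - (x == y)%:Z)) => cE.
  apply: (add_subgroup_trans sn cE).
  have [r [ur h0] hK] := hP Kx; rewrite -/(h Kx) in h0 hK.
  have KxE : (Kx : set A) = [set a | (n %| beta x n a)%Z] by exact: KE.
  have nK (a : ZA) : (Kx : set ZA) (a *+ n).
    rewrite KxE; apply/(add_subgroup_congr sn (additive_modMn sn (betaM x n n0) a n)).
    by rewrite /dvdset /= -mulr_natr natz dvdz_mull.
  pose t := undup [:: x, y & r]; have ut : uniq t by exact: undup_uniq.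
  have xt : x \in t by rewrite mem_undup mem_head.
  have yt : y \in t by rewrite mem_undup !inE eqxx orbT.
  have fn : finite_index (dvdset n).
    exact: (@additive_mod_finite_index _ n id n0 (morph_additive_mod sn (fun _ _ => erefl))).
  have nn (b : int) : dvdset n (b *+ n) by rewrite /dvdset /= -mulr_natr natz dvdz_mull.
  apply: (dual_basis_unique betaP sn n0 nn fn ut (h := fun z => beta x n (h Kx z) - (x == z)%:Z) _ yt) => a.
  have -> : \sum_(z <- t) (beta x n (h Kx z) - (x == z)%:Z) *~ beta z n a =
      \sum_(z <- t) beta x n (h Kx z) *~ beta z n a - beta x n a.
    rewrite -[X in _ - X](@sum_delta _ _ t (fun z => beta z n a) x ut xt) -sumrB.
    by apply: eq_bigr => z _; rewrite mulrzBl; congr (_ - _); rewrite !mulrzz mulrC eq_sym.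
  apply: (add_subgroup_trans sn (y := \sum_(z <- r) beta x n (h Kx z) *~ beta z n a)).
    apply: sum_widen_mod => // [z zr|z zr]; first by rewrite mem_undup !inE zr !orbT.
    apply: (add_subgroupMz sn); rewrite (h0 z zr).
    exact: (additive_mod0 sn (betaM x n n0)).
  have H1 := hK n n0 nK a; rewrite KxE /= in H1.
  have H2 := additive_modB sn (betaM x n n0) a (\sum_(z <- r) h Kx z *~ beta z n a).
  have H3 := (add_subgroup_congr sn H2).1 H1.
  apply: (add_subgroup_trans sn _ (add_subgroup_sym sn H3)).
  apply: (add_subgroup_sym sn).
  apply: (add_subgroup_trans sn (additive_mod_sum sn (betaM x n n0) _ _)).
  rewrite -sumrB; apply: (add_subgroup_sum sn) => z _.
  exact: (additive_modMz sn (betaM x n n0)).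
- move=> U n r oU n0 nU ur rU g; have sU := oU.2.
  have etaM := to_completion_additive oU.
  have [sW fW] := preimage_to_completion oU.
  have [N NE] := fin_index_of sW fW.
  have NU : (N : set A) `<=` @to_completion A @^-1` U by rewrite NE.
  (* [N'] is so small that the component of [g] in A / N' determines [g] modulo [U] and all its
     coordinates in [r] modulo n. So [g] may be replaced by an element [a] of A, and the
     decomposition of [a] modulo [N] gives the expansion. *)
  have [N' N'N N'K] : exists2 N' : fin_index_normal A, N' `<=` N &
      {in r, forall x, N' `<=` K x n}.
    elim: (r) => [|x s [N' N'N N'K]]; first by exists N.
    have [M ME] := fin_index_setI cA N' (K x n).
    exists M; rewrite ME; first by move=> z [/N'N].
    move=> y; rewrite inE => /predU1P[->|/N'K N'y] z [] // /N'y.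
    by [].
  pose a := rep N' g.
  have aE : set_val (g : P) N' = Q N' (a : A) by exact: completion_repE.
  have Uga : U (g - (to_completion (a : A) : ZP)).
    exact: (to_completion_congr oU (subset_trans N'N NU)).
  apply: (add_subgroup_trans sU Uga).
  have nN (b : ZA) : (N : set ZA) (b *+ n).
    rewrite NE; apply: (add_subgroup_congr sU (additive_modMn sU etaM b n)).2.
    exact: nU.
  have [s [us h0] hN] := hP N; rewrite -/(h N) in h0 hN.
  have Um (y : ZP) (m : int) : (n %| m)%Z -> U (y *~ m).
    by move=> /dvdzP[q ->]; rewrite mulrzA mulrzAC; apply: (add_subgroupMz sU); exact: nU.
  have H1 : U (to_completion ((a - \sum_(x <- s) h N x *~ beta x n a : ZA) : A)).
    by apply: NU; exact: hN.
  have H2 := (add_subgroup_congr sU (additive_modB sU etaM _ _)).1 H1.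
  apply: (add_subgroup_trans sU H2).
  apply: (add_subgroup_trans sU (additive_mod_sum sU etaM _ _)).
  apply: (add_subgroup_trans sU (y := \sum_(x <- s) (ix x : ZP) *~ beta x n a)).
    rewrite -sumrB; apply: (add_subgroup_sum sU) => x _.
    apply: (add_subgroup_trans sU (additive_modMz sU etaM _ _)).
    rewrite -mulrzBl; apply: (add_subgroupMz sU).
    by apply: (add_subgroup_sym sU); exact: h_exp.
  pose t := undup (r ++ s); have ut : uniq t by exact: undup_uniq.
  apply: (add_subgroup_trans sU (y := \sum_(x <- t) (ix x : ZP) *~ beta x n a)).
    apply: (add_subgroup_sym sU); apply: sum_widen_mod => // x.
      by move=> xs; rewrite mem_undup mem_cat xs orbT.
    move=> xs; apply: (add_subgroupMz sU).
    apply: (add_subgroup_congr sU (h_exp U x N oU NU)).2.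
    by apply: NU; rewrite [h N x]h0 //; exact: (add_subgroup0 (sN N)).
  apply: (add_subgroup_trans sU (y := \sum_(x <- r) (ix x : ZP) *~ beta x n a)).
    apply: sum_widen_mod => // x.
      by move=> xr; rewrite mem_undup mem_cat xr.
    move=> xr; apply: (add_subgroupMz sU); apply: contrapT => /rU.
    by rewrite (negbTE xr).
  rewrite -sumrB; apply: (add_subgroup_sum sU) => x xr.
  rewrite -mulrzBr; apply: Um; rewrite -opprB rpredN.
  by apply: (chiE x n _ N') => //; exact: N'K.
Qed.

Lemma completion_free : exists i : opc X -> P, free_profinite_abelian_on i.
Proof.
have [i [chi [ic i1 chiP]]] := completion_coordinates.
by exists i; exact: (coordinates_free ic i1 chiP).
Qed.

End CompletionFree.

(** * Coordinates and cardinality of free profinite abelian groups *)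

Section FiniteDiscrete.
Variables (K : groupType) (fK : finite_set [set: K]).

(** The alias carries the finiteness proof, which yields compactness. These groups are the test
    objects for the universal property. *)
Definition finite_discrete (_ : finite_set [set: K]) : Type := K.
Local Notation D := (finite_discrete fK).
HB.instance Definition _ := Group.copy D K.
HB.instance Definition _ := DiscreteTopology.copy D (discrete_topology K).

Let mul_continuous : continuous (fun x : D * D => (x.1 * x.2)%g).
Proof.
move=> [x y] U /nbhs_singleton /= Uxy.
exists ([set x], [set y]); first by split; exact: discrete_set1.
by move=> [z t] [/= -> ->].
Qed.

Let inv_continuous : continuous (fun x : D => x^-1%g).
Proof.
move=> x U /nbhs_singleton /= Ux.
change (nbhs x ((fun x : D => x^-1%g) @^-1` U)).
by apply: (@filterS _ _ (nbhs_filter x) _ _ _ (discrete_set1 x)) => _ ->.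
Qed.

HB.instance Definition _ :=
  PreTopologicalGroup_isTopologicalGroup.Build D mul_continuous inv_continuous.

HB.instance Definition _ := TopologicalGroup_isProfinite.Build D
  (finite_compact (fK : finite_set [set: D])) (@discrete_hausdorff D)
  (zero_dimension_totally_disconnected (@discrete_zero_dimension D)).

End FiniteDiscrete.

Section FreeCoordinates.
Variables (X : choiceType) (F : profiniteGroupType) (i : opc X -> F).
Hypothesis freeF : free_profinite_abelian_on i.

Lemma free_abelian : abelian_group F. Proof. by case: freeF. Qed.

Local Notation cF := free_abelian.
Local Notation Z := (zmod_of cF).

Let ic : continuous i. Proof. by case: freeF. Qed.
Let i1 : i None = 1%g. Proof. by case: freeF. Qed.

Lemma free_hom_eq (H : profiniteGroupType) (g g' : F -> H) : abelian_group H ->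
  {morph g : x y / (x * y)%g} -> {morph g' : x y / (x * y)%g} ->
  continuous g -> continuous g' -> (forall x, g (i (Some x)) = g' (i (Some x))) -> g = g'.
Proof.
move=> cH gM g'M gc g'c gg'; have [_ _ _ univ] := freeF.
have m1 (k : F -> H) : {morph k : x y / (x * y)%g} -> k 1%g = 1%g.
  by move=> kM; apply: (@mulgI _ (k 1%g)); rewrite -kM !mulg1.
have fc : continuous (g \o i).
  by move=> x; apply: continuous_comp; [exact: ic|exact: gc].
have [|k [_ kE]] := univ H (g \o i) cH fc; first by rewrite /= i1 m1.
rewrite -(kE g); last by split.
apply: kE; split=> // -[x|]; first exact: gg'.
by rewrite /= i1 !m1.
Qed.

(** The projection to the finite group F / W and the trivial homomorphism agree on the generators,
    so the universal property identifies them. Congruences that define open subgroups can thus be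
    checked on generators. *)
Lemma free_dense (W : set F) : open_subgroup cF W -> (forall x, W (i (Some x))) ->
  forall g, W g.
Proof.
move=> oW Wi; have [N NE] := fin_index_of oW.2 (open_subgroup_finite_index oW).
pose H : profiniteGroupType := finite_discrete (finite_quotient N).
have cH : abelian_group H.
  move=> x y; have [a ->] := quotient_surj (x : quotient_group N).
  have [b ->] := quotient_surj (y : quotient_group N).
  by rewrite /commute -!(@quotient_piM F N) cF.
pose q (g : F) : H := \pi_(quotient_group N) g.
have qM : {morph q : x y / (x * y)%g} by move=> x y; exact: quotient_piM.
have q1 x : q x = 1%g <-> W x.
  rewrite -NE -(@quotient_pi1 F N) /q (@quotient_eq_sub F cF) -zmod_of_0.
  by rewrite subr0.
have qc : continuous q.
  apply: (@hom_continuous F H cF cH) => // U oU.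
  have : nbhs (1%g : F) W by apply: open_nbhs_nbhs; split; [exact: oW.1|exact: (add_subgroup0 oW.2)].
  by apply: filterS => x /q1 qx; rewrite /preimage /= qx; exact: (add_subgroup0 oU.2).
have qE : q = fun=> 1%g.
  apply: free_hom_eq => //.
  - by move=> x y; rewrite mulg1.
  - by move=> x; exact: cvg_cst.
  - by move=> x; apply/q1.
by move=> g; apply/q1; rewrite qE.
Qed.

Let fin_ord n : finite_set [set: 'I_n.+1]. Proof. exact: finite_finset. Qed.

(** Note the shift: this cyclic group has order n + 1, and its product is [Zp_add]. *)
Let cyc n : profiniteGroupType := finite_discrete (fin_ord n).

Let cyc_abelian n : abelian_group (cyc n).
Proof.
move=> x y; change (Zp_add (x : 'I_n.+1) y = Zp_add (y : 'I_n.+1) x).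
exact: Zp_addC.
Qed.

Let coord_hom x n : exists g : F -> 'I_n.+1, [/\ forall a b, g (a * b)%g = Zp_add (g a) (g b),
  open [set a | g a = ord0] & forall y, g (i (Some y)) = if x == y then inZp 1 else ord0].
Proof.
have [_ _ _ univ] := freeF.
pose f (o : opc X) : cyc n := if o is Some y then if x == y then inZp 1 else ord0 else ord0.
have fc : continuous f.
  apply/(opc_continuousP (@cyc_abelian n)) => // U oU.
  apply: (@sub_finite_set _ _ [set x]); last exact: finite_set1.
  move=> y /=; have [->//|_] := eqVneq x y.
  by case; exact: (add_subgroup0 oU.2).
have [g [[gM gc gE] _]] := univ (cyc n) f (@cyc_abelian n) fc erefl.
exists g; split=> [a b||y]; first exact: gM.
- rewrite -[X in open X]/(g @^-1` [set ord0]); apply: open_comp; last exact: discrete_open.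
  by move=> a _; exact: gc.
- by rewrite -gE.
Qed.

(** The coordinate at [x] modulo n extends the map sending the generator at [x] to 1 and all others
    to 0. Compatibility and the expansion hold on open subgroups that contain the generators. *)
Lemma free_coordinates : exists chi : X -> nat -> Z -> int, coordinates i chi.
Proof.
pose chi x n (g : Z) : int := if n is m.+1 then (sval (cid (coord_hom x m)) g : nat) else 0.
have chiM x n : (0 < n)%N -> additive_mod (dvdset n) (chi x n).
  case: n => // n _ a b; rewrite /chi; case: cid => g /= [gM _ _].
  rewrite -[a + b]/(a * b)%g gM /=.
  rewrite /dvdset /= -addrA -opprD -eqz_mod_dvd -PoszD.
  by rewrite !modz_nat modn_mod.
have chi_open x n : (0 < n)%N -> open [set g : F | (n %| chi x n g)%Z].
  case: n => // n _; rewrite /chi; case: cid => g /= [_ go _].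
  suff -> : [set a : F | (n.+1 %| Posz (g a))%Z] = [set a | g a = ord0] by [].
  apply/seteqP; split=> a /=; last by move=> ->; rewrite dvdz0.
  rewrite dvdzE /= => /dvdnP[k gk]; apply/val_inj => /=.
  by move: gk (ltn_ord (g a)); case: k => [|k] ->; rewrite // mulSn ltnNge leq_addr.
have chi_delta x y n : (0 < n)%N -> (n %| chi x n (i (Some y)) - (x == y)%:Z)%Z.
  case: n => // n _; rewrite /chi; case: cid => g /= [_ _ ->].
  case: eqP => _ /=; last by rewrite subr0 dvdz0.
  by rewrite -eqz_mod_dvd !modz_nat modn_mod.
have chi_compat x n m g : (0 < m)%N -> (n %| m)%N -> (n %| chi x m g - chi x n g)%Z.
  move=> m0 nm; have n0 := dvdn_gt0 m0 nm; have sn := add_subgroup_dvdset n.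
  have nm' c : (m %| c)%Z -> (n %| c)%Z by apply: dvdz_trans.
  have eM : additive_mod (dvdset n) (fun g => chi x m g - chi x n g).
    move=> a b; have := rpredB (nm' _ (chiM x m m0 a b)) (chiM x n n0 a b).
    rewrite /dvdset /=; congr (_ %| _)%Z; ring.
  have sW := additive_mod_kernel sn eM.
  have oW : open_subgroup cF [set g : F | dvdset n (chi x m g - chi x n g)].
    split=> //; apply: (add_subgroup_open sW (O := [set g : F | (m %| chi x m g)%Z] `&` [set g : F | (n %| chi x n g)%Z])).
      apply: open_nbhs_nbhs; split; first by apply: openI; exact: chi_open.
      by split; [exact: (additive_mod0 (add_subgroup_dvdset m) (chiM x m m0))
                |exact: (additive_mod0 sn (chiM x n n0))].
    by move=> a [/nm' ma na]; exact: rpredB.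
  apply: (free_dense oW) => y /=.
  have := rpredB (nm' _ (chi_delta x y m m0)) (chi_delta x y n n0).
  rewrite /dvdset /=; congr (_ %| _)%Z; ring.
exists chi; split=> // U n r oU n0 nU ur rU.
have sU := oU.2; have sn := add_subgroup_dvdset n.
have Um (h : Z) (m : int) : (n %| m)%Z -> U (h *~ m).
  by move=> /dvdzP[q ->]; rewrite mulrzA mulrzAC; apply: (add_subgroupMz sU); exact: nU.
have eM : additive_mod (U : set Z) (fun g => g - \sum_(x <- r) (i (Some x) : Z) *~ chi x n g).
  move=> a b; pose s (g : Z) : Z := \sum_(x <- r) (i (Some x) : Z) *~ chi x n g.
  change (U (a + b - s (a + b) - (a - s a) - (b - s b))).
  have sM : U (s (a + b) - s a - s b).
    rewrite /s -!sumrB; apply: (add_subgroup_sum sU) => x _.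
    by rewrite -!mulrzBr; apply: Um; exact: chiM.
  have -> : a + b - s (a + b) - (a - s a) - (b - s b) = - (s (a + b) - s a - s b).
    rewrite !opprD !opprK !addrA [LHS](ACl ((1*4)*(2*6)*3*5*7))/=.
    by rewrite subrr add0r subrr add0r.
  exact: (add_subgroupN sU).
have sW := additive_mod_kernel sU eM.
have oW : open_subgroup cF [set g : F | U ((g : Z) - \sum_(x <- r) (i (Some x) : Z) *~ chi x n g)].
  split=> //.
  have nr : nbhs (1%g : F) [set g : F | {in r, forall x, (n %| chi x n g)%Z}].
    elim: (r) => [|x s IH]; first by apply: filterS filterT.
    have nx : nbhs (1%g : F) [set g : F | (n %| chi x n g)%Z].
      apply: open_nbhs_nbhs; split; first exact: chi_open.
      exact: (additive_mod0 sn (chiM x n n0)).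
    apply: filterS (filterI nx IH) => g [/= gx gs] y.
    by rewrite inE => /predU1P[->|/gs].
  have nU1 : nbhs (1%g : F) U.
    by apply: open_nbhs_nbhs; split; [exact: oU.1|exact: (add_subgroup0 sU)].
  apply: (add_subgroup_open sW (filterI nU1 nr)) => g [/= Ug gr].
  apply: (add_subgroupB sU) => //; apply: (add_subgroup_sum sU) => x xr.
  exact/Um/gr.
apply: (free_dense oW) => y /=.
have [yr|yr] := boolP (y \in r).
  rewrite -[U _]/(U ((i (Some y) : Z) - \sum_(x <- r) (i (Some x) : Z) *~ chi x n (i (Some y)))).
  rewrite -{1}(@sum_delta _ Z r (fun x => i (Some x)) y ur yr) -sumrB.
  apply: (add_subgroup_sum sU) => x xr; rewrite -mulrzBr; apply: Um.
  by rewrite -opprB rpredN; exact: chi_delta.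
have Uy : U (i (Some y)) by apply: contrapT => /rU; rewrite (negbTE yr).
apply: (add_subgroupB sU) => //; apply: (add_subgroup_sum sU) => x xr.
apply: Um; have := chi_delta x y n n0.
by case: eqP => [xy|_]; [rewrite -xy xr in yr|rewrite subr0].
Qed.

End FreeCoordinates.

Section FreeSize.
Variables (X : choiceType) (F : profiniteGroupType) (i : opc X -> F).
Hypotheses (freeF : free_profinite_abelian_on i) (infX : infinite_set [set: X]).

Local Notation cF := (free_abelian freeF).
Local Notation Z := (zmod_of cF).

Let coords : exists chi : X -> nat -> Z -> int, coordinates i chi := free_coordinates freeF.
Let chi := sval (cid coords).
Let chiP : coordinates i chi := svalP (cid coords).
Let chiM := coord_add chiP.

Let support (U : set F) : open_subgroup cF U -> exists2 r : seq X, uniq r &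
  forall x, ~ U (i (Some x)) -> x \in r.
Proof.
have [_ ic i1 _] := freeF.
move=> oU; have /finite_seqP[r rE] := (opc_continuousP cF i1).1 ic U oU.
exists (undup r); first exact: undup_uniq.
by move=> x nU; rewrite mem_undup; have : [set` r] x by rewrite -rE.
Qed.

Let UMz (U : set F) n (h : Z) (m : int) : open_subgroup cF U ->
  (forall h : Z, U (h *+ n)) -> (n %| m)%Z -> U (h *~ m).
Proof.
move=> [_ sU] nU /dvdzP[q ->]; rewrite mulrzA mulrzAC.
by apply: (add_subgroupMz sU); exact: nU.
Qed.

(* If p g = 0, then np divides p (chi x (np) g), so n divides chi x (np) g. *)
Lemma free_torsion_free : torsion_free Z.
Proof.
move=> p pp g gp; apply: (open_subgroup_separated (cH := cF)) => U oU; rewrite subr0.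
have sU := oU.2.
have [n n0 nU] := open_subgroup_exponent oU; have [r ur rU] := support oU.
have np0 : (0 < n * p)%N by rewrite muln_gt0 n0 prime_gt0.
have npU (h : Z) : U (h *+ (n * p)) by rewrite mulrnA; apply: (add_subgroupMn sU).
apply: (add_subgroup_congr sU (coord_expansion chiP oU np0 npU ur rU g)).2.
apply: (add_subgroup_sum sU) => x _; apply: (UMz _ oU nU).
have snp := add_subgroup_dvdset (n * p).
have : dvdset (n * p) (chi x (n * p)%N g *+ p).
  apply: (add_subgroup_congr snp (additive_modMn snp (chiM x np0) g p)).1.
  by rewrite gp; exact: (additive_mod0 snp (chiM x np0)).
rewrite /dvdset /= -mulr_natr natz PoszM dvdz_mul2r //.
by rewrite eqz_nat -lt0n prime_gt0.
Qed.

(** By the expansion, an element is determined by the residues of its coordinates. These form a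
    subset of a product of [X] with a countable set. *)
Lemma free_embeds_set : embeds F (set X).
Proof.
have XX : embeds (X * (nat * int)) X.
  by apply: embeds_prod_infinite => //; [exists id|exact: embeds_countable].
apply: embeds_trans (embeds_set XX).
exists (fun g => [set t | (0 < t.2.1)%N /\ (t.2.1 %| chi t.1 t.2.1 g - t.2.2)%Z]) => g h gh.
apply: (@open_subgroup_separated F cF) => U oU; have sU := oU.2.
have [n n0 nU] := open_subgroup_exponent oU; have [r ur rU] := support oU.
apply: (add_subgroup_trans sU (coord_expansion chiP oU n0 nU ur rU g)).
apply: (add_subgroup_trans sU _ (add_subgroup_sym sU (coord_expansion chiP oU n0 nU ur rU h))).
rewrite -sumrB; apply: (add_subgroup_sum sU) => x _; rewrite -mulrzBr; apply: (UMz _ oU nU).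
have : [set t : X * (nat * int) | (0 < t.2.1)%N /\ (t.2.1 %| chi t.1 t.2.1 h - t.2.2)%Z] (x, (n, chi x n h)).
  by split=> //=; rewrite subrr dvdz0.
by rewrite -gh => -[].
Qed.

(** Some element has the indicator of [S] as its coordinates modulo p: finite sums of generators
    meet any finite number of these conditions, and compactness does the rest. *)
Lemma set_embeds_free_modp p : prime p ->
  exists f : set X -> Z, forall S S', multiples p (f S - f S') -> S = S'.
Proof.
move=> pp; have p0 := prime_gt0 pp; have sp := add_subgroup_dvdset p.
have cptF : compact [set: F] by exact: profinite_compact.
have char_ex (S : set X) : exists g : Z, forall x, (p %| chi x p g - (`[< S x >] : nat)%:Z)%Z.
  pose V (r : seq X) : set F := [set g : F | forall x, x \in r -> (p %| chi x p g - (`[< S x >] : nat)%:Z)%Z].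
  pose G := filter_from [set: seq X] V.
  have GF : ProperFilter G.
    apply: filter_from_proper; last first.
      move=> r _; pose s := undup r; have us : uniq s by exact: undup_uniq.
      exists (\sum_(y <- s) (i (Some y) : Z) *~ (`[< S y >] : nat)%:Z) => x xr.
      have xs : x \in s by rewrite mem_undup.
      apply: (add_subgroup_trans sp (additive_mod_sum sp (chiM x p0) s _)).
      rewrite -[X in _ - X](sum_delta (fun y => (`[< S y >] : nat)%:Z) us xs) -sumrB.
      apply: (add_subgroup_sum sp) => y _.
      apply: (add_subgroup_trans sp (additive_modMz sp (chiM x p0) _ _)).
      have := coord_delta chiP x y p0 => /(dvdz_mulr (`[< S y >] : nat)%:Z).
      by rewrite mulrBl /dvdset /= !mulrzz eq_sym [_ * (y == x)%:Z]mulrC.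
    apply: filter_from_filter; first by exists [::].
    move=> r s _ _; exists (r ++ s) => // g Vg.
    by split=> x xr; apply: Vg; rewrite mem_cat xr ?orbT.
  have [g [_ cg]] := cptF G GF filterT.
  exists g => x; have GV : G (V [:: x]) by exists [:: x].
  have oK : open_subgroup cF [set h : F | (p %| chi x p h)%Z].
    by split; [exact: (coord_open chiP)|exact: (additive_mod_kernel sp (chiM x p0))].
  have [h [/= Vh gh]] := cg _ _ GV (open_subgroup_nbhs (g : Z) oK).
  have H1 := additive_modB sp (chiM x p0) h g.
  have H2 := (add_subgroup_congr sp H1).1 gh.
  have Vx := Vh x (mem_head _ _).
  exact: (add_subgroup_trans sp (add_subgroup_sym sp H2) Vx).
exists (fun S => sval (cid (char_ex S))) => S S'.
case: cid => g /= gS; case: cid => g' /= g'S' [y _ yg].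
have gg x : dvdset p (chi x p g - chi x p g').
  apply: (add_subgroup_congr sp (additive_modB sp (chiM x p0) g g')).1.
  rewrite -yg; apply: (add_subgroup_congr sp (additive_modMn sp (chiM x p0) y p)).2.
  by rewrite /dvdset /= -mulr_natr natz dvdz_mull.
apply/funext => x; apply/propext; suff e : `[< S x >] = `[< S' x >].
  by split=> /asboolP; [rewrite e|rewrite -e] => /asboolP.
have := add_subgroup_trans sp (add_subgroup_trans sp (add_subgroup_sym sp (gS x)) (gg x)) (g'S' x).
case: `[< S x >]; case: `[< S' x >] => //; rewrite /dvdset /= ?subr0 ?sub0r ?dvdzN dvdzE /= dvdn1;
  by move=> /eqP p1; move: pp; rewrite p1.
Qed.

Lemma set_embeds_free : embeds (set X) F.
Proof.
have [f fI] := set_embeds_free_modp (isT : prime 2).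
exists f => S S' e; apply: fI; rewrite e subrr; exists 0 => //.
by rewrite mul0rn.
Qed.

(** An embedding of [F] in [set X], followed by one of [set X] in F / pF, is the required
    self-map. *)
Lemma free_rich : rich Z.
Proof.
split; first exact: free_torsion_free.
- apply: (infinite_embedsW infX); apply: embeds_trans set_embeds_free.
  by exists set1 => a b /seteqP[/(_ a erefl)].
- move=> p /set_embeds_free_modp[f fI]; have [g gI] := free_embeds_set.
  by exists (fun a => f (g a)) => a b /fI /gI.
Qed.

Lemma open_normal_subgroupP (U : set F) :
  open_normal_subgroups F U <-> open_subgroup cF U.
Proof.
by split=> -[oU nU]; split=> //; exact/(normal_subgroup_zmod cF).
Qed.

(** An open subgroup is described by finite data over [X], and [X] is infinite; conversely each x in
    [X] has its own open subgroup of index 2. *)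
Lemma free_card_open_normal : ([set: X] #= open_normal_subgroups F)%card.
Proof.
have XU : embeds X {U | open_normal_subgroups F U}.
  (* The kernel of the coordinate at [x] modulo 2 contains every generator except the one at [x], so
     these subgroups are distinct. *)
  have oK x : open_normal_subgroups F [set g : F | (2%N %| chi x 2%N g)%Z].
    apply/open_normal_subgroupP; split; first exact: (coord_open chiP).
    exact: (additive_mod_kernel (add_subgroup_dvdset 2) (chiM x (isT : (0 < 2)%N))).
  exists (fun x => exist _ _ (oK x)) => x y /(congr1 sval) /= xy.
  apply/eqP/negPn/negP => nxy.
  have : [set g : F | (2%N %| chi y 2%N g)%Z] (i (Some x)).
    have := coord_delta chiP y x (isT : (0 < 2)%N).
    by rewrite eq_sym (negbTE nxy) subr0.
  rewrite -xy /= => H; have := rpredB H (coord_delta chiP x x (isT : (0 < 2)%N)).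
  by rewrite eqxx opprB addrC subrK.
have UX : embeds {U | open_normal_subgroups F U} X.
  have dataX : embeds (seq X * (nat * seq bool)) X.
    apply: embeds_prod_infinite => //; first by apply: embeds_seq => //; exists id.
    exact: embeds_countable.
  apply: embeds_trans dataX.
  (* The bits record which words in the generators of [r], with coefficients below n, lie in [U]. If
     n and [r] suit [U], every element is such a word modulo [U], so [U] is determined. *)
  pose bits (r : seq X) (n : nat) (U : set F) :=
    [seq `[< U (\sum_(t <- zip r (w : (size r).-tuple 'I_n)) (i (Some t.1) : Z) *+ (t.2 : 'I_n)) >] |
      w <- enum {: (size r).-tuple 'I_n}].
  have par (U : {U | open_normal_subgroups F U}) : exists rn : seq X * nat,
      [/\ (0 < rn.2)%N, uniq rn.1, forall g : Z, sval U (g *+ rn.2) &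
          forall x, ~ sval U (i (Some x)) -> x \in rn.1].
    case: U => U /= /open_normal_subgroupP oU.
    have [n n0 nU] := open_subgroup_exponent oU; have [r ur rU] := support oU.
    by exists (r, n).
  have bitsP (U U' : {U | open_normal_subgroups F U}) r n : (0 < n)%N -> uniq r ->
      (forall g : Z, sval U (g *+ n)) -> (forall x, ~ sval U (i (Some x)) -> x \in r) ->
      (forall g : Z, sval U' (g *+ n)) -> (forall x, ~ sval U' (i (Some x)) -> x \in r) ->
      bits r n (sval U) = bits r n (sval U') -> sval U `<=` sval U'.
    case: U => U /= /open_normal_subgroupP oU; case: U' => U' /= /open_normal_subgroupP oU'.
    move=> n0 ur nU rU nU' rU' /eq_in_map bb g Ug.
    have m0 z : (0 <= z %% n)%Z by rewrite modz_ge0 // eqz_nat -lt0n.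
    have pE (z : int) : (`|(z %% n)%Z|%N < n)%N.
      by rewrite -ltz_nat gez0_abs ?m0 // ltz_pmod // ltz_nat.
    pose w := [tuple of map (fun x => Ordinal (pE (chi x n g))) (in_tuple r)].
    have word (V : set F) : open_subgroup cF V -> (forall g : Z, V (g *+ n)) ->
        (forall x, ~ V (i (Some x)) -> x \in r) ->
        V (g : F) <-> V (\sum_(t <- zip r w) (i (Some t.1) : Z) *+ (t.2 : 'I_n)).
      move=> oV nV rV; have sV := oV.2; apply: (add_subgroup_congr sV).
      apply: (add_subgroup_trans sV (coord_expansion chiP oV n0 nV ur rV g)).
      have -> : zip r w = [seq (x, Ordinal (pE (chi x n g))) | x <- r].
        by rewrite /= -[X in zip X _]map_id zip_map.
      rewrite big_map -sumrB; apply: (add_subgroup_sum sV) => x _ /=.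
      rewrite pmulrn -mulrzBr; apply: (UMz _ oV nV).
      by rewrite gez0_abs // -eqz_mod_dvd modz_mod.
    have := bb w (mem_enum _ _).
    have /asboolP -> := (word U oU nU rU).1 Ug.
    move=> /esym/asboolP /(word U' oU' nU' rU'); exact.
  exists (fun U => let rn := sval (cid (par U)) in (rn.1, (rn.2, bits rn.1 rn.2 (sval U)))).
  move=> U U'; case: cid => -[r n] /= [n0 ur nU rU]; case: cid => -[r' n'] /= [_ _ nU' rU'].
  case=> er en; subst r' n' => bb.
  have UU : sval U = sval U'.
    by apply/seteqP; split; [apply: (bitsP U U' r n)|apply: (bitsP U' U r n)].
  by case: U U' UU {nU rU nU' rU' bb} => [U hU] [U' hU'] /= UU; exact: eq_exist.
have [f [g fK gK]] := embeds_bijective XU UX.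
have -> : open_normal_subgroups F = range (fun x => sval (f x)).
  apply/seteqP; split=> [U oU|_ [x _ <-]]; last exact: svalP (f x).
  by exists (g (exist _ U oU)) => //; rewrite gK.
apply/card_esym; apply: inj_card_eq => x y _ _ /eq_sig_hprop e.
by apply: (can_inj fK); apply: e => ?; exact: Prop_irrelevance.
Qed.

Lemma free_profinite_rank : free_profinite_abelian_of_rank (open_normal_subgroups F) F.
Proof.
split; last by exists X; [exact: free_card_open_normal|exists i].
move=> finU; apply: infX; move: free_card_open_normal.
by rewrite card_eq_le => /andP[/card_le_finite + _]; apply.
Qed.

End FreeSize.

(** * The tower of completions *)

Lemma zmod_of_mulrn (G : groupType) (cG : abelian_group G) (x : zmod_of cG) n :
  x *+ n = ((x : G) ^+ n)%g :> G.
Proof. by elim: n => // n IH; rewrite mulrS expgS -IH. Qed.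

Lemma morph_group1 (G H : groupType) (f : G -> H) : {morph f : x y / (x * y)%g} ->
  f 1%g = 1%g.
Proof. by move=> fM; apply: (@mulgI _ (f 1%g)); rewrite -fM !mulg1. Qed.

Lemma morph_groupX (G H : groupType) (f : G -> H) n : {morph f : x y / (x * y)%g} ->
  {morph f : x / (x ^+ n)%g}.
Proof.
move=> fM x; elim: n => [|n IH]; first by rewrite !expg0 (morph_group1 fM).
by rewrite !expgS fM IH.
Qed.

Lemma iso_free (X : choiceType) (F F' : profiniteGroupType) (i : opc X -> F) (theta : F -> F') :
  topological_group_iso theta -> free_profinite_abelian_on i ->
  free_profinite_abelian_on (theta \o i).
Proof.
move=> [tM [tc [k kc [tK kK]]]] [cF ic i1 univ].
have kM : {morph k : x y / (x * y)%g}.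
  by move=> x y; apply: (can_inj tK); rewrite tM !kK.
split.
- by move=> x y; apply: (can_inj kK); rewrite !kM cF.
- by move=> x; apply: continuous_comp; [exact: ic|exact: tc].
- by rewrite /= i1 (morph_group1 tM).
- move=> H f cH fc f1; have [g [[gM gc gf] gu]] := univ H f cH fc f1.
  exists (g \o k); split.
    split; first by move=> x y; rewrite /= kM gM.
      by move=> x; apply: continuous_comp; [exact: kc|exact: gc].
    by move=> x; rewrite /= tK.
  move=> g' [g'M g'c g'f]; have -> : g = g' \o theta.
    apply: gu; split; first by move=> x y; rewrite /= tM g'M.
      by move=> x; apply: continuous_comp; [exact: tc|exact: g'c].
    exact: g'f.
  by apply/funext => x; rewrite /= kK.
Qed.

(** For a homomorphism of abelian groups, this is injectivity of the induced map modulo p. *)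
Definition pure (p : nat) (G H : groupType) (f : G -> H) : Prop :=
  forall x y, f x = (y ^+ p)%g -> exists z, x = (z ^+ p)%g.

Section CompletionStep.
Variables (A : groupType) (cA : abelian_group A) (P : profiniteGroupType) (f : A -> P).
Hypotheses (richA : rich (zmod_of cA)) (compl : is_profinite_completion f).

Lemma is_completion_free : exists i : opc (set A) -> P, free_profinite_abelian_on i.
Proof.
have [i freei] := completion_free richA; have [theta iso _] := compl.
by exists (theta \o i); exact: iso_free.
Qed.

Lemma is_completion_pure p : prime p -> pure p f.
Proof.
move=> pp x y fxy; have [theta [tM [_ [k _ [tK kK]]]] tf] := compl.
have [tfA _ _] := richA.
have [|z _ zx] := @completion_pure A cA p x tfA pp.
  exists (k y) => //; rewrite zmod_of_mulrn; apply: (can_inj tK).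
  by rewrite tf fxy (morph_groupX _ tM) kK.
by exists z; rewrite -zx zmod_of_mulrn.
Qed.

(* Otherwise P would embed in A, as A -> P / pP would be onto; but P contains a
   copy of the power set of the power set of A. *)
Lemma is_completion_not_surjective p : prime p ->
  exists y : P, forall x z, y <> (f x * z ^+ p)%g.
Proof.
move=> pp; apply: contrapT => nex.
have [i freei] := is_completion_free.
have [_ infA _] := richA.
have A_set : embeds A (set A) by exists set1 => a b /seteqP[/(_ a erefl)].
have infX : infinite_set [set: set A] := infinite_embedsW infA A_set.
have [_ _ /(_ p pp)[g gI]] := free_rich freei infX.
have xex t : exists x z, (g t : P) = (f x * z ^+ p)%g.
  apply: contrapT => nx; apply: nex; exists (g t) => x z e; apply: nx.
  by exists x, z.
have PA : embeds P A.
  exists (fun t => sval (cid (xex t))) => t u; case: cid => x [z /= xz].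
  case: cid => x' [z' /= xz'] xx; apply: gI; rewrite -xx in xz'.
  rewrite xz xz'; pose ZP := zmod_of (free_abelian freei).
  exists ((z : ZP) - (z' : ZP)) => //; rewrite mulrnBl.
  have zE (w : ZP) : (f x * (w : P) ^+ p)%g = (w *+ p + (f x : ZP) : ZP).
    rewrite addrC; change ((f x * (w : P) ^+ p)%g = (f x * ((w *+ p : ZP) : P))%g).
    by rewrite zmod_of_mulrn.
  by rewrite !zE [X in _ = _ - X]addrC (@addrKA ZP).
apply: (@Cantor_embeds A); apply: embeds_trans PA.
apply: (embeds_trans _ (set_embeds_free freei)).
by exists set1 => a b /seteqP[/(_ a erefl)].
Qed.

End CompletionStep.

(** * Direct limits of rich groups *)

Section DirectLimitRich.
Variables (d : Order.disp_t) (J : orderType d) (S : group_system J).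
Variable J0 : [set: J] !=set0.
Local Notation L := (direct_limit S J0).
Local Notation phi := (@system_map d J S).

Hypothesis cS : forall j, abelian_group (S j).
Hypothesis richS : forall j, rich (zmod_of (@cS j)).
Hypothesis pureS : forall p j k (jk : (j <= k)%O), prime p -> pure p (phi jk).
Hypothesis growS : forall p j, prime p -> exists t : {k : J & S k},
  [/\ (j <= tag t)%O, forall l, (j < l)%O -> (tag t <= l)%O &
      forall (jk : (j <= tag t)%O) x z, tagged t <> (phi jk x * z ^+ p)%g].

Let limM j : {morph @to_limit _ _ S J0 j : x y / (x * y)%g} := @to_limitM _ _ S J0 j.

Let limX j n (x : S j) : to_limit J0 (x ^+ n)%g = (to_limit J0 x ^+ n)%g.
Proof. exact: (morph_groupX n (@limM j)). Qed.

Lemma direct_limit_abelian : abelian_group L.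
Proof.
move=> u v; have [j [x ->]] := to_limit_surj u; have [k [y ->]] := to_limit_surj v.
have jl : (j <= Order.max j k)%O by rewrite le_max lexx.
have kl : (k <= Order.max j k)%O by rewrite le_max lexx orbT.
rewrite -(to_limit_map J0 jl x) -(to_limit_map J0 kl y) /commute -!limM.
by rewrite (cS _).
Qed.

Local Notation ZL := (zmod_of direct_limit_abelian).

Lemma to_limit_pure p j : prime p -> pure p (@to_limit _ _ S J0 j).
Proof.
move=> pp x u; have [k [y ->]] := to_limit_surj u; rewrite -limX.
move=> /to_limit_eqP[l [jl [kl]]].
by rewrite (morph_groupX p (system_mapM kl)) => /(@pureS p _ _ jl pp).
Qed.

Lemma direct_limit_torsion_free : torsion_free ZL.
Proof.
move=> p pp u; have [j [x ->]] := to_limit_surj u; rewrite zmod_of_mulrn.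
rewrite -limX zmod_of_0 -(morph_group1 (@limM j)) => /to_limit_eqP[l [jl [jl']]].
rewrite (morph_groupX p (system_mapM jl)) (morph_group1 (system_mapM jl')) => xp.
have [tf _ _] := richS l.
have := tf p pp (phi jl x); rewrite zmod_of_mulrn xp => /(_ erefl) e.
by rewrite -(to_limit_map J0 jl) e (morph_group1 (@limM l)) (morph_group1 (@limM j)).
Qed.

Let limB j (x y : S j) : (to_limit J0 x : ZL) - (to_limit J0 y : ZL) =
  to_limit J0 (((x : zmod_of (@cS j)) - (y : zmod_of (@cS j)) : zmod_of (@cS j)) : S j).
Proof.
apply/eqP; rewrite (@subr_eq ZL); apply/eqP.
rewrite -[RHS]/(to_limit J0 _ * to_limit J0 y)%g -limM; congr to_limit.
exact: (esym (subrK (y : zmod_of (@cS j)) x)).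
Qed.

Let lim_multiples p j (x y : S j) : prime p ->
  multiples p ((to_limit J0 x : ZL) - (to_limit J0 y : ZL)) ->
  multiples p ((x : zmod_of (@cS j)) - (y : zmod_of (@cS j))).
Proof.
move=> pp [u _]; rewrite zmod_of_mulrn limB => /esym /(to_limit_pure pp)[z ->].
by exists z; rewrite ?zmod_of_mulrn.
Qed.

Section ModP.
Variables (p : nat) (pp : prime p).

Let sp := add_subgroup_multiples ZL p.

(** A representative of the class of [u] modulo p: congruent elements define the same set, and
    [xget] depends on the set alone. The type [R] of representatives stands for L / pL. *)
Let canon (u : ZL) : ZL := xget 0 [set v | multiples p (u - v)].

Let canonP u : multiples p (u - canon u).
Proof.
rewrite /canon; case: xgetP => // /(_ u) []; rewrite /= subrr.
exact: (add_subgroup0 sp).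
Qed.

Let canon_eq u v : multiples p (u - v) -> canon u = canon v.
Proof.
move=> uv; congr xget; apply/seteqP; split=> w /= Hw.
  by apply: (add_subgroup_trans sp (add_subgroup_sym sp uv)).
by apply: (add_subgroup_trans sp uv).
Qed.

Let R := {v : ZL | exists u, v = canon u}.

Let R_eq (v w : R) : multiples p (sval v - sval w) -> v = w.
Proof.
case: v w => v [u vu] [w [u' wu]] /= vw.
apply: eq_exist => /=; rewrite vu wu; apply: canon_eq.
apply: (add_subgroup_trans sp (canonP u)); rewrite -vu.
by apply: (add_subgroup_trans sp vw); rewrite wu; apply/(add_subgroup_sym sp)/canonP.
Qed.

Let toR (u : ZL) : R := exist _ (canon u) (ex_intro _ u erefl).

Let toR_inj u v : toR u = toR v -> multiples p (u - v).
Proof.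
move=> /(congr1 sval) /= e; apply: (add_subgroup_trans sp (canonP u)).
by rewrite e; apply/(add_subgroup_sym sp)/canonP.
Qed.

Lemma stage_embeds_modp j : exists f : S j -> ZL, forall x y, multiples p (f x - f y) -> x = y.
Proof.
have [_ _ /(_ p pp)[f fI]] := richS j.
by exists (fun x => to_limit J0 (f x)) => x y /(lim_multiples pp) /fI.
Qed.

Let infR : infinite_set [set: R].
Proof.
have [j _] := J0; have [_ infj _] := richS j; apply: (infinite_embedsW infj).
have [f fI] := stage_embeds_modp j.
by exists (fun x => toR (f x)) => x y /toR_inj /fI.
Qed.

(* For the successor k of j, some element of S k lies outside the image of S j
   modulo p; by purity these elements stay incongruent modulo p in the limit. *)
Let index_inj : exists f : J -> ZL, forall j k, multiples p (f j - f k) -> j = k.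
Proof.
pose t j := sval (cid (growS j pp)).
exists (fun j => to_limit J0 (tagged (t j))) => j k.
wlog jk : j k / (j < k)%O.
  move=> W; case: (ltgtP j k) => // [|kj /(add_subgroup_sym sp)/W ->//]; exact: W.
rewrite /t; case: cid => -[g y] /= [_ gmin _]; case: cid => -[h z] /= [kh _ zP].
have gk := gmin k jk.
rewrite -(to_limit_map J0 (le_trans gk kh)) -(system_map_comp gk kh).
move=> /(lim_multiples pp)[w _ e]; case: (zP kh (phi gk y) (w^-1)%g).
rewrite -(zmod_of_mulrn (w^-1%g : zmod_of (@cS h))).
change (z = (phi kh (phi gk y) : zmod_of (@cS h)) + (- (w : zmod_of (@cS h))) *+ p).
by rewrite mulNrn e opprB addrC subrK.
Qed.

(* |L| <= |J| * sup |S j|, and both factors are at most |L / pL|, represented by R. *)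
Lemma direct_limit_rich_modp :
  exists f : ZL -> ZL, forall u v, multiples p (f u - f v) -> u = v.
Proof.
have [f fI] := index_inj.
have [g gI] : {g : forall j, S j -> ZL | forall j x y, multiples p (g j x - g j y) -> x = y}.
  exists (fun j => sval (cid (stage_embeds_modp j))) => j; exact: svalP (cid (stage_embeds_modp j)).
have LR : embeds ZL R.
  apply: embeds_trans (embeds_square infR).
  have H (u : ZL) : exists t : {j : J & S j}, u = to_limit J0 (tagged t).
    by have [j [x ->]] := to_limit_surj u; exists (existT _ j x).
  exists (fun u => let t := sval (cid (H u)) in (toR (f (tag t)), toR (g (tag t) (tagged t)))).
  move=> u v; case: cid => -[j x] /= ->; case: cid => -[k y] /= -> [fe ge].
  (* The first component recovers the stage; only then can the second be compared within that
     stage. *)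
  have jk : j = k by apply: fI; apply: toR_inj; apply: eq_exist.
  subst k; congr to_limit; apply: gI; apply: toR_inj; exact: eq_exist.
have [r rI] := LR.
by exists (fun u => sval (r u)) => u v /R_eq /rI.
Qed.

End ModP.

Lemma direct_limit_rich : rich ZL.
Proof.
split; [exact: direct_limit_torsion_free| |exact: direct_limit_rich_modp].
have [j _] := J0; have [_ infj _] := richS j; apply: (infinite_embedsW infj).
have [f fI] := stage_embeds_modp (isT : prime 2) j; exists f => x y e.
by apply: fI; rewrite e subrr; exists 0; rewrite // mul0rn.
Qed.

End DirectLimitRich.

(** * Transfinite induction along the tower *)

Section Tower.
Variables (d : Order.disp_t) (I : orderType d).
Hypothesis wo : well_order (fun x y : I => (x <= y)%O).
Variables (G : profiniteGroupType) (X : choiceType).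
Hypothesis freeG : free_profinite_abelian_of_rank [set: X] G.
Variables (T : profinite_system I).
Hypothesis towerT : completion_tower G T.

Local Notation phi := (@profinite_map d I T).

Let min_ex (A : I -> Prop) : (exists a, A a) -> exists2 a, A a & forall b, A b -> (a <= b)%O.
Proof.
move=> [a Aa]; have [|z [[zA zmin] _]] := wo (A := fun x => `[< A x >]).
  by exists a; apply/asboolP.
exists z; first exact/asboolP.
by move=> b Ab; apply: zmin; apply/asboolP.
Qed.

(** The induction hypothesis includes purity of the maps into stage [a], which limit stages require
    in order to keep classes modulo p apart. *)
Let good a := (exists (Y : choiceType) (i : opc Y -> T a),
    infinite_set [set: Y] /\ free_profinite_abelian_on i) /\
  forall p b (ba : (b <= a)%O), prime p -> pure p (phi ba).

Let good_abelian a : good a -> abelian_group (T a).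
Proof. by move=> [[Y [i [_ []]]]]. Qed.

Let good_rich a (ga : good a) : rich (zmod_of (good_abelian ga)).
Proof.
have [[Y [i [infY fi]]] _] := ga.
by rewrite (Prop_irrelevance (good_abelian ga) (free_abelian fi)); exact: free_rich.
Qed.

Let pure_id a p (aa : (a <= a)%O) : pure p (phi aa).
Proof. by move=> x y; rewrite profinite_map_id => ->; exists y. Qed.

Let completion_good (A : groupType) (cA : abelian_group A) a (f : A -> T a) :
  rich (zmod_of cA) -> is_profinite_completion f ->
  exists (Y : choiceType) (i : opc Y -> T a),
    infinite_set [set: Y] /\ free_profinite_abelian_on i.
Proof.
move=> richA compl; have [i fi] := is_completion_free richA compl.
exists (set A), i; split=> //; have [_ infA _] := richA.
by apply: (infinite_embedsW infA); exists set1 => x y /seteqP[/(_ x erefl)].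
Qed.

Let good_zero a : is_zero a -> good a.
Proof.
move=> a0; have [zeroT _ _] := towerT; have [theta iso] := zeroT a a0.
have [infX [X0 X0X [i fi]]] := freeG.
split.
  exists X0, (theta \o i); split; last exact: iso_free.
  move=> fX0; apply: infX; apply: (card_le_finite _ fX0).
  by move: X0X; rewrite card_eq_le => /andP[].
move=> p b ba pp; have ab : b = a by apply/le_anti; rewrite ba a0.
by subst b; exact: pure_id.
Qed.

(** A map from an earlier stage factors through stage [b], and purity of its two factors gives
    purity of the composite. *)
Let good_succ b a : is_succ b a -> good b -> good a.
Proof.
move=> sb gb; have [_ succT _] := towerT; have ba := ltW (proj1 sb).
have compl := succT b a ba sb; have richb := good_rich gb.
split; first exact: completion_good richb compl.
move=> p c ca pp; have [ca'|] := eqVneq c a; first by subst c; exact: pure_id.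
move=> nca; have cb : (c <= b)%O.
  rewrite leNgt; apply/negP => /(proj2 sb) ac.
  by move/eqP: nca; apply; apply/le_anti; rewrite ca ac.
move=> x y; rewrite -(profinite_map_comp cb ba) => /(is_completion_pure richb compl pp)[z].
by have [_ pureb] := gb; exact: pureb.
Qed.

Let good_limit a : is_limit a -> (forall b, (b < a)%O -> good b) -> good a.
Proof.
move=> la IH; have [_ succT /(_ a la)[f compl fE]] := towerT.
pose S := below_system T a.
pose J0 := below_limit_neq0 la.
have gS (j : initial_segment a) : good (val j) := IH _ (valP j).
pose cS (j : initial_segment a) : abelian_group (S j) := good_abelian (gS j).
have richS (j : initial_segment a) : rich (zmod_of (cS j)) := good_rich (gS j).
have pureS p (j k : initial_segment a) (jk : (j <= k)%O) : prime p -> pure p (@system_map _ _ S j k jk).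
  by move=> pp; have [_] := gS k; apply.
have growS p (j : initial_segment a) : prime p -> exists t : {k : initial_segment a & S k},
    [/\ (j <= tag t)%O, forall l, (j < l)%O -> (tag t <= l)%O &
      forall (jk : (j <= tag t)%O) x z, tagged t <> (@system_map _ _ S _ _ jk x * z ^+ p)%g].
  (* The successor [c] of [j] is still below [a], as [a] is a limit. Stage [c] is the completion of
     stage [j], whose canonical map is not onto modulo p. *)
  move=> pp; have [c jc cmin] := @min_ex (fun c => (val j < c)%O) (ex_intro _ a (valP j)).
  have sc : is_succ (val j) c by split.
  have ca : (c < a)%O.
    rewrite lt_neqAle cmin ?andbT; last exact: (valP j).
    by apply/eqP => ca; have [_ /(_ (val j))] := la; apply; move: sc; rewrite ca.
  have compl' := succT _ _ (ltW jc) sc.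
  have [y yP] := is_completion_not_surjective (richS j) compl' pp.
  exists (existT _ (exist _ c ca : initial_segment a) y); split.
  - exact: (ltW jc).
  - by move=> l jl; exact: cmin.
  - move=> jk x z; rewrite (bool_irrelevance (ltW jc) jk) in yP; exact: yP.
have richL := direct_limit_rich J0 richS pureS growS.
split; first exact: (completion_good richL compl).
move=> p b ba pp; have [ba'|nba] := eqVneq b a; first by subst b; exact: pure_id.
have ltba : (b < a)%O by rewrite lt_neqAle nba.
move=> x y; pose j : initial_segment a := exist _ b ltba.
rewrite (bool_irrelevance ba (ltW (valP j))) -(fE j) => /(is_completion_pure richL compl pp)[z].
by move=> /(@to_limit_pure _ _ S J0 pureS p j pp x z).
Qed.

Lemma completion_tower_free a : exists (Y : choiceType) (i : opc Y -> T a),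
  infinite_set [set: Y] /\ free_profinite_abelian_on i.
Proof.
suff [] : good a by [].
apply: contrapT => nga.
have [c nc cmin] := @min_ex (fun c => ~ good c) (ex_intro _ a nga).
apply: nc; have IH b : (b < c)%O -> good b.
  by move=> bc; apply: contrapT => /cmin; rewrite leNgt bc.
have [c0|nc0] := pselect (is_zero c); first exact: good_zero.
have [[b sb]|ns] := pselect (exists b, is_succ b c).
  by apply: (good_succ sb); apply: IH; case: sb.
by apply: good_limit => //; split=> // b sb; apply: ns; exists b.
Qed.

End Tower.

Theorem theorem26
    (G : profiniteGroupType) (X : choiceType)
    (hG : free_profinite_abelian_of_rank [set: X]%classic G)
    (d : Order.disp_t) (I : orderType d)
    (hI : well_order (fun x y : I => x <= y)%O)
    (T : profinite_system I) (hT : completion_tower G T) (alpha : I) :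
  free_profinite_abelian_of_rank (open_normal_subgroups (T alpha)) (T alpha).
Proof.
have [Y [i [infY fi]]] := completion_tower_free hI hG hT alpha.
exact: free_profinite_rank fi infY.
Qed.
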